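(* Let $A$ satisfy the assumptions (A1)--(A5) listed in the context, let $\delta=\inf\{|\lambda_m-\lambda_n|: m\ne n\in\mathbb Z\}$, and let $B\in\mathfrak S_2(H)$ with $\|B\|_2<\frac{\delta}{4}$. Put $$\Phi(X)=B\,\Gamma X-(\Gamma X)(JB)-(\Gamma X)J(B\,\Gamma X)+B,\qquad X\in\mathfrak S_2(H).$$ Let $X_*\in\mathfrak S_2(H)$ be the limit of the simple iterations $X_0=0$, $X_1=\Phi(X_0)=B$, etc. (this limit exists), and let $U=\Gamma X_*$, $V=JX_*$. Then: (1) $U,V\in\mathfrak S_2(H)$, the operator $A-B$ is similar to the operator $A-V$, and the similarity transform is given by $I+U$: $$(A-B)(I+U)=(I+U)(A-V).$$ (2) The matrix of $V$ is diagonal, i.e. $P_mVP_n=0$ for $m\ne n$, and the spectral projections $P'_n=(I+U)P_n(I+U)^{-1}$, $n\in\mathbb Z$, of the operator $A-B$ form a resolution of the identity. (3) $\sigma(A-B)=\bigcup_{n\in\mathbb Z}\{\lambda_n-b_n\}$ for some sequence $b=(b_n)\in\ell^2(\mathbb Z)$.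
   Context: $H$ is a separable complex Hilbert space, $B(H)$ the algebra of bounded linear operators on $H$, $\mathfrak S_2(H)$ the ideal of Hilbert--Schmidt operators with norm $\|\cdot\|_2$. Resolution of the identity: a finite or countable family $\{E_n\}$ of idempotents in $B(H)$ such that each $E_n$ is an orthogonal projection, $E_mE_n=0$ for $m\neq n$, and for each $x\in H$ the series $\sum_nE_nx$ converges unconditionally to $x$. Assumptions on the densely defined operator $A:D(A)\subseteq H\to H$: (A1) $A$ is a closed normal linear operator, i.e. $D(A^* )=D(A)$ and $\|A^*x\|=\|Ax\|$ for $x\in D(A)$; (A2) $\sigma(A)=\bigcup_{n\in\mathbb Z}\{\lambda_n\}$, where each $\lambda_n$ is a semisimple eigenvalue of $A$ of finite multiplicity; (A3) the Riesz projections $P_n=P(\{\lambda_n\},A)$ (so $AP_n=\lambda_nP_n$) form a resolution of the identity; (A4) $\sup_{j\in\mathbb Z}\sum_{n\ne j}|\lambda_n-\lambda_j|^{-2}<\infty$; (A5) for every $\varepsilon>0$ there is $\lambda_\varepsilon\in\rho(A)$ with $\|(A-\lambda_\varepsilon I)^{-1}\|<\varepsilon$. It follows that $\delta>0$. Transforms: for $X\in\mathfrak S_2(H)$, $JX=\sum_{n\in\mathbb Z}P_nXP_n$ and $\Gamma X=\sum_{m\ne n}\frac{P_mXP_n}{\lambda_m-\lambda_n}$. Similarity: operators $A_1,A_2$ are similar, with similarity transform $W$ of $A_1$ into $A_2$, if $W\in B(H)$ is continuously invertible, $WD(A_2)=D(A_1)$ and $A_1Wx=WA_2x$ for $x\in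 D(A_2)$. The operators $A-B$ and $A-V$ have domain $D(A)$.
   Formalization: In (2) the P'_n form a resolution of the identity for an equivalent inner product on H, not the given one; in (3) each λ_n is repeated by its multiplicity, so σ(A−B) consists of the points λ_n − b_{n,i}, i < mult(λ_n), with Σ|b_{n,i}|² < ∞. Both clauses fail as literally written. *)

(* Defs.v *)
From mathcomp Require Import all_boot all_order all_algebra finmap.
From mathcomp Require Import all_classical all_reals all_analysis.
From mathcomp Require Import complex.
From mathcomp Require Import sesquilinear summability.

Set Implicit Arguments.
Unset Strict Implicit.
Unset Printing Implicit Defensive.
Import Order.TTheory GRing.Theory Num.Theory.
Import numFieldNormedType.Exports.

Local Open Scope classical_set_scope.
Local Open Scope ring_scope.
Local Open Scope complex_scope.

Definition separable_space (T : topologicalType) : Prop :=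
  exists S : set T, countable S /\ dense S.

(* A norm over [R[i]] takes its (nonnegative real) values in [R[i]]; this is
   the same number read in [R]. *)
Definition rnorm (R : realType) (V : normedZmodType R[i]) (x : V) : R :=
  complex.Re `|x|.
Arguments rnorm {R V} x.

Section ContourIntegral.
Variable R : realType.
Local Notation C := R[i].

Definition complex_integral (f : R -> C) (a b : R) : C :=
  Rintegral lebesgue_measure `[a, b] (fun t => complex.Re (f t)) +i*
  Rintegral lebesgue_measure `[a, b] (fun t => complex.Im (f t)).

Definition cis (t : R) : C := cos t +i* sin t.

Definition circle_integral (f : C -> C) (c : C) (r : R) : C :=
  complex_integral
    (fun t => f (c + r%:C * cis t) * ('i * r%:C * cis t)) 0 (2 * pi).

End ContourIntegral.

Section HilbertSpace.
Variables (R : realType) (H : completeNormedModType R[i]).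
Local Notation C := R[i].
Implicit Types dot : {dot H for Num.conj}.

(* [H] is a Hilbert space for [dot]; [dot] is linear in its first argument. *)
Definition hilbert_inner_product dot : Prop :=
  forall x : H, `|x| ^+ 2 = dot x x.

Definition equivalent_inner_product dot : Prop :=
  exists a b : C, [/\ 0 < a, 0 < b &
    forall x : H, a * `|x| ^+ 2 <= dot x x <= b * `|x| ^+ 2].

Definition orthonormal_basis dot (S : set H) : Prop :=
  (forall e f, S e -> S f -> dot e f = (e == f)%:R) /\
  (forall x, (forall e, S e -> dot x e = 0) -> x = 0).

Definition has_dimension dot (S : set H) (k : nat) : Prop :=
  exists e : 'I_k -> H,
    (forall i j, dot (e i) (e j) = (i == j)%:R) /\
    S = range (fun c : 'I_k -> C => \sum_i c i *: e i).

Definition bounded_op (X : H -> H) : Prop := linear X /\ continuous X.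

Definition op_norm (X : H -> H) : \bar R :=
  ereal_sup [set (rnorm (X x))%:E | x in [set x : H | rnorm x <= 1]].

Definition inverse_op (W W' : H -> H) : Prop :=
  [/\ bounded_op W', cancel W W' & cancel W' W].

(* The Hilbert-Schmidt norm does not depend on the orthonormal basis, so it is
   computed in a chosen one. *)
Definition hs_basis dot : set H := xget set0 [set S | orthonormal_basis dot S].

Definition hs_norm dot (X : H -> H) : \bar R :=
  sqrte (\esum_(e in hs_basis dot) ((rnorm (X e)) ^+ 2)%:E).

Definition hilbert_schmidt dot (X : H -> H) : Prop :=
  bounded_op X /\ (hs_norm dot X < +oo)%E.

Definition hs_limit dot (u : nat -> H -> H) (X : H -> H) : Prop :=
  hilbert_schmidt dot X /\
  (hs_norm dot (u k \- X) @[k --> \oo] --> (0 : \bar R)%E).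

(* Unconditional sum of a family of operators for the Hilbert-Schmidt norm;
   the zero operator if there is none. *)
Definition hs_sum dot (I : choiceType) (f : I -> H -> H) : H -> H :=
  xget (fun=> 0) [set S | hilbert_schmidt dot S /\
    (hs_norm dot ((fun x => partial_sum (f ^~ x) F) \- S) @[F --> @totally I]
       --> (0 : \bar R)%E)].

(* Values of [act] outside [dom] are irrelevant. *)
Record unbounded_op := UnboundedOp { dom : set H; act :> H -> H }.
Implicit Types A : unbounded_op.

Definition linear_op A : Prop :=
  dom A 0 /\ forall (a : C) (x y : H), dom A x -> dom A y ->
    dom A (a *: x + y) /\ A (a *: x + y) = a *: A x + A y.

Definition densely_defined A : Prop := dense (dom A).

Definition closed_op A : Prop :=
  closed [set p : H * H | dom A p.1 /\ p.2 = A p.1].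

Definition adjoint dot A : unbounded_op :=
  let adj y z := forall x, dom A x -> dot (A x) y = dot x z in
  UnboundedOp [set y | exists z, adj y z] (fun y => xget 0 (adj y)).

Definition normal_op dot A : Prop :=
  dom (adjoint dot A) = dom A /\
  forall x, dom A x -> `|adjoint dot A x| = `|A x|.

Definition sub_op A (B : H -> H) : unbounded_op :=
  UnboundedOp (dom A) (fun x => A x - B x).

Definition is_resolvent A (z : C) (T : H -> H) : Prop :=
  [/\ bounded_op T,
      forall x, dom A (T x) /\ A (T x) - z *: T x = x &
      forall x, dom A x -> T (A x - z *: x) = x].

Definition resolvent_set A : set C := [set z | exists T, is_resolvent A z T].

Definition spectrum A : set C := ~` resolvent_set A.

(* [resolvent A z] is $(A - zI)^{-1}$. *)
Definition resolvent A (z : C) : H -> H := xget (fun=> 0) (is_resolvent A z).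

(* [P] is the Riesz projection of the part [s] of the spectrum of [A] cut out
   by a circle contained in the resolvent set; the contour integral
   $-\frac{1}{2\pi i}\oint (A - zI)^{-1} dz$ is taken weakly. *)
Definition riesz_projection dot A (s : set C) (P : H -> H) : Prop :=
  bounded_op P /\
  exists (c : C) (r : R), [/\ 0 < r,
    s = spectrum A `&` [set z | rnorm (z - c) < r],
    [set z | rnorm (z - c) = r] `<=` resolvent_set A &
    forall x y, dot (P x) y =
      - (2 * pi%:C * 'i)^-1 *
      circle_integral (fun z => dot (resolvent A z x) y) c r].

Definition eigenspace A (z : C) : set H := [set x | dom A x /\ A x = z *: x].

(* The (algebraic) multiplicity is the dimension of the range of the Riesz
   projection; the eigenvalue is semisimple when this range is the
   eigenspace. *)
Definition semisimple_eigenvalue dot A (z : C) (k : nat) : Prop :=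
  (exists2 x, eigenspace A z x & x != 0) /\
  exists P, [/\ riesz_projection dot A [set z] P,
    range P = eigenspace A z & has_dimension dot (range P) k].

Definition orthogonal_projection dot (E : H -> H) : Prop :=
  [/\ bounded_op E, forall x, E (E x) = E x &
      forall x y, dot (E x) y = dot x (E y)].

Definition resolution_of_identity dot (I : countType) (E : I -> H -> H) : Prop :=
  [/\ forall n, orthogonal_projection dot (E n),
      forall m n, m != n -> forall x, E m (E n x) = 0 &
      forall x, partial_sum (fun n => E n x) F @[F --> @totally I] --> x].

(* The operators [A1] and [A2] are similar, [W] transforming [A1] into [A2]. *)
Definition similarity_transform (A1 A2 : unbounded_op) (W : H -> H) : Prop :=
  [/\ bounded_op W, exists W', inverse_op W W',
      W @` dom A2 = dom A1 &
      forall x, dom A2 x -> A1 (W x) = W (A2 x)].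

(* The integer [mult n] is the multiplicity of the eigenvalue [lam n]. *)
Record standing_assumptions dot A (lam : int -> C) (mult : int -> nat)
    (P : int -> H -> H) : Prop := {
  A_linear : linear_op A;
  A_dense : densely_defined A;
  A_closed : closed_op A;
  A_normal : normal_op dot A;
  A_spectrum : spectrum A = range lam;
  A_semisimple : forall n, semisimple_eigenvalue dot A (lam n) (mult n);
  P_riesz : forall n, riesz_projection dot A [set lam n] (P n);
  P_resolution : resolution_of_identity dot P;
  lam_sum : (ereal_sup [set \esum_(n in [set n : int | n != j])
               ((rnorm (lam n - lam j)) ^- 2)%:E | j in [set: int]] < +oo)%E;
  A_resolvent_small : forall eps : R, 0 < eps -> exists2 z,
    resolvent_set A z & (op_norm (resolvent A z) < eps%:E)%E
}.

Section Transforms.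
Variables (dot : {dot H for Num.conj}) (lam : int -> C) (P : int -> H -> H).

Definition gap : R :=
  inf [set rnorm (lam p.1 - lam p.2) | p in [set p : int * int | p.1 != p.2]].

Definition Jmap (X : H -> H) : H -> H :=
  hs_sum dot (fun (n : int) x => P n (X (P n x))).

Definition Gmap (X : H -> H) : H -> H :=
  hs_sum dot (fun (p : int * int) x => if p.1 == p.2 then 0
    else (lam p.1 - lam p.2)^-1 *: P p.1 (X (P p.2 x))).

Definition Phi (B X : H -> H) : H -> H := fun x =>
  B (Gmap X x) - Gmap X (Jmap B x) - Gmap X (Jmap (B \o Gmap X) x) + B x.

End Transforms.

End HilbertSpace.

(* Main.v *)
Require Import Defs.
From HB Require Import structures.
From mathcomp Require Import all_boot all_order all_algebra finmap.
From mathcomp Require Import all_classical all_reals all_analysis.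
From mathcomp Require Import complex.
From mathcomp Require Import sesquilinear summability.
From mathcomp Require Import spectral ring lra.

(** Write T(z) for the resolvent of A at z, delta for the gap, b for a bound of the
    Hilbert-Schmidt norm of B with b < delta / 4, U = Gamma X and V = J X.

    The operator A is diagonal. A Riesz projection of an isolated point does not
    depend on the circle: the scalar functions <T(z) x, y> are holomorphic, and
    circle integrals of such functions are invariant under deformations of the
    circle in the resolvent set ([circle_homotopy], [circle_shrink]). Hence P_n is
    the projection that witnesses the semisimplicity of lambda_n, its range is the
    eigenspace ([range_P]), and the lambda_n are distinct. Since the P_n resolve
    the identity, a vector y is in D(A) with A y = w as soon as
    P_n w = lambda_n P_n y for all n ([dom_criterion]), and Hilbert-Schmidt
    operators are determined by their blocks P_m X P_n.

    Blocks are orthogonal for the Hilbert-Schmidt inner product, so multiplying the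
    blocks by bounded coefficients defines an operator by an unconditionally
    convergent sum ([block_sum]). This gives |J X| <= |X|, |Gamma X| <= |X| / delta
    and A U - U A = X - V on D(A) ([U_commutator]).

    On the ball of radius delta the map Phi has values of norm at most 4 b < delta
    and Lipschitz constant 4 b / delta < 1, so the iterations converge to a fixed
    point X in this ball ([Phi_fixed_point]). Applying J to X = Phi(X) yields
    V = J B + J (B U), hence X = B + B U - U V; together with the commutator
    relation this is (A - B)(1 + U) = (1 + U)(A - V). As |U| < 1, the operator
    W = 1 + U is invertible, and it maps D(A) onto D(A) because it intertwines
    resolvents of A - V and A - B at a point where T(z) is small ([W_similarity]).

    The operator V commutes with every P_n and its norm is at most 2 b < delta / 2.
    Along the segment A - s V the circle of radius delta / 2 around lambda_n stays
    in the resolvent set, and the contour integral does not change because the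
    derivative of the resolvent in s is a derivative in z ([riesz_V]). So P_n is a
    Riesz projection of A - V, and W P_n W^-1 one of A - B; these projections are
    orthogonal for the equivalent inner product <W^-1 x, W^-1 y>.

    For any z all blocks of A - V - z except at most one are dominated by their
    diagonal part, so z is in the spectrum exactly when lambda_n - z is an
    eigenvalue of the n-th block of V for some n ([spectrum_block]). Schur's
    inequality bounds the sum of the squared moduli of the eigenvalues of the
    blocks by the squared Hilbert-Schmidt norm of V ([block_eigenvalues]). *)

Set Implicit Arguments.
Unset Strict Implicit.
Unset Printing Implicit Defensive.
Import Order.TTheory GRing.Theory Num.Theory.
Import numFieldNormedType.Exports.

Local Open Scope classical_set_scope.
Local Open Scope ring_scope.
Local Open Scope complex_scope.

(** * Real-valued norms over the complex scalars *)

Section RealNorm.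
Variable R : realType.
Local Notation C := R[i].

Section Zmod.
Variable V : normedZmodType C.
Implicit Types x y : V.

Lemma rnormE x : `|x| = (rnorm x)%:C.
Proof.
have /complex_realP[k hk] : `|x| \is Num.real by rewrite realE normr_ge0.
by rewrite /rnorm hk.
Qed.

Lemma rnorm_ge0 x : 0 <= rnorm x.
Proof. by rewrite -ler0c -rnormE. Qed.

Lemma rnorm0 : rnorm (0 : V) = 0.
Proof. by rewrite /rnorm normr0. Qed.

Lemma rnormN x : rnorm (- x) = rnorm x.
Proof. by rewrite /rnorm normrN. Qed.

Lemma rnorm_eq0 x : rnorm x = 0 -> x = 0.
Proof. by move=> h; apply/normr0_eq0; rewrite rnormE h. Qed.

Lemma rnorm_eq0E x : (rnorm x == 0) = (x == 0).
Proof. by apply/eqP/eqP => [/rnorm_eq0//|->]; rewrite rnorm0. Qed.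

Lemma rnorm_gt0 x : x != 0 -> 0 < rnorm x.
Proof. by move=> x0; rewrite lt_def rnorm_ge0 rnorm_eq0E x0. Qed.

Lemma rnormD x y : rnorm (x + y) <= rnorm x + rnorm y.
Proof. by rewrite -lecR rmorphD /= -!rnormE ler_normD. Qed.

Lemma rnormB x y : rnorm (x - y) <= rnorm x + rnorm y.
Proof. by rewrite -[rnorm y]rnormN rnormD. Qed.

Lemma rnorm_distC x y : rnorm (x - y) = rnorm (y - x).
Proof. by rewrite -rnormN opprB. Qed.

Lemma rnorm_distD z x y : rnorm (x - y) <= rnorm (x - z) + rnorm (z - y).
Proof. by apply: le_trans (rnormD _ _); rewrite addrA subrK. Qed.

Lemma rnorm_sub_ge x y : rnorm x - rnorm y <= rnorm (x - y).
Proof. by rewrite lerBlDr -{1}(subrK y x) rnormD. Qed.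

Lemma rnorm_sum (I : Type) (r : seq I) (P : pred I) (F : I -> V) :
  rnorm (\sum_(i <- r | P i) F i) <= \sum_(i <- r | P i) rnorm (F i).
Proof.
elim/big_rec2: _ => [|i a b _ h]; first by rewrite rnorm0.
by apply: le_trans (rnormD _ _) _; rewrite lerD2l.
Qed.

(** The form in which a vector is shown to vanish after passing to a limit. *)
Lemma rnorm_small_eq0 x (M : R) :
  (forall e : R, 0 < e -> rnorm x <= M * e) -> x = 0.
Proof.
move=> h; apply: rnorm_eq0; apply/eqP; rewrite eq_le rnorm_ge0 andbT.
apply/ler_addgt0Pl => e e0; rewrite addr0.
have M0 : 0 < `|M| + 1 by rewrite ltr_wpDl.
apply: le_trans (h (e / (`|M| + 1)) _) _; first by rewrite divr_gt0.
rewrite mulrCA ger_pMr// ler_pdivrMr// mul1r.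
by apply: le_trans (ler_norm _) _; rewrite lerDl.
Qed.

End Zmod.

Lemma rnormM (a b : C) : rnorm (a * b) = rnorm a * rnorm b.
Proof. by apply: complexI; rewrite rmorphM /= -!rnormE normrM. Qed.

Lemma rnormV (a : C) : rnorm (a^-1) = (rnorm a)^-1.
Proof. by apply: complexI; rewrite fmorphV /= -!rnormE normfV. Qed.

Lemma rnorm1 : rnorm (1 : C) = 1.
Proof. by apply: complexI; rewrite -rnormE normr1. Qed.

Lemma rnormX (a : C) n : rnorm (a ^+ n) = rnorm a ^+ n.
Proof. by elim: n => [|n IH]; rewrite ?expr0 ?rnorm1// !exprS rnormM IH. Qed.

Lemma rnormR (r : R) : rnorm (r%:C) = `|r|.
Proof. by rewrite /rnorm normc_def /= expr0n addr0 sqrtr_sqr. Qed.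

Lemma rnorm_i : rnorm ('i : C) = 1.
Proof. by rewrite /rnorm normc_def /= expr0n add0r expr1n sqrtr1. Qed.

Lemma rnorm_sqr (a : C) : rnorm a ^+ 2 = complex.Re a ^+ 2 + complex.Im a ^+ 2.
Proof. by rewrite /rnorm normc_def /= sqr_sqrtr// addr_ge0// sqr_ge0. Qed.

Lemma rnorm_conj (a : C) : rnorm (Num.conj a) = rnorm a.
Proof. by rewrite /rnorm norm_conjC. Qed.

Lemma Re_le_rnorm (a : C) : `|complex.Re a| <= rnorm a.
Proof.
rewrite -(@ler_pXn2r _ 2) ?nnegrE ?rnorm_ge0// rnorm_sqr.
by rewrite real_normK ?num_real// lerDl sqr_ge0.
Qed.

Lemma Im_le_rnorm (a : C) : `|complex.Im a| <= rnorm a.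
Proof.
rewrite -(@ler_pXn2r _ 2) ?nnegrE ?rnorm_ge0// rnorm_sqr.
by rewrite real_normK ?num_real// lerDr sqr_ge0.
Qed.

Lemma rnorm_ReIm (a : C) : rnorm a <= `|complex.Re a| + `|complex.Im a|.
Proof.
rewrite {1}[a]complexE; apply: le_trans (rnormD _ _) _.
by rewrite rnormM rnorm_i mul1r !rnormR.
Qed.

Lemma rnormZ (V : normedModType C) (a : C) (x : V) :
  rnorm (a *: x) = rnorm a * rnorm x.
Proof. by apply: complexI; rewrite rmorphM /= -!rnormE normrZ. Qed.

Lemma gt0_real_complex (e : C) : 0 < e -> exists2 r : R, 0 < r & e = r%:C.
Proof.
move=> e0; have /complex_realP[k hk] : e \is Num.real by rewrite gtr0_real.
by exists k => //; rewrite -ltcR -hk.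
Qed.

Section Topology.
Variable V : normedModType C.

Lemma cvg_rnormP (T : Type) (F : set_system T) {FF : Filter F} (f : T -> V) (l : V) :
  f @ F --> l <-> forall e : R, 0 < e -> \forall t \near F, rnorm (f t - l) < e.
Proof.
split=> [/cvgrPdist_lt h e e0|h].
  have e0' : 0 < e%:C by rewrite ltcR.
  near=> t; rewrite rnorm_distC -ltcR -rnormE; near: t; exact: h.
apply/cvgrPdist_lt => e /gt0_real_complex[r r0 ->].
near=> t; rewrite rnormE ltcR rnorm_distC; near: t; exact: h.
Unshelve. all: by end_near. Qed.

Lemma nbhs_rnormP (x : V) (U : set V) :
  nbhs x U <-> exists2 e : R, 0 < e & forall y, rnorm (y - x) < e -> U y.
Proof.
split=> [/nbhs_normP[e /= /gt0_real_complex[r r0 ->] h]|[e e0 h]].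
  by exists r => // y yx; apply: h; rewrite /= rnormE ltcR rnorm_distC.
apply/nbhs_normP; exists e%:C; first by rewrite /= ltcR.
by move=> y /=; rewrite rnormE ltcR rnorm_distC; exact: h.
Qed.

End Topology.

Lemma continuous_rnormP (V W : normedModType C) (f : V -> W) :
  continuous f <-> forall x (e : R), 0 < e ->
    exists2 d : R, 0 < d & forall y, rnorm (y - x) < d -> rnorm (f y - f x) < e.
Proof.
split=> [cf x e e0|h x].
  have /(_ e e0) := (@cvg_rnormP _ _ (nbhs x) (nbhs_filter x) f (f x)).1 (cf x).
  by move=> /nbhs_rnormP.
by apply/cvg_rnormP => e e0; apply/nbhs_rnormP; exact: h.
Qed.

Section Complete.
Variable V : completeNormedModType C.

Lemma cauchy_rnorm (T : Type) (F : set_system T) {FF : ProperFilter F} (f : T -> V) :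
  (forall e : R, 0 < e -> exists2 U, F U & forall s t, U s -> U t ->
     rnorm (f s - f t) < e) ->
  exists l : V, f @ F --> l.
Proof.
move=> h; apply/cvg_ex; apply/cauchy_cvgP; apply/cauchy_ballP => e.
move=> /gt0_real_complex[r r0 ->].
have [U FU hU] := h r r0.
exists (f @` U, f @` U) => /=.
  by split; apply: (@filterS _ F _ U) => // t Ut; exists t.
move=> -[_ _] [[s Us <-] [t Ut <-]] /=.
by rewrite -ball_normE /ball_ /= rnormE ltcR; apply: hU.
Qed.

End Complete.

End RealNorm.

#[global] Hint Extern 0 (is_true (0 <= rnorm _)) => solve [apply: rnorm_ge0] : core.

Lemma subrACA (V : zmodType) (x y z t : V) : (x - y) - (z - t) = (x - z) - (y - t).
Proof. by rewrite !opprD !opprK addrACA. Qed.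

(** * Linear maps given as plain functions *)

Section LinearFacts.
Variables (K : pzRingType) (U V : lmodType K) (X : U -> V).
Hypothesis lX : linear X.

Lemma lin0 : X 0 = 0.
Proof. by have := lX (-1) 0 0; rewrite scaler0 add0r scaleN1r addNr. Qed.

Lemma linD x y : X (x + y) = X x + X y.
Proof. by have := lX 1 x y; rewrite !scale1r. Qed.

Lemma linZ a x : X (a *: x) = a *: X x.
Proof. by have := lX a x 0; rewrite !addr0 lin0 addr0. Qed.

Lemma linN x : X (- x) = - X x.
Proof. by rewrite -scaleN1r linZ scaleN1r. Qed.

Lemma linB x y : X (x - y) = X x - X y.
Proof. by rewrite linD linN. Qed.

Lemma linsum (I : Type) (r : seq I) (P : pred I) (F : I -> U) :
  X (\sum_(i <- r | P i) F i) = \sum_(i <- r | P i) X (F i).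
Proof. by elim/big_rec2: _ => [|i a b _ <-]; rewrite ?lin0 ?linD. Qed.

End LinearFacts.

(** * Geometric chains of distances *)

Section GeometricChain.
Variables (R : realType) (P : nat -> nat -> R -> Prop) (M q : R).
Hypotheses (M0 : 0 <= M) (q0 : 0 <= q) (q1 : q < 1).
Hypothesis Pstep : forall k, P k k.+1 (M * q ^+ k).
Hypothesis Prefl : forall k, P k k 0.
Hypothesis Ptrans : forall i j k a b, P i j a -> P j k b -> P i k (a + b).
Hypothesis Pmono : forall i j a b, a <= b -> P i j a -> P i j b.

(** Stated for a relation [P i j a], read as: the distance from the [i]-th to the
    [j]-th term is at most [a]. It serves both for vectors and for operators in the
    Hilbert-Schmidt norm, where the distance is an extended real. *)
Lemma geometric_chain k l : (k <= l)%N -> P k l (M * q ^+ k / (1 - q)).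
Proof.
have q1' : 0 < 1 - q by rewrite subr_gt0.
suff h n m : P m (m + n)%N (M * q ^+ m * (1 - q ^+ n) / (1 - q)).
  move=> kl; rewrite -(subnKC kl); apply: Pmono (h (l - k)%N k).
  rewrite ler_pM2r ?invr_gt0// ler_piMr ?mulr_ge0 ?exprn_ge0//.
  by rewrite gerBl exprn_ge0.
elim: n m => [|n IH] m; first by rewrite addn0 expr0 subrr mulr0 mul0r.
rewrite addnS -addSn; apply: Pmono (Ptrans (Pstep m) (IH m.+1)).
rewrite le_eqVlt; apply/orP; left; apply/eqP; rewrite !exprS.
by field; rewrite lt0r_neq0.
Qed.

Lemma geometric_small (e : R) : 0 < e ->
  exists N, forall k, (N <= k)%N -> M * q ^+ k / (1 - q) < e.
Proof.
move=> e0; have q1' : 0 < 1 - q by rewrite subr_gt0.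
have /cvgrPdist_lt h : (fun k => M / (1 - q) * q ^+ k) @ \oo --> (0 : R).
  rewrite -[X in _ --> X](mulr0 (M / (1 - q))); apply: cvgMr.
  by apply: cvg_expr; rewrite ger0_norm.
have [N _ hN] := h e e0; exists N => k Nk; have := hN k Nk.
rewrite /= sub0r normrN => /(le_lt_trans (ler_norm _)).
by rewrite mulrAC.
Qed.

End GeometricChain.

(** * Bounded operators and Neumann inverses *)

Section BoundedOperators.
Variables (R : realType).
Local Notation C := R[i].

Definition opbound (V W : normedZmodType C) (X : V -> W) (M : R) :=
  forall x, rnorm (X x) <= M * rnorm x.

Lemma opbound_le (V W : normedZmodType C) (X : V -> W) (M N : R) :
  M <= N -> opbound X M -> opbound X N.
Proof.
by move=> MN h x; apply: le_trans (h x) _; rewrite ler_wpM2r ?rnorm_ge0.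
Qed.

Lemma opbound_comp (U V W : normedZmodType C) (X : V -> W) (Y : U -> V) (M N : R) :
  0 <= M -> opbound X M -> opbound Y N -> opbound (X \o Y) (M * N).
Proof.
move=> M0 hX hY x; apply: le_trans (hX _) _.
by rewrite -mulrA ler_wpM2l.
Qed.

(** Rescaling [x] into the ball on which continuity at [0] bounds [X] by [1]. *)
Lemma linear_continuous_opbound (V W : normedModType C) (X : V -> W) :
  linear X -> continuous X -> exists2 M : R, 0 < M & opbound X M.
Proof.
move=> lX /continuous_rnormP/(_ 0 1 ltr01)[d d0 h].
exists (2 / d); first by rewrite divr_gt0.
move=> x; have [->|x0] := eqVneq x 0.
  by rewrite (lin0 lX) !rnorm0 mulr0.
have nx : 0 < rnorm x by rewrite rnorm_gt0.
pose a : R := d / 2 / rnorm x; have a0 : 0 < a by rewrite !divr_gt0.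
have := h (a%:C *: x); rewrite (lin0 lX) !subr0 (linZ lX) !rnormZ rnormR gtr0_norm//.
have -> : a * rnorm x = d / 2 by rewrite /a divfK// gt_eqF.
move=> /(_ _)/ltW; rewrite ltr_pdivrMr// ltr_pMr// ltr1n => /(_ isT).
rewrite -ler_pdivlMl// mulr1 => /le_trans; apply.
rewrite le_eqVlt; apply/orP; left; apply/eqP; rewrite /a; field.
by rewrite !gt_eqF.
Qed.

Lemma opbound_continuous (V W : normedModType C) (X : V -> W) (M : R) :
  linear X -> opbound X M -> continuous X.
Proof.
move=> lX hX; apply/continuous_rnormP => x e e0.
have M1 : 0 < `|M| + 1 by rewrite ltr_wpDl.
exists (e / (`|M| + 1)); first by rewrite divr_gt0.
move=> y; rewrite ltr_pdivlMr// mulrC => /(le_lt_trans _); apply.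
rewrite -(linB lX); apply: le_trans (hX _) _; rewrite ler_wpM2r ?rnorm_ge0//.
by apply: le_trans (ler_norm _) _; rewrite lerDl.
Qed.

Lemma cvg_opbound (V W : normedModType C) (X : V -> W) (M : R) (T : Type)
    (F : set_system T) {FF : Filter F} (f : T -> V) l :
  linear X -> opbound X M -> f @ F --> l -> X \o f @ F --> X l.
Proof.
move=> lX hX fl; apply: continuous_cvg => //.
exact: (opbound_continuous lX hX).
Qed.

End BoundedOperators.

Section BoundedOp.
Variables (R : realType) (H : completeNormedModType R[i]).
Local Notation C := R[i].

Lemma bounded_opP (X : H -> H) :
  bounded_op X <-> linear X /\ exists2 M : R, 0 < M & opbound X M.
Proof.
split=> [[lX cX]|[lX [M M0 hM]]]; first by split=> //; exact: linear_continuous_opbound.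
by split=> //; exact: opbound_continuous hM.
Qed.

Lemma bounded_opI (X : H -> H) (M : R) : linear X -> opbound X M -> bounded_op X.
Proof. by move=> lX hX; split=> //; exact: opbound_continuous hX. Qed.

Lemma linear_comp (X Y : H -> H) : linear X -> linear Y -> linear (X \o Y).
Proof. by move=> lX lY a x y; rewrite /= lY lX. Qed.

Lemma bounded_op_comp (X Y : H -> H) :
  bounded_op X -> bounded_op Y -> bounded_op (X \o Y).
Proof.
move=> [lX cX] [lY cY]; split; first exact: linear_comp.
by move=> x; apply: continuous_comp; [exact: cY|exact: cX].
Qed.

Lemma bounded_opD (X Y : H -> H) : bounded_op X -> bounded_op Y ->
  bounded_op (fun x => X x + Y x).
Proof.
move=> [lX cX] [lY cY]; split.
  by move=> a x y; rewrite lX lY scalerDr addrACA.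
by move=> x; apply: cvgD; [exact: cX|exact: cY].
Qed.

Lemma bounded_opZ (a : C) (X : H -> H) : bounded_op X ->
  bounded_op (fun x => a *: X x).
Proof.
move=> [lX cX]; split; last by move=> x; apply: cvgZr; exact: cX.
by move=> b x y; rewrite lX scalerDr !scalerA mulrC.
Qed.

Lemma bounded_opB (X Y : H -> H) : bounded_op X -> bounded_op Y ->
  bounded_op (fun x => X x - Y x).
Proof.
move=> bX bY; have := bounded_opD bX (bounded_opZ (-1) bY).
by under eq_fun do rewrite scaleN1r.
Qed.

Lemma bounded_op_id : bounded_op (@id H).
Proof. by split=> // x; exact: cvg_id. Qed.

Lemma bounded_op0 : bounded_op (fun=> 0 : H).
Proof. by split=> [a x y|x]; [rewrite scaler0 addr0|exact: cvg_cst]. Qed.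

Lemma bounded_op_sum (I : Type) (r : seq I) (F : I -> H -> H) :
  (forall i, bounded_op (F i)) -> bounded_op (fun x => \sum_(i <- r) F i x).
Proof.
move=> h; elim: r => [|i r IH].
  by under eq_fun do rewrite big_nil; exact: bounded_op0.
by under eq_fun do rewrite big_cons; exact: bounded_opD.
Qed.

(** The sum of the powers of [K] applied to [x] is obtained as the limit of the
    iteration y -> x + K y; the lower bound (1 - q)|x| <= |x - K x| gives uniqueness
    and the norm of the inverse. *)
Lemma neumann (K : H -> H) (q : R) : linear K -> 0 <= q < 1 -> opbound K q ->
  exists T : H -> H, [/\ linear T, opbound T (1 - q)^-1,
    forall x, T x - K (T x) = x & forall x, T (x - K x) = x].
Proof.
move=> lK /andP[q0 q1] hK; have q1' : 0 < 1 - q by rewrite subr_gt0.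
have low x : (1 - q) * rnorm x <= rnorm (x - K x).
  apply: le_trans (rnorm_sub_ge _ _); rewrite mulrBl mul1r lerB//.
have inj x y : x - K x = y - K y -> x = y.
  move=> e; apply/eqP; rewrite -subr_eq0; apply/eqP/(@rnorm_eq0 R).
  have := low (x - y); rewrite (linB lK) subrACA e subrr rnorm0 pmulr_rle0// => h.
  by apply/eqP; rewrite eq_le h rnorm_ge0.
have ex x : exists y, y - K y = x.
  pose u (n : nat) : H := iter n (fun y => x + K y) 0.
  have stepu k : rnorm (u k - u k.+1) <= rnorm x * q ^+ k.
    elim: k => [|k IH].
      by rewrite /u /= (lin0 lK) addr0 sub0r rnormN expr0 mulr1.
    rewrite /u /= -/(u k) opprD addrACA subrr add0r -(linB lK).
    apply: le_trans (hK _) _; rewrite exprS mulrCA ler_wpM2l//.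
  have chain k l : (k <= l)%N -> rnorm (u k - u l) <= rnorm x * q ^+ k / (1 - q).
    move=> kl; pose D i j a := rnorm (u i - u j) <= a.
    apply: (@geometric_chain R D _ _ _ _ _ _ _ _ _ _ _ kl); rewrite /D => //.
    - by move=> i; rewrite subrr rnorm0.
    - by move=> i j n a b h1 h2; apply: le_trans (rnorm_distD (u j) _ _) (lerD h1 h2).
    - by move=> i j a b ab /le_trans; apply.
  have [l ul] : exists l : H, u @ \oo --> l.
    apply: cauchy_rnorm => e e0.
    have [N hN] := @geometric_small R (rnorm x) q q0 q1 e e0.
    exists [set k | (N <= k)%N]; first by exists N.
    move=> s t /= Ns Nt; case: (leqP s t) => [st|/ltnW ts].
      by apply: le_lt_trans (chain _ _ st) (hN _ Ns).
    by rewrite rnorm_distC; apply: le_lt_trans (chain _ _ ts) (hN _ Nt).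
  exists l; have h1 : (fun n => u n.+1) @ \oo --> l by rewrite (cvg_shiftS u).
  have h2 : (fun n => u n.+1) @ \oo --> x + K l.
    by apply: cvgD; [exact: cvg_cst|exact: (cvg_opbound lK hK ul)].
  apply/eqP; rewrite subr_eq; apply/eqP.
  by apply: (cvg_unique _ h1 h2).
have [T hT] := choice ex.
exists T; split=> //; last by move=> x; apply: inj.
  move=> a x y; apply: inj; rewrite hT lK opprD addrACA -scalerBr.
  by rewrite !hT.
by move=> x; rewrite -ler_pdivrMl ?invr_gt0// invrK -{2}(hT x).
Qed.

End BoundedOp.

(** * Inner product identities *)

Section InnerProduct.
Variables (R : realType) (H : completeNormedModType R[i]).
Variable dot : {dot H for Num.conj}.
Local Notation C := R[i].
Hypothesis hd : hilbert_inner_product dot.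

Lemma dotDl x y z : dot (x + y) z = dot x z + dot y z.
Proof. exact: linearDl. Qed.
Lemma dotBl x y z : dot (x - y) z = dot x z - dot y z.
Proof. exact: linearBl. Qed.
Lemma dotZl a x z : dot (a *: x) z = a * dot x z.
Proof. exact: linearZl_LR. Qed.
Lemma dot0l z : dot 0 z = 0.
Proof. exact: linear0l. Qed.
Lemma dotDr x y z : dot z (x + y) = dot z x + dot z y.
Proof. exact: linearDr. Qed.
Lemma dotBr x y z : dot z (x - y) = dot z x - dot z y.
Proof. exact: linearBr. Qed.
Lemma dotZr a x z : dot z (a *: x) = Num.conj a * dot z x.
Proof. exact: linearZr_LR. Qed.
Lemma dot0r z : dot z 0 = 0.
Proof. exact: linear0r. Qed.
Lemma dot_suml (I : Type) (r : seq I) (P : pred I) (F : I -> H) z :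
  dot (\sum_(i <- r | P i) F i) z = \sum_(i <- r | P i) dot (F i) z.
Proof. exact: linear_sumlz. Qed.
Lemma dot_sumr (I : Type) (r : seq I) (P : pred I) (F : I -> H) z :
  dot z (\sum_(i <- r | P i) F i) = \sum_(i <- r | P i) dot z (F i).
Proof. exact: linear_sumr. Qed.
Lemma dotC x y : dot x y = Num.conj (dot y x).
Proof. by rewrite hermC expr0 mul1r. Qed.

Lemma dot_self x : dot x x = (rnorm x ^+ 2)%:C.
Proof. by rewrite -hd rnormE rmorphXn. Qed.

Lemma rnorm_sq_dot x : rnorm x ^+ 2 = complex.Re (dot x x).
Proof. by rewrite dot_self. Qed.

Lemma dot_self_eq0 x : dot x x = 0 -> x = 0.
Proof.
rewrite dot_self => /complexI/eqP; rewrite expf_eq0/= => /eqP.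
exact: rnorm_eq0.
Qed.

(** Positivity of the squared norm of x - (<x,y>/<y,y>) y. *)
Lemma cauchy_schwarz x y : rnorm (dot x y) <= rnorm x * rnorm y.
Proof.
have [->|y0] := eqVneq y 0; first by rewrite dot0r !rnorm0 mulr0.
have ny : 0 < rnorm y by rewrite rnorm_gt0.
have ny' : dot y y != 0 by apply: contra y0 => /eqP/dot_self_eq0 ->.
pose a := dot x y / dot y y.
have : 0 <= dot (x - a *: y) (x - a *: y) by rewrite dot_self ler0c sqr_ge0.
have -> : dot (x - a *: y) (x - a *: y) = dot x x - dot x y * Num.conj (dot x y) / dot y y.
  rewrite dotBl !dotBr !dotZl !dotZr [dot y x]dotC.
  have -> : a * (Num.conj a * dot y y) = Num.conj a * dot x y.
    by rewrite mulrCA divfK.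
  by rewrite opprB addrA subrK /a mulrAC.
rewrite -normCK rnormE !dot_self -!rmorphXn -fmorph_div -rmorphB ler0c subr_ge0.
rewrite ler_pdivrMr ?exprn_gt0// -exprMn ler_pXn2r// nnegrE ?mulr_ge0 ?rnorm_ge0//.
Qed.

Lemma pythagoras x y : dot x y = 0 -> rnorm (x + y) ^+ 2 = rnorm x ^+ 2 + rnorm y ^+ 2.
Proof.
move=> xy; rewrite !rnorm_sq_dot dotDl !dotDr xy [dot y x]dotC xy rmorph0.
by rewrite addr0 add0r raddfD.
Qed.

Lemma pythagoras_sum (I : eqType) (r : seq I) (F : I -> H) : uniq r ->
  (forall i j, i != j -> dot (F i) (F j) = 0) ->
  rnorm (\sum_(i <- r) F i) ^+ 2 = \sum_(i <- r) rnorm (F i) ^+ 2.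
Proof.
move=> ur h; elim: r ur => [|i r IH] /=.
  by rewrite !big_nil rnorm0 expr0n.
move=> /andP[ir /IH{}IH]; rewrite !big_cons pythagoras ?IH// dot_sumr big_seq.
rewrite big1// => j jr; apply: h; apply: contraNneq ir => ->//.
Qed.

End InnerProduct.

(** * Second-order estimates for the unit circle *)

Section RealEstimates.
Variable R : realType.
Local Notation C := R[i].

(** Only the values of the derivative between [0] and [h] enter, so the bound [M]
    may depend on [h]; this is what turns first-order bounds into second-order ones. *)
Lemma mean_value_bound (f df : R -> R) (h M : R) :
  (forall t : R, is_derive t 1 f (df t)) ->
  (forall t, `|t| <= `|h| -> `|df t| <= M) -> `|f h - f 0| <= M * `|h|.
Proof.
move=> fd dM.
have cf (a b : R) : {within `[a, b], continuous f}.
  apply: continuous_subspaceT => t; apply/differentiable_continuous.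
  by apply/derivable1_diffP; case: (fd t).
case: (leP 0 h) => h0.
  have [c] := @MVT_segment R f df 0 h h0 (fun x _ => fd x) (cf _ _).
  rewrite in_itv /= => /andP[c0 ch] ->; rewrite subr0 normrM ler_wpM2r//.
  by apply: dM; rewrite !ger0_norm.
have [c] := @MVT_segment R f df h 0 (ltW h0) (fun x _ => fd x) (cf _ _).
rewrite in_itv /= => /andP[c0 ch]; rewrite distrC => ->.
rewrite sub0r normrM normrN ler_wpM2r//; apply: dM.
by rewrite !ler0_norm ?lerN2// ltW.
Qed.

Lemma normr_sin_le (h : R) : `|sin h| <= `|h|.
Proof.
have := @mean_value_bound sin cos h 1 _ _; rewrite sin0 subr0 mul1r; apply.
  by move=> t _; exact: cos_max.
Qed.

Lemma sqr_normM (h : R) : h ^+ 2 = `|h| * `|h|.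
Proof. by rewrite -normrM -expr2 ger0_norm ?sqr_ge0. Qed.

Lemma normr_cos_sub1 (h : R) : `|cos h - 1| <= h ^+ 2.
Proof.
rewrite sqr_normM -[X in _ - X]cos0.
apply: (@mean_value_bound cos (fun t => - sin t)) => t ht.
by rewrite normrN; apply: le_trans (normr_sin_le _) ht.
Qed.

Lemma normr_cos_sub1_lin (h : R) : `|cos h - 1| <= `|h|.
Proof.
rewrite -[X in _ <= X]mul1r -[X in _ - X]cos0.
apply: (@mean_value_bound cos (fun t => - sin t)) => t ht.
by rewrite normrN sin_max.
Qed.

Lemma normr_sin_sub (h : R) : `|sin h - h| <= h ^+ 2.
Proof.
have := @mean_value_bound (fun t => sin t - t) (fun t => cos t - 1) h `|h|.
rewrite sin0 !subr0 -sqr_normM; apply.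
by move=> t ht; apply: le_trans (normr_cos_sub1_lin _) ht.
Qed.

Lemma rnorm_cis (t : R) : rnorm (cis t) = 1.
Proof.
apply/eqP; rewrite -(@eqrXn2 _ 2)// ?rnorm_ge0// rnorm_sqr /= cos2Dsin2.
by rewrite expr1n.
Qed.

Lemma cisD (s t : R) : cis (s + t) = cis s * cis t.
Proof. by rewrite /cis cosD sinD; simpc; rewrite [sin s * _ + _]addrC. Qed.

Lemma cis0 : cis (0 : R) = 1.
Proof. by rewrite /cis cos0 sin0. Qed.

Lemma cis2pi : cis (2 * pi : R) = 1.
Proof. by rewrite mulr_natl /cis cos2pi sin2pi. Qed.

(** By the addition formula it suffices to expand at [0]. *)
Lemma cis_taylor (s t : R) :
  rnorm (cis s - cis t - (s - t)%:C * ('i * cis t)) <= 2 * (s - t) ^+ 2.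
Proof.
set h := s - t; have -> : s = t + h by rewrite /h addrC subrK.
clearbody h.
rewrite cisD (_ : _ - _ - _ = cis t * (cis h - 1 - h%:C * 'i)); last by ring.
rewrite rnormM rnorm_cis mul1r.
apply: le_trans (rnorm_ReIm _) _; rewrite /cis; simpc => /=.
by rewrite ?subr0 mulr2n mulrDl mul1r lerD ?normr_cos_sub1 ?normr_sin_sub.
Qed.

End RealEstimates.

(** * Calculus of complex-valued functions of a real variable *)

Section CurveCalculus.
Variable R : realType.
Local Notation C := R[i].

(** Enough regularity for an integrand to be integrable, and stable under the
    operations below by elementary estimates. *)
Definition loclip (g : R -> C) := forall t, exists K : R, forall u,
  `|u - t| <= 1 -> rnorm (g u - g t) <= K * `|u - t|.

(** Differentiability with a quadratic remainder: products and compositions then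
    need only norm estimates, and real and imaginary parts are treated at once. *)
Definition cderiv (g g' : R -> C) := forall t, exists K : R, forall u,
  `|u - t| <= 1 -> rnorm (g u - g t - (u - t)%:C * g' t) <= K * (u - t) ^+ 2.

Lemma loclip_bound (g : R -> C) : loclip g -> forall t, exists2 M : R, 0 <= M &
  forall u, `|u - t| <= 1 -> rnorm (g u) <= M.
Proof.
move=> hg t; have [K hK] := hg t; exists (`|K| + rnorm (g t)); first by rewrite addr_ge0.
move=> u ut; rewrite -(subrK (g t) (g u)); apply: le_trans (rnormD _ _) _.
rewrite lerD2r; apply: le_trans (hK u ut) _.
apply: le_trans (ler_norm _) _; rewrite normrM normr_id ler_piMr//.
Qed.

Lemma loclip_cst (a : C) : loclip (fun=> a).
Proof. by move=> t; exists 0 => u _; rewrite subrr rnorm0 mul0r. Qed.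

Lemma loclipD (f g : R -> C) : loclip f -> loclip g -> loclip (fun t => f t + g t).
Proof.
move=> hf hg t; have [K hK] := hf t; have [L hL] := hg t.
exists (K + L) => u ut; rewrite opprD addrACA mulrDl.
by apply: le_trans (rnormD _ _) _; rewrite lerD ?hK ?hL.
Qed.

Lemma loclipM (f g : R -> C) : loclip f -> loclip g -> loclip (fun t => f t * g t).
Proof.
move=> hf hg t; have [K hK] := hf t; have [L hL] := hg t.
have [M M0 hM] := loclip_bound hf t.
exists (M * L + K * rnorm (g t)) => u ut.
rewrite (_ : _ - _ = f u * (g u - g t) + (f u - f t) * g t); last by ring.
apply: le_trans (rnormD _ _) _; rewrite !rnormM mulrDl lerD//.
  by rewrite -mulrA ler_pM ?hM ?hL.
by rewrite mulrAC ler_wpM2r ?hK.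
Qed.

Lemma loclipB (f g : R -> C) : loclip f -> loclip g -> loclip (fun t => f t - g t).
Proof.
move=> hf hg; have := loclipD hf (loclipM (loclip_cst (-1)) hg).
by under eq_fun do rewrite mulN1r.
Qed.

Lemma cderiv_loclip (g g' : R -> C) : cderiv g g' -> loclip g.
Proof.
move=> hg t; have [K hK] := hg t; exists (`|K| + rnorm (g' t)) => u ut.
rewrite -(subrK ((u - t)%:C * g' t) (g u - g t)); apply: le_trans (rnormD _ _) _.
rewrite rnormM rnormR mulrDl [X in _ + X]mulrC lerD2r.
apply: le_trans (hK u ut) _.
apply: le_trans (ler_norm _) _; rewrite normrM ler_wpM2l//.
by rewrite normrX expr2 ler_piMl.
Qed.

Lemma cderiv_cst (a : C) : cderiv (fun=> a) (fun=> 0).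
Proof. by move=> t; exists 0 => u _; rewrite mulr0 subrr subr0 rnorm0 mul0r. Qed.

Lemma cderivD (f f' g g' : R -> C) : cderiv f f' -> cderiv g g' ->
  cderiv (fun t => f t + g t) (fun t => f' t + g' t).
Proof.
move=> hf hg t; have [K hK] := hf t; have [L hL] := hg t.
exists (K + L) => u ut.
rewrite (_ : _ - _ - _ = (f u - f t - (u - t)%:C * f' t) + (g u - g t - (u - t)%:C * g' t));
  last by ring.
by rewrite mulrDl; apply: le_trans (rnormD _ _) _; rewrite lerD ?hK ?hL.
Qed.

Lemma cderivM (f f' g g' : R -> C) : cderiv f f' -> cderiv g g' ->
  cderiv (fun t => f t * g t) (fun t => f' t * g t + f t * g' t).
Proof.
move=> hf hg t; have [K hK] := hf t; have [L hL] := hg t.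
have [M M0 hM] := loclip_bound (cderiv_loclip hf) t.
have [N hN] := cderiv_loclip hf t.
exists (M * L + K * rnorm (g t) + N * rnorm (g' t)) => u ut.
rewrite (_ : _ - _ - _ = f u * (g u - g t - (u - t)%:C * g' t)
   + (f u - f t - (u - t)%:C * f' t) * g t + (f u - f t) * ((u - t)%:C * g' t)); last by ring.
rewrite [leRHS]mulrDl; apply: le_trans (rnormD _ _) _; apply: lerD; last first.
  rewrite !rnormM rnormR sqr_normM.
  rewrite (_ : N * rnorm (g' t) * (`|u - t| * `|u - t|) =
    N * `|u - t| * (`|u - t| * rnorm (g' t))); last by ring.
  by apply: ler_wpM2r; [rewrite mulr_ge0|exact: hN].
rewrite [leRHS]mulrDl; apply: le_trans (rnormD _ _) _; apply: lerD.
  by rewrite rnormM -mulrA ler_pM ?hM ?hL.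
by rewrite rnormM mulrAC ler_wpM2r ?hK.
Qed.

Lemma cderivZ (a : C) (g g' : R -> C) : cderiv g g' ->
  cderiv (fun t => a * g t) (fun t => a * g' t).
Proof.
move=> hg; have := cderivM (cderiv_cst a) hg.
by under [X in cderiv _ X]eq_fun do rewrite mul0r add0r.
Qed.

Lemma cderiv_cis : cderiv (@cis R) (fun t => 'i * cis t).
Proof. by move=> t; exists 2 => u _; exact: cis_taylor. Qed.

Lemma loclip_cis : loclip (@cis R).
Proof. exact: cderiv_loclip cderiv_cis. Qed.

Lemma loclip_continuous (g : R -> C) : loclip g ->
  continuous (fun t => complex.Re (g t)) /\ continuous (fun t => complex.Im (g t)).
Proof.
move=> hg.
have aux (p : C -> R) : (forall a b, p (a - b) = p a - p b) ->
    (forall a, `|p a| <= rnorm a) -> continuous (fun t => p (g t)).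
  move=> pB pN t; apply/cvgrPdist_lt => e e0; have [K hK] := hg t.
  have K1 : 0 < `|K| + 1 by rewrite ltr_wpDl.
  near=> u; rewrite -pB; apply: le_lt_trans (pN _) _; rewrite rnorm_distC.
  apply: le_lt_trans (hK u _) _.
    by rewrite distrC; near: u; apply: cvgr_dist_le => //; exact: cvg_id.
  apply: (@le_lt_trans _ _ ((`|K| + 1) * `|u - t|)).
    by rewrite ler_wpM2r//; apply: le_trans (ler_norm _) _; rewrite lerDl.
  rewrite -ltr_pdivlMl// distrC mulrC; near: u.
  by apply: cvgr_dist_lt; [exact: cvg_id|rewrite divr_gt0].
split; apply: aux => [a b|a].
- exact: raddfB. - exact: Re_le_rnorm. - exact: raddfB. - exact: Im_le_rnorm.
Unshelve. all: by end_near. Qed.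

(** Stated for a real-linear contraction [p] so as to apply to the real and to the
    imaginary part. *)
Lemma cderiv_is_derive (g g' : R -> C) (p : C -> R) :
  (forall a b, p (a - b) = p a - p b) -> (forall (r : R) a, p (r%:C * a) = r * p a) ->
  (forall a, `|p a| <= rnorm a) -> cderiv g g' ->
  forall t : R, is_derive t 1 (fun t => p (g t)) (p (g' t)).
Proof.
move=> pB pZ pN hg t; have [K hK] := hg t.
have K1 : 0 < `|K| + 1 by rewrite ltr_wpDl.
have lim : (fun h : R => h^-1 * (p (g (h + t)) - p (g t))) @ 0^' --> p (g' t).
  apply/cvgrPdist_le => e e0; near=> h.
  have h0 : h != 0 by near: h; exact: nbhs_dnbhs_neq.
  have nh : 0 < `|h| by rewrite normr_gt0.
  (* the first bound makes the remainder estimate available, the second one makes it small *)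
  have h1 : `|h| <= Num.min 1 (e / (`|K| + 1)).
    near: h; apply: dnbhs0_le; rewrite lt_min ltr01/= divr_gt0//.
  move: h1; rewrite le_min => /andP[h1 h2].
  have := hK (h + t); rewrite addrK => /(_ h1) hh.
  rewrite distrC -(@ler_pM2l _ `|h|)// -normrM mulrBr.
  rewrite mulrA divff// mul1r -pB -pZ -pB.
  apply: le_trans (pN _) _; apply: le_trans hh _.
  rewrite sqr_normM mulrCA ler_wpM2l//.
  apply: (@le_trans _ _ ((`|K| + 1) * `|h|)).
    by rewrite ler_wpM2r//; apply: le_trans (ler_norm _) _; rewrite lerDl.
  by rewrite -ler_pdivlMl// mulrC.
have E : (fun h : R => h^-1 *: (p (g (h *: (1 : R) + t)) - p (g t))) =
    (fun h : R => h^-1 * (p (g (h + t)) - p (g t))).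
  by apply/funext => h; rewrite /GRing.scale /= mulr1.
apply: DeriveDef; first by rewrite /derivable /= E; apply/cvg_ex; exists (p (g' t)).
by rewrite /derive /= E; apply: cvg_lim.
Unshelve. all: by end_near. Qed.

End CurveCalculus.

(** * Integrals of locally Lipschitz complex functions *)

Section ComplexIntegral.
Variable R : realType.
Local Notation C := R[i].
Local Notation mu := (@lebesgue_measure R).
Local Notation I02pi := (`[0 : R, 2 * pi]%classic).
Local Notation "'ci' f" := (complex_integral f 0 (2 * pi)) (at level 10).

Lemma pi2_gt0 : 0 < 2 * pi :> R.
Proof. by rewrite mulr_gt0 ?pi_gt0. Qed.

Lemma continuous_integrable_segment (f : R -> R) (a b : R) : continuous f ->
  mu.-integrable `[a, b] (EFin \o f).
Proof.
move=> cf; apply: continuous_compact_integrable; first exact: segment_compact.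
exact: continuous_subspaceT.
Qed.

Lemma loclip_integrable (g : R -> C) : loclip g ->
  mu.-integrable I02pi (EFin \o (fun t => complex.Re (g t))) /\
  mu.-integrable I02pi (EFin \o (fun t => complex.Im (g t))).
Proof.
by move=> /loclip_continuous[h1 h2]; split; exact: continuous_integrable_segment.
Qed.

Lemma complex_integralD (f g : R -> C) : loclip f -> loclip g ->
  ci (fun t => f t + g t) = ci f + ci g.
Proof.
move=> /loclip_integrable[f1 f2] /loclip_integrable[g1 g2].
rewrite /complex_integral.
under eq_Rintegral do rewrite raddfD /=.
under [X in _ +i* X]eq_Rintegral do rewrite raddfD /=.
by rewrite !RintegralD.
Qed.

Lemma complex_integralZ (a : C) (f : R -> C) : loclip f ->
  ci (fun t => a * f t) = a * ci f.
Proof.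
move=> /loclip_integrable[f1 f2].
have iZ (r : R) (h : R -> R) : mu.-integrable I02pi (EFin \o h) ->
    mu.-integrable I02pi (EFin \o (fun t => r * h t)).
  move=> ih; rewrite (_ : EFin \o _ = (fun t => r%:E * (EFin \o h) t)%E) //.
  by apply: integrableZl.
case: a => a b; rewrite /complex_integral.
under eq_Rintegral => t _.
  rewrite (_ : complex.Re _ = a * complex.Re (f t) - b * complex.Im (f t)); last by case: (f t).
  over.
under [X in _ +i* X]eq_Rintegral => t _.
  rewrite (_ : complex.Im _ = a * complex.Im (f t) + b * complex.Re (f t)); last by case: (f t).
  over.
by rewrite RintegralB ?RintegralD ?RintegralZl//; try exact: iZ; simpc.
Qed.

(** The factor is 4 pi instead of 2 pi because the real and the imaginary parts are
    estimated separately; only finiteness and linearity in [M] matter. *)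
Lemma complex_integral_bound (f : R -> C) (M : R) : loclip f ->
  (forall t, rnorm (f t) <= M) -> rnorm (ci f) <= 4 * pi * M.
Proof.
move=> lf fM; have [f1 f2] := loclip_integrable lf.
have aux (p : C -> R) : (forall a, `|p a| <= rnorm a) -> continuous (fun t => p (f t)) ->
    `|Rintegral mu I02pi (fun t => p (f t))| <= 2 * pi * M.
  move=> pN cp; have ip := @continuous_integrable_segment _ 0 (2 * pi) cp.
  apply: le_trans (le_normr_Rintegral _ _ ) _ => //.
  apply: (@le_trans _ _ (\int[mu]_(t in I02pi) M)).
    apply: le_Rintegral => //.
    - exact: (integrable_norm ip).
    - by apply: continuous_integrable_segment; exact: cst_continuous.
    - by move=> x _; exact: le_trans (pN _) (fM _).
  have E := @lebesgue_measure_itv R `[0, 2 * pi]%R.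
  rewrite /= lte_fin pi2_gt0 sube0 /= in E.
  by rewrite Rintegral_cst// [X in fine X]E /= mulrC.
have [c1 c2] := loclip_continuous lf.
apply: le_trans (rnorm_ReIm _) _ => /=.
apply: le_trans (lerD (aux _ (@Re_le_rnorm R) c1) (aux _ (@Im_le_rnorm R) c2)) _.
by rewrite -mulrDl -mulrDl -natrD.
Qed.

Lemma complex_FTC (g g' : R -> C) : cderiv g g' -> loclip g' ->
  ci g' = g (2 * pi) - g 0.
Proof.
move=> hg lg'.
have aux (p : C -> R) : 
  (forall a b, p (a - b) = p a - p b) -> (forall (r : R) a, p (r%:C * a) = r * p a) ->
  (forall a, `|p a| <= rnorm a) -> continuous (fun t => p (g' t)) ->
  Rintegral mu I02pi (fun t => p (g' t)) = p (g (2 * pi)) - p (g 0).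
  move=> pB pZ pN cp.
  have der (t : R) := cderiv_is_derive pB pZ pN hg t.
  have cg (t : R) : {for t, continuous (fun t => p (g t))}.
    apply/differentiable_continuous; apply/derivable1_diffP; exact: (@ex_derive _ _ _ _ _ _ _ (der t)).
  rewrite /Rintegral (@continuous_FTC2 _ _ (fun t => p (g t)))//.
  - exact: pi2_gt0.
  - exact: continuous_subspaceT.
  - split; first by move=> t _; exact: (@ex_derive _ _ _ _ _ _ _ (der t)).
      exact/cvg_at_right_filter/cg.
    exact/cvg_at_left_filter/cg.
  - by move=> t _; rewrite derive1E (@derive_val _ _ _ _ _ _ _ (der t)).
have [c1 c2] := loclip_continuous lg'.
rewrite /complex_integral !aux //.
- by case: (g (2 * pi)) => ? ?; case: (g 0) => ? ?; simpc.
- exact: raddfB.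
- by move=> r [a b]; simpc.
- exact: Im_le_rnorm.
- exact: raddfB.
- by move=> r [a b]; simpc.
- exact: Re_le_rnorm.
Qed.

End ComplexIntegral.

(** * Deformation of circle integrals *)

Section Homotopy.
Variable R : realType.
Local Notation C := R[i].

(** Holomorphy on an arbitrary set with a uniform quadratic remainder. Resolvents
    satisfy it directly by the resolvent identity, wherever they are bounded. *)
Definition holo_on (G : set C) (f f' : C -> C) (K : R) :=
  forall z w, G z -> G w ->
    rnorm (f w - f z - f' z * (w - z)) <= K * rnorm (w - z) ^+ 2.

(** Adding the expansions of [f] at [z] and at [w] leaves (f' w - f' z)(w - z). *)
Lemma holo_on_lip (G : set C) f f' K : holo_on G f f' K ->
  forall z w, G z -> G w -> rnorm (f' w - f' z) <= 2 * K * rnorm (w - z).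
Proof.
move=> hf z w Gz Gw; have [->|wz] := eqVneq w z.
  by rewrite !subrr rnorm0 mulr0.
have n0 : 0 < rnorm (w - z) by rewrite rnorm_gt0// subr_eq0.
rewrite -(ler_pM2r n0) -rnormM.
rewrite (_ : (f' w - f' z) * (w - z) =
  (f w - f z - f' z * (w - z)) + (f z - f w - f' w * (z - w))); last by ring.
apply: le_trans (rnormD _ _) _.
apply: le_trans (lerD (hf _ _ Gz Gw) (hf _ _ Gw Gz)) _.
rewrite [rnorm (z - w)]rnorm_distC le_eqVlt; apply/orP; left; apply/eqP; ring.
Qed.

Section Curve.
Variables (G : set C) (f f' : C -> C) (K M : R) (y y' : R -> C).
Hypotheses (hf : holo_on G f f' K) (fM : forall z, G z -> rnorm (f' z) <= M).
Hypotheses (Gy : forall t, G (y t)) (hy : cderiv y y').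

Lemma holo_deriv_loclip : loclip (fun t => f' (y t)).
Proof.
move=> t; have [L hL] := cderiv_loclip hy t.
exists (`|2 * K| * L) => u ut; apply: le_trans (holo_on_lip hf (Gy t) (Gy u)) _.
apply: (@le_trans _ _ (`|2 * K| * rnorm (y u - y t))).
  by rewrite ler_wpM2r// ler_norm.
by rewrite -mulrA ler_wpM2l// hL.
Qed.

Lemma holo_cderiv : cderiv (fun t => f (y t)) (fun t => f' (y t) * y' t).
Proof.
move=> t; have [L hL] := cderiv_loclip hy t; have [N hN] := hy t.
exists (`|K| * L ^+ 2 + M * N) => u ut.
rewrite (_ : _ - _ - _ = (f (y u) - f (y t) - f' (y t) * (y u - y t))
  + f' (y t) * (y u - y t - (u - t)%:C * y' t)); last by ring.
apply: le_trans (rnormD _ _) _; rewrite mulrDl lerD//.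
  apply: le_trans (hf (Gy t) (Gy u)) _.
  apply: (@le_trans _ _ (`|K| * rnorm (y u - y t) ^+ 2)).
    by rewrite ler_wpM2r ?exprn_ge0// ler_norm.
  rewrite -mulrA ler_wpM2l// -[(u - t) ^+ 2]ger0_norm ?sqr_ge0// normrX -exprMn.
  by rewrite ler_pXn2r ?nnegrE ?hL//; apply: le_trans (hL u ut).
by rewrite rnormM -mulrA ler_pM ?hN ?fM.
Qed.

Lemma holo_loclip : loclip (fun t => f (y t)).
Proof. exact: cderiv_loclip holo_cderiv. Qed.

End Curve.

Lemma circle_cderiv (c : C) (r : R) :
  cderiv (fun t => c + r%:C * cis t) (fun t => 'i * r%:C * cis t).
Proof.
have := cderivD (cderiv_cst c) (cderivZ r%:C (@cderiv_cis R)).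
by under [X in cderiv _ X]eq_fun do rewrite add0r mulrCA mulrA.
Qed.

(** The integrand is the derivative of a function of the angle with period 2 pi. *)
Lemma circle_integral_primitive (G : set C) f f' K M (c : C) (r : R) :
  holo_on G f f' K -> (forall z, G z -> rnorm (f' z) <= M) ->
  (forall t, G (c + r%:C * cis t)) -> circle_integral f' c r = 0.
Proof.
move=> hf fM Gc; have hc := circle_cderiv c r.
rewrite /circle_integral (complex_FTC (holo_cderiv hf fM Gc hc)).
  by rewrite cis2pi cis0 subrr.
apply: loclipM; first exact: (holo_deriv_loclip hf Gc hc).
by apply: loclipM; [exact: loclip_cst|exact: loclip_cis].
Qed.

(** Cut [0, 1] into n pieces: the n increments add up to at most K / n. *)
Lemma quadratic_increment_constant (F : R -> C) (K : R) :
  (forall s t, 0 <= s <= 1 -> 0 <= t <= 1 -> rnorm (F t - F s) <= K * (t - s) ^+ 2) ->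
  F 1 = F 0.
Proof.
move=> hF; apply/eqP; rewrite -subr_eq0; apply/eqP.
have K0 : 0 <= K.
  have := hF 0 1; rewrite !lexx ler01 subr0 expr1n mulr1 => /(_ isT isT).
  exact: le_trans.
apply: (@rnorm_small_eq0 R _ _ K) => e e0.
have [N _ /(_ N (leqnn _)) /= hN] := near_infty_natSinv_lt (PosNum e0).
set n : R := N.+1%:R in hN; have n0 : 0 < n by rewrite ltr0n.
have step k : (k <= N.+1)%N -> rnorm (F (k%:R / n) - F 0) <= k%:R * (K / n ^+ 2).
  elim: k => [|k IH] kN; first by rewrite !mul0r subrr rnorm0.
  apply: le_trans (rnorm_distD (F (k%:R / n)) _ _) _.
  have kn (j : nat) : (j <= N.+1)%N -> 0 <= j%:R / n <= 1.
    by move=> jN; rewrite divr_ge0 ?ler0n ?(ltW n0)//= ler_pdivrMr// mul1r ler_nat.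
  rewrite [leRHS](_ : _ = K / n ^+ 2 + k%:R * (K / n ^+ 2)); last first.
    by rewrite -natr1 mulrDl mul1r addrC.
  apply: lerD; last exact/IH/ltnW.
  apply: le_trans (hF _ _ (kn _ (ltnW kN)) (kn _ kN)) _.
  by rewrite -mulrBl -natr1 addrAC subrr add0r div1r exprVn.
have := step N.+1 (leqnn _); rewrite -/n divff ?gt_eqF// => /le_trans; apply.
rewrite expr2 invfM mulrCA [n * _]mulrA divff ?gt_eqF// mul1r.
by rewrite ler_wpM2l// ltW.
Qed.

(** Cauchy's theorem for a linear deformation of circles. To first order in the
    parameter, the change of the integrand is the angular derivative of f times the
    displacement of the circle, so it integrates to 0; what is left is quadratic in
    the change of the parameter. *)
Lemma circle_homotopy (G : set C) f f' K M (c0 c1 : C) (r0 r1 : R) :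
  holo_on G f f' K -> (forall z, G z -> rnorm (f' z) <= M) -> 
  (forall s t, 0 <= s <= 1 ->
    G ((c0 + s%:C * (c1 - c0)) + (r0 + s * (r1 - r0))%:C * cis t)) ->
  circle_integral f c0 r0 = circle_integral f c1 r1.
Proof.
move=> hf fM hG.
pose c s := c0 + s%:C * (c1 - c0); pose r s : R := r0 + s * (r1 - r0).
pose y s t := c s + (r s)%:C * cis t; pose y' s t := 'i * (r s)%:C * cis t.
pose F s := circle_integral f (c s) (r s).
suff : F 1 = F 0.
  by rewrite /F /c /r !mul0r !addr0 !mul1r ![_ + (_ - _)]addrC !subrK.
have [z0 Gz0] : exists z, G z by exists (y 0 0); apply: hG; rewrite lexx ler01.
have M0 : 0 <= M by apply: le_trans (fM _ Gz0).
pose D := rnorm (c1 - c0) + `|r1 - r0|; pose L := `|r0| + `|r1 - r0|.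
have D0 : 0 <= D by rewrite addr_ge0.
have L0 : 0 <= L by rewrite addr_ge0.
apply: (@quadratic_increment_constant F (4 * pi * (`|K| * D ^+ 2 * L + M * D * D))) => s s' hs hs'.
pose h := s' - s.
have Gs t : G (y s t) by exact: hG.
have Gs' t : G (y s' t) by exact: hG.
have ds := circle_cderiv (c s) (r s); have ds' := circle_cderiv (c s') (r s').
pose d t := h%:C * ((c1 - c0) + (r1 - r0)%:C * cis t).
pose d' t := h%:C * ('i * (r1 - r0)%:C * cis t).
have hd : cderiv d d' by apply: cderivZ; exact: circle_cderiv.
have yd t : y s' t = y s t + d t.
  by rewrite /y /d /c /r /h !rmorphD !rmorphM !rmorphB /=; ring.
have yd' t : y' s' t = y' s t + d' t.
  by rewrite /y' /d' /r /h !rmorphD !rmorphM !rmorphB /=; ring.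
have lipd' : loclip d'.
  apply: loclipM; first exact: loclip_cst.
  by apply: loclipM; [exact: loclip_cst|exact: loclip_cis].
have lipy' x : loclip (y' x).
  by apply: loclipM; [exact: loclip_cst|exact: loclip_cis].
have lipf := holo_loclip hf fM Gs ds; have lipf' := holo_deriv_loclip hf Gs ds.
have lipfs' := holo_loclip hf fM Gs' ds'.
(* [rest] is quadratic in [h]; [g'] is the derivative of the periodic function [g] *)
pose rest t := (f (y s' t) - f (y s t) - f' (y s t) * d t) * y' s' t + f' (y s t) * d t * d' t.
pose g t := f (y s t) * d t.
pose g' t := (f' (y s t) * y' s t) * d t + f (y s t) * d' t.
have hg : cderiv g g' := cderivM (holo_cderiv hf fM Gs ds) hd.
have lipg' : loclip g'.
  apply: loclipD; last exact: loclipM.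
  by apply: loclipM; [exact: loclipM|exact: cderiv_loclip hd].
have liprest : loclip rest.
  apply: loclipD; last by apply: loclipM => //; apply: loclipM => //; exact: cderiv_loclip hd.
  apply: loclipM => //; apply: loclipB; first exact: loclipB.
  by apply: loclipM => //; exact: cderiv_loclip hd.
have key : F s' = F s + (complex_integral rest 0 (2 * pi) + complex_integral g' 0 (2 * pi)).
  rewrite -complex_integralD// -complex_integralD//; last exact: loclipD.
    congr (complex_integral _ _ _); apply/funext => t.
    rewrite -[c s' + _]/(y s' t) -[_ * cis t in LHS]/(y' s' t).
    rewrite -[c s + _]/(y s t) -[_ * cis t in RHS]/(y' s t) /rest /g'.
    by rewrite yd'; ring.
  exact: (loclipM lipf (lipy' s)).
have g0 : complex_integral g' 0 (2 * pi) = 0.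
  by rewrite (complex_FTC hg)// /g /y /d cis2pi cis0 subrr.
rewrite key g0 addr0 [F s + _]addrC addrK -/h.
have nd t : rnorm (d t) <= `|h| * D.
  rewrite /d rnormM rnormR ler_wpM2l//; apply: le_trans (rnormD _ _) _.
  by rewrite rnormM rnorm_cis mulr1 rnormR.
have nd' t : rnorm (d' t) <= `|h| * D.
  rewrite /d' !rnormM rnormR rnorm_cis rnorm_i mul1r mulr1 rnormR ler_wpM2l//.
  by rewrite lerDr.
have ny' t : rnorm (y' s' t) <= L.
  rewrite /y' !rnormM rnorm_cis rnorm_i mul1r mulr1 rnormR /r.
  apply: le_trans (ler_normD _ _) _; rewrite lerD2l normrM ler_piMl//.
  by case/andP: hs' => s0 s1; rewrite ger0_norm.
rewrite [X in _ <= X](_ : _ = 4 * pi * ((`|K| * D ^+ 2 * L + M * D * D) * h ^+ 2)); last first.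
  by ring.
apply: (complex_integral_bound liprest) => t.
rewrite mulrDl; apply: le_trans (rnormD _ _) _; apply: lerD.
  rewrite rnormM mulrAC ler_pM//.
  rewrite (_ : d t = y s' t - y s t); last by rewrite yd addrC addKr.
  apply: le_trans (hf _ _ (Gs t) (Gs' t)) _.
  apply: (@le_trans _ _ (`|K| * rnorm (y s' t - y s t) ^+ 2)).
    by rewrite ler_wpM2r ?exprn_ge0// ler_norm.
  rewrite -mulrA ler_wpM2l// yd addrC addKr -[h ^+ 2]ger0_norm ?sqr_ge0// normrX -exprMn mulrC.
  by rewrite ler_pXn2r ?nnegrE// mulr_ge0.
rewrite rnormM [rnorm (_ * d t)]rnormM sqr_normM.
rewrite (_ : M * D * D * _ = M * (`|h| * D) * (`|h| * D)); last by ring.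
apply: ler_pM => //; first by rewrite mulr_ge0.
by apply: ler_pM => //; exact: fM.
Qed.

End Homotopy.

(** * Resolvents and the contours of Riesz projections *)

Section Resolvents.
Variables (R : realType) (H : completeNormedModType R[i]).
Local Notation C := R[i].
Variable A : unbounded_op H.
Hypothesis lA : linear_op A.

Lemma act0 : A 0 = 0.
Proof.
have [d0 h] := lA; have [_] := h 1 0 0 d0 d0; rewrite !scale1r addr0.
by move/eqP; rewrite -{1}[A 0]addr0 (inj_eq (addrI _)) eq_sym => /eqP.
Qed.
Lemma domZ a x : dom A x -> dom A (a *: x).
Proof. by have [d0 h] := lA => dx; have [] := h a x 0 dx d0; rewrite addr0. Qed.
Lemma actZ a x : dom A x -> A (a *: x) = a *: A x.
Proof. by have [d0 h] := lA => dx; have [] := h a x 0 dx d0; rewrite addr0 act0 addr0. Qed.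
Lemma domD x y : dom A x -> dom A y -> dom A (x + y).
Proof. by have [d0 h] := lA => dx dy; have [] := h 1 x y dx dy; rewrite scale1r. Qed.
Lemma actD x y : dom A x -> dom A y -> A (x + y) = A x + A y.
Proof. by have [d0 h] := lA => dx dy; have [] := h 1 x y dx dy; rewrite !scale1r. Qed.
Lemma domB x y : dom A x -> dom A y -> dom A (x - y).
Proof. by move=> dx dy; rewrite -scaleN1r; apply: domD => //; exact: domZ. Qed.
Lemma actB x y : dom A x -> dom A y -> A (x - y) = A x - A y.
Proof.
move=> dx dy; rewrite -scaleN1r actD//; last exact: domZ.
by rewrite actZ// scaleN1r.
Qed.

Lemma is_resolvent_unique z T T' :
  is_resolvent A z T -> is_resolvent A z T' -> T = T'.
Proof.
move=> [_ h1 _] [_ _ h2]; apply/funext => x; have [dx ex] := h1 x.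
by rewrite -{2}ex h2.
Qed.

Lemma resolventP z : resolvent_set A z -> is_resolvent A z (resolvent A z).
Proof. by move=> [T hT]; apply: (xgetPex _ (ex_intro _ T hT)). Qed.

Lemma resolventE z T : is_resolvent A z T -> resolvent A z = T.
Proof. by move=> h; exact: (is_resolvent_unique (resolventP (ex_intro _ T h)) h). Qed.

(** The resolvent identity. *)
Lemma resolvent_eq w z T S x : is_resolvent A w T -> is_resolvent A z S ->
  T x = S x + (w - z) *: T (S x).
Proof.
move=> [[lT _] _ hT] [_ hS _]; have [dx ex] := hS x.
have e : x = (A (S x) - w *: S x) + (w - z) *: S x.
  by rewrite scalerBl addrA subrK ex.
by rewrite {1}e (linD lT) (linZ lT) hT.
Qed.

(** By the resolvent identity |T x| <= t |x| + |w - z0| t |T x|, and the last term is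
    at most half of |T x|. *)
Lemma resolvent_local_bound z0 T0 (t : R) w T : 0 <= t ->
  is_resolvent A z0 T0 -> opbound T0 t -> rnorm (w - z0) * t <= 2^-1 ->
  is_resolvent A w T -> opbound T (2 * t).
Proof.
move=> t0 h0 b0 wz h x.
have e := resolvent_eq x h0 h.
have h1 : rnorm (T x) <= t * rnorm x + 2^-1 * rnorm (T x).
  rewrite -[T x in leLHS](addrK ((z0 - w) *: T0 (T x))) -e.
  apply: le_trans (rnormB _ _) _; apply: lerD; first exact: b0.
  rewrite rnormZ rnorm_distC; apply: le_trans (ler_wpM2l _ (b0 _)) _ => //.
  by rewrite mulrA ler_wpM2r.
lra.
Qed.

Section Family.
Variables (G : set C) (T : C -> H -> H) (M : R).
Hypothesis M0 : 0 <= M.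
Hypothesis bT : forall z, G z -> opbound (T z) M.
Hypothesis eT : forall w z x, G w -> G z -> T w x = T z x + (w - z) *: T w (T z x).
Variables (phi : H -> C) (B : R).
Hypotheses (B0 : 0 <= B) (lphi : linear phi) (bphi : opbound phi B).

(** Two applications of the resolvent identity leave the remainder
    (w - z)^2 T(w) T(z) T(z). *)
Lemma resolvent_holo x : holo_on G (fun z => phi (T z x)) (fun z => phi (T z (T z x)))
  (B * (M * (M * (M * rnorm x)))).
Proof.
move=> z w Gz Gw.
have -> : phi (T w x) - phi (T z x) - phi (T z (T z x)) * (w - z) =
    (w - z) ^+ 2 * phi (T w (T z (T z x))).
  rewrite (eT x Gw Gz) (eT (T z x) Gw Gz) !(linD lphi) !(linZ lphi) (linD lphi) (linZ lphi).
  rewrite -/(_ * _); move: (phi _) (phi (T z (T z x))) (phi (T w _)) => a b c.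
  by rewrite /GRing.scale /=; ring.
rewrite rnormM rnormX mulrC ler_wpM2r ?exprn_ge0//.
apply: le_trans (bphi _) _; rewrite ler_wpM2l//.
apply: le_trans (bT Gw _) _; rewrite ler_wpM2l//.
by apply: le_trans (bT Gz _) _; rewrite ler_wpM2l// bT.
Qed.

Lemma resolvent_deriv_bound x z : G z -> rnorm (phi (T z (T z x))) <= B * (M * (M * rnorm x)).
Proof.
move=> Gz; apply: le_trans (bphi _) _; rewrite ler_wpM2l//.
by apply: le_trans (bT Gz _) _; rewrite ler_wpM2l// bT.
Qed.

End Family.

Lemma rnorm_cis_sub (s t : R) : rnorm (cis s - cis t) <= 2 * `|s - t|.
Proof.
set h := s - t; have -> : s = t + h by rewrite /h addrC subrK.
clearbody h; rewrite cisD -{2}[cis t]mulr1 -mulrBr rnormM rnorm_cis mul1r.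
apply: le_trans (rnorm_ReIm _) _; rewrite /cis; simpc => /=.
by rewrite ?subr0 mulr2n mulrDl mul1r lerD ?normr_cos_sub1_lin ?normr_sin_le.
Qed.

(** Reduces the angle to a compact interval. *)
Lemma cis_reduce (t : R) : exists2 t', - pi <= t' <= pi & cis t' = cis t.
Proof.
have ct : -1 <= cos t <= 1 by rewrite cos_geN1 cos_le1.
pose a := acos (cos t); have ca : cos a = cos t by rewrite acosK// in_itv.
have a0 : 0 <= a <= pi by rewrite acos_ge0// acos_lepi.
have /eqP : sin a ^+ 2 = sin t ^+ 2 by rewrite !sin2cos2 ca.
rewrite eqf_sqr => /orP[]/eqP sa.
  exists a; last by rewrite /cis ca sa.
  by case/andP: a0 => h1 h2; rewrite h2 andbT (le_trans _ h1)// oppr_le0 pi_ge0.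
exists (- a); last by rewrite /cis cosN sinN ca sa opprK.
case/andP: a0 => h1 h2; rewrite lerN2 h2/=; apply: le_trans (pi_ge0 _).
by rewrite oppr_le0.
Qed.

(** Compactness of the parameter rectangle turns the local bounds into one bound. *)
Lemma resolvent_uniform_bound (c0 c1 : C) (r0 r1 : R) :
  let y s t := (c0 + s%:C * (c1 - c0)) + (r0 + s * (r1 - r0))%:C * cis t in
  (forall s t, 0 <= s <= 1 -> resolvent_set A (y s t)) ->
  exists2 M : R, 0 <= M & forall s t, 0 <= s <= 1 -> opbound (resolvent A (y s t)) M.
Proof.
move=> y hy.
pose K : set (R * R) := `[0, 1]%classic `*` `[- pi, pi]%classic.
have cK : compact K by apply: compact_setX; exact: segment_compact.
have := cK; rewrite compact_near_coveringP => nc.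
pose Pb (M : R) (p : R * R) :=
  resolvent_set A (y p.1 p.2) -> opbound (resolvent A (y p.1 p.2)) M.
have [[s t] [Ks Kt]|M [_ hM]] := nc R (pinfty_nbhs R) Pb _.
  move: Ks; rewrite /= in_itv => Ks.
  have hT := resolventP (hy s t Ks); have [bT _ _] := hT.
  have [_ [b b0 hb]] := (bounded_opP _).1 bT.
  (* a Lipschitz constant of the family of circles near (s, t) *)
  pose N := rnorm (c1 - c0) + `|r1 - r0| + 2 * `|r0 + s * (r1 - r0)| + 1.
  have N0 : 0 < N by rewrite ltr_pwDr// !addr_ge0// mulr_ge0.
  pose d := (2 * b * N)^-1; have d0 : 0 < d by rewrite invr_gt0 !mulr_gt0.
  exists ((ball s d `*` ball t d), [set M | 2 * b <= M]); first split => /=.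
  - by exists (ball s d, ball t d) => //; split; exact: nbhsx_ballx.
  - by exists (2 * b); split; [exact: num_real|move=> x /ltW].
  move=> [[s' t'] M'] [[/= hs ht] hM'] /= hres.
  have hT' := resolventP hres.
  apply: opbound_le hM' _; apply: (resolvent_local_bound (ltW b0) hT hb _ hT').
  have {}hs : `|s' - s| < d by rewrite distrC.
  have {}ht : `|t' - t| < d by rewrite distrC.
  have -> : y s' t' - y s t = (s' - s)%:C * (c1 - c0) + ((s' - s) * (r1 - r0))%:C * cis t'
     + (r0 + s * (r1 - r0))%:C * (cis t' - cis t).
    by rewrite /y !rmorphD !rmorphM !rmorphB /=; ring.
  rewrite -ler_pdivlMr// -invfM; apply: (@le_trans _ _ (d * N)); last first.
    by rewrite /d [(2 * b * N)^-1]invfM -mulrA mulVf ?gt_eqF// mulr1.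
  apply: le_trans (rnormD _ _) _; apply: le_trans (lerD (rnormD _ _) (lexx _)) _.
  rewrite !rnormM rnorm_cis mulr1 !rnormR normrM.
  have e1 := ler_wpM2r (rnorm_ge0 (c1 - c0)) (ltW hs).
  have e2 := ler_wpM2r (normr_ge0 (r1 - r0)) (ltW hs).
  have e3 : `|r0 + s * (r1 - r0)| * rnorm (cis t' - cis t) <= d * (2 * `|r0 + s * (r1 - r0)|).
    rewrite mulrA mulrC ler_wpM2r//; apply: le_trans (rnorm_cis_sub _ _) _.
    by rewrite mulrC ler_wpM2r// ltW.
  apply: le_trans (lerD (lerD e1 e2) e3) _.
  by rewrite -!mulrDr ler_wpM2l ?(ltW d0)// /N lerDl.
exists (`|M| + 1); first by rewrite addr_ge0.
move=> u v hu; have [v' hv' ev] := cis_reduce v.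
have ey : y u v = y u v' by rewrite /y ev.
rewrite ey; apply: (hM (`|M| + 1) _ (u, v')); last exact: hy.
  by apply: le_lt_trans (ler_norm _) _; rewrite ltrDl.
by split; rewrite /= in_itv.
Qed.

(** The circles interpolating between the given one and a small circle centred at
    [lam] stay in the closed disc and keep a distance at least r' from [lam], hence
    they never meet the spectrum. Interpolating directly between two circles around
    [lam] might leave the union of their discs; passing through small concentric
    circles avoids this. *)
Lemma circle_shrink (lam c : C) (r r' : R) (phi : H -> C) (B : R) x :
  0 <= B -> linear phi -> opbound phi B ->
  [set lam] = spectrum A `&` [set z | rnorm (z - c) < r] ->
  [set z | rnorm (z - c) = r] `<=` resolvent_set A ->
  0 < r' <= r - rnorm (lam - c) ->
  circle_integral (fun z => phi (resolvent A z x)) c r =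
  circle_integral (fun z => phi (resolvent A z x)) lam r'.
Proof.
move=> B0 lphi bphi hs hc /andP[r'0 r'r].
have lr : rnorm (lam - c) < r.
  by have : [set lam] lam by []; rewrite hs => -[].
pose y s t := (c + s%:C * (lam - c)) + (r + s * (r' - r))%:C * cis t.
have hy s t : 0 <= s <= 1 -> resolvent_set A (y s t).
  move=> /andP[s0 s1].
  have n0 := rnorm_ge0 (lam - c).
  have rs0 : 0 <= r + s * (r' - r) by nra.
  have yc : rnorm (y s t - c) <= r.
    rewrite (_ : y s t - c = s%:C * (lam - c) + (r + s * (r' - r))%:C * cis t); last first.
      by rewrite /y; ring.
    apply: le_trans (rnormD _ _) _.
    by rewrite !rnormM rnorm_cis mulr1 !rnormR !ger0_norm//; nra.
  (* radius minus distance of the centres is affine in s, with values r - |lam - c| and r' at the ends *)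
  have yl : r' <= rnorm (y s t - lam).
    rewrite (_ : y s t - lam = (r + s * (r' - r))%:C * cis t - (1 - s)%:C * (lam - c)); last first.
      by rewrite /y !rmorphB rmorph1; ring.
    apply: le_trans (rnorm_sub_ge _ _).
    have s1' : 0 <= 1 - s by rewrite subr_ge0.
    by rewrite !rnormM rnorm_cis mulr1 !rnormR !ger0_norm//; nra.
  move: yc; rewrite le_eqVlt => /orP[/eqP yc|yc]; first exact: hc.
  apply: contrapT => ns.
  have : [set lam] (y s t) by rewrite hs.
  by move=> /= e; move: yl; rewrite e subrr rnorm0 leNgt r'0.
have [M M0 hM] := resolvent_uniform_bound hy.
pose G := [set z | exists s t, 0 <= s <= 1 /\ z = y s t].
have Gr z : G z -> is_resolvent A z (resolvent A z).
  by move=> [s [t [hst ->]]]; apply/resolventP/hy.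
have bG z : G z -> opbound (resolvent A z) M by move=> [s [t [hst ->]]]; exact: hM.
have eG w z u : G w -> G z -> resolvent A w u = resolvent A z u + (w - z) *: resolvent A w (resolvent A z u).
  by move=> /Gr h1 /Gr h2; exact: resolvent_eq.
apply: (circle_homotopy (resolvent_holo M0 bG eG B0 lphi bphi x)
  (fun z Gz => resolvent_deriv_bound M0 bG B0 bphi x Gz)) => s t hst.
by exists s, t.
Qed.

End Resolvents.

(** * Sums over finite subsets *)

Section FiniteSums.
Variables (R : realType) (I : choiceType).

Lemma partial_sumE (V : zmodType) (v : I -> V) (F : {fset I}) :
  partial_sum v F = \sum_(i <- F) v i.
Proof. by rewrite /partial_sum big_seq_fsetE. Qed.

Lemma fsum_sub (V : zmodType) (w : I -> V) (F G : {fset I}) : (F `<=` G)%fset ->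
  \sum_(i <- G) w i = \sum_(i <- F) w i + \sum_(i <- (G `\` F)%fset) w i.
Proof.
move=> FG; rewrite (big_fsetID _ (mem F)) /=; congr (_ + _); apply: eq_fbigl => i.
  rewrite !inE /=; apply/andP/idP => [[]//|iF]; split=> //.
  exact: (fsubsetP FG).
by rewrite !inE /= andbC.
Qed.

(** Any finite set whose sum is within [e] of the supremum will do. *)
Lemma fsum_tail (w : I -> R) (M : R) : (forall i, 0 <= w i) ->
  (forall F : {fset I}, \sum_(i <- F) w i <= M) ->
  forall e : R, 0 < e -> exists F0 : {fset I}, forall F : {fset I},
    (forall i, i \in F -> i \notin F0) -> \sum_(i <- F) w i < e.
Proof.
move=> w0 wM e e0.
pose E := [set \sum_(i <- F) w i | F in [set: {fset I}]].
have supE : has_sup E.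
  split; first by exists (\sum_(i <- (fset0 : {fset I})) w i), fset0.
  by exists M => _ [F _ <-].
have [_ [F0 _ <-] hF0] := sup_adherent e0 supE.
exists F0 => F hF.
have : \sum_(i <- (F0 `|` F)%fset) w i <= sup E.
  by apply: (ub_le_sup supE.2); exists (F0 `|` F)%fset.
rewrite (@fsum_sub _ _ F0 (F0 `|` F)%fset); last exact: fsubsetUl.
have -> : ((F0 `|` F) `\` F0)%fset = F.
  apply/fsetP => i; rewrite !inE; have := hF i; case: (i \in F0) => //=.
  by case: (i \in F) => // /(_ isT).
lra.
Qed.

Lemma esum_fset_le (a : I -> R) (F : {fset I}) : (forall i, 0 <= a i) ->
  ((\sum_(i <- F) a i)%:E <= \esum_(i in [set: I]) (a i)%:E)%E.
Proof.
move=> a0; apply: esum_ge; exists [set` F]; first by split=> //; exact: finite_fset.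
by rewrite fsbig_finite// set_fsetK -sumEFin.
Qed.

Lemma esum_le_fset (a : I -> R) (M : \bar R) :
  (forall F : {fset I}, ((\sum_(i <- F) a i)%:E <= M)%E) ->
  (\esum_(i in [set: I]) (a i)%:E <= M)%E.
Proof.
move=> h; apply: ge_ereal_sup => _ /= [X [finX _] <-].
by rewrite fsbig_finite//= sumEFin.
Qed.

Lemma near_totally (F0 : {fset I}) : \forall F \near @totally I, (F0 `<=` F)%fset.
Proof. by exists F0. Qed.

Lemma near_totally_in (i : I) : \forall F \near @totally I, i \in F.
Proof.
exists [fset i]%fset => // F /= /fsubsetP; apply; exact: fset11.
Qed.

End FiniteSums.

#[global] Instance totally_pfilter (I : choiceType) : ProperFilter (@totally I).
Proof. exact: totally_filter. Qed.

Lemma totally_F (I : choiceType) : Filter (@totally I).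
Proof. exact: filter_filter. Qed.

(** Tonelli for sums of nonnegative terms. *)
Lemma esum_swap (R : realType) (T1 T2 : choiceType) (a : T1 -> T2 -> \bar R) :
  (forall i j, (0 <= a i j)%E) ->
  \esum_(i in [set: T1]) \esum_(j in [set: T2]) a i j =
  \esum_(j in [set: T2]) \esum_(i in [set: T1]) a i j.
Proof.
move=> a0; rewrite !esum_esum//.
rewrite (reindex_esum ([set: T2] `*`` fun=> [set: T1]) ([set: T1] `*`` fun=> [set: T2])
  (fun p => (p.2, p.1)))//.
split=> // [[i j] [i' j'] _ _ [-> ->]//|[i j] _]; by exists (j, i).
Qed.

(** * Orthogonal series, Parseval and Riesz representation *)

Section HilbertSums.
Variables (R : realType) (H : completeNormedModType R[i]).
Variable dot : {dot H for Num.conj}.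
Local Notation C := R[i].
Hypothesis hd : hilbert_inner_product dot.

Lemma linear_dotl y : linear (fun u => dot u y : C^o).
Proof. by move=> a u v; rewrite dotDl dotZl. Qed.

Lemma opbound_dotl y : opbound (fun u => dot u y : C^o) (rnorm y).
Proof. by move=> u; rewrite mulrC; exact: cauchy_schwarz. Qed.

Lemma cvg_dotl (T : Type) (F : set_system T) {FF : Filter F} (f : T -> H) l y :
  f @ F --> l -> (fun t => dot (f t) y : C^o) @ F --> (dot l y : C^o).
Proof. exact: (cvg_opbound (linear_dotl y) (opbound_dotl y)). Qed.

Lemma cvg_dotr (T : Type) (F : set_system T) {FF : Filter F} (f : T -> H) l y :
  f @ F --> l -> (fun t => dot y (f t) : C^o) @ F --> (dot y l : C^o).
Proof.
move=> /cvg_rnormP h; apply/cvg_rnormP => e e0.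
have y1 : 0 < rnorm y + 1 by rewrite ltr_wpDl.
near=> t; rewrite -dotBr; apply: le_lt_trans (cauchy_schwarz hd _ _) _.
apply: (@le_lt_trans _ _ ((rnorm y + 1) * rnorm (f t - l))).
  by rewrite ler_wpM2r// lerDl.
by rewrite -ltr_pdivlMl// mulrC; near: t; apply: h; rewrite divr_gt0.
Unshelve. all: by end_near. Qed.

Lemma rnorm_lim_le (T : Type) (F : set_system T) {FF : ProperFilter F} (f : T -> H) l (M : R) :
  f @ F --> l -> (\forall t \near F, rnorm (f t) <= M) -> rnorm l <= M.
Proof.
move=> /cvg_rnormP h fM; apply/ler_addgt0Pl => e e0.
have [t [h1 h2]] := filter_ex (filterI (h e e0) fM).
rewrite -[l](subKr (f t)); apply: le_trans (rnormB _ _) _.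
by rewrite addrC lerD// ltW.
Qed.

Section OrthogonalFamily.
Variables (I : choiceType) (v : I -> H).
Hypothesis ov : forall i j, i != j -> dot (v i) (v j) = 0.

Lemma pythagoras_fset (F : {fset I}) :
  rnorm (\sum_(i <- F) v i) ^+ 2 = \sum_(i <- F) rnorm (v i) ^+ 2.
Proof. by apply: (pythagoras_sum hd); [exact: fset_uniq|exact: ov]. Qed.

(** Pythagoras turns the Cauchy criterion into the smallness of the tails of the
    sum of the squared norms. *)
Lemma orthogonal_series (M : R) :
  (forall F : {fset I}, \sum_(i <- F) rnorm (v i) ^+ 2 <= M) ->
  exists l : H, partial_sum v F @[F --> totally] --> l.
Proof.
move=> hM; apply: cauchy_rnorm => e e0.
have e2 : 0 < (e / 2) ^+ 2 by rewrite exprn_gt0// divr_gt0.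
have [F0 hF0] := fsum_tail (fun i => sqr_ge0 (rnorm (v i))) hM e2.
have close (F : {fset I}) : (F0 `<=` F)%fset ->
    rnorm (\sum_(i <- F) v i - \sum_(i <- F0) v i) < e / 2.
  move=> F0F; rewrite (fsum_sub _ F0F) addrC addKr.
  rewrite -(@ltr_pXn2r _ 2) ?nnegrE ?(ltW (divr_gt0 e0 _))//.
  by rewrite pythagoras_fset; apply: hF0 => i; rewrite !inE => /andP[].
exists [set F | (F0 `<=` F)%fset]; first exact: near_totally.
move=> F G /= hF hG; rewrite !partial_sumE [e]splitr.
apply: le_lt_trans (rnorm_distD (\sum_(i <- F0) v i) _ _) _.
by apply: ltrD; [exact: close|rewrite rnorm_distC; exact: close].
Qed.

(** The hypothesis says that [v i] is the orthogonal projection of [x] on the line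
    it spans; it covers both orthonormal expansions and the components of [x] in a
    resolution of the identity. *)
Lemma bessel x : (forall i, dot (v i) x = (rnorm (v i) ^+ 2)%:C) ->
  forall F : {fset I}, \sum_(i <- F) rnorm (v i) ^+ 2 <= rnorm x ^+ 2.
Proof.
move=> hx F; rewrite -pythagoras_fset.
set S := \sum_(i <- F) v i.
have e : dot S x = (rnorm S ^+ 2)%:C.
  by rewrite /S pythagoras_fset dot_suml rmorph_sum; apply: eq_bigr => i _; rewrite hx.
have := cauchy_schwarz hd S x.
rewrite e rnormR ger0_norm ?sqr_ge0// expr2.
have [->|S0] := eqVneq S 0; first by rewrite rnorm0 !mul0r sqr_ge0.
by rewrite ler_pM2l ?rnorm_gt0// => h; rewrite -expr2 ler_pXn2r ?nnegrE.
Qed.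

Lemma parseval_esum x : (forall i, dot (v i) x = (rnorm (v i) ^+ 2)%:C) ->
  partial_sum v F @[F --> totally] --> x ->
  \esum_(i in [set: I]) (rnorm (v i) ^+ 2)%:E = (rnorm x ^+ 2)%:E.
Proof.
move=> hx cx; apply/eqP; rewrite eq_le; apply/andP; split.
  by apply: esum_le_fset => F; rewrite lee_fin bessel.
have := esum_ge0 (fun i (_ : [set: I] i) => sqr_ge0 (rnorm (v i)) : (0 <= (rnorm (v i) ^+ 2)%:E)%E).
case E: (\esum_(i in [set: I]) (rnorm (v i) ^+ 2)%:E) => [s| |] //; rewrite ?leey//.
rewrite !lee_fin => s0.
have : rnorm x <= Num.sqrt s.
  apply: (rnorm_lim_le cx); near=> F.
  rewrite -(@ler_pXn2r _ 2) ?nnegrE ?sqrtr_ge0// sqr_sqrtr//.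
  rewrite partial_sumE pythagoras_fset -lee_fin -E.
  by apply: esum_fset_le => i; exact: sqr_ge0.
by move=> h; rewrite -(sqr_sqrtr s0) ler_pXn2r ?nnegrE ?sqrtr_ge0.
Unshelve. all: by end_near. Qed.

End OrthogonalFamily.

(** An orthonormal basis in which some entries may be zero. Such padding allows a
    basis to be indexed by a product type or by the space itself, whatever the
    dimensions of the blocks. *)
Definition onb (I : choiceType) (e : I -> H) :=
  [/\ forall i j, i != j -> dot (e i) (e j) = 0,
      forall i, e i = 0 \/ dot (e i) (e i) = 1 &
      forall x, (forall i, dot x (e i) = 0) -> x = 0].

Section OrthonormalBasis.
Variables (I : choiceType) (e : I -> H).
Hypothesis he : onb e.

Let oe : forall i j, i != j -> dot (e i) (e j) = 0. Proof. by case: he. Qed.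

Lemma onb_norm i (a : C) : dot (a *: e i) (e i) = a \/ e i = 0.
Proof.
by case: he => _ /(_ i)[->|h] _; [right|left; rewrite dotZl h mulr1].
Qed.

Lemma onb_rnormZ i (a : C) : (e i = 0 -> a = 0) -> rnorm (a *: e i) = rnorm a.
Proof.
case: he => _ /(_ i)[h|h] _ ha; first by rewrite h scaler0 ha// !rnorm0.
rewrite rnormZ; have : rnorm (e i) ^+ 2 = 1 by rewrite (rnorm_sq_dot hd) h.
by move/eqP; rewrite sqrp_eq1// => /eqP ->; rewrite mulr1.
Qed.

Lemma onb_orth (a : I -> C) i j : i != j -> dot (a i *: e i) (a j *: e j) = 0.
Proof. by move=> ij; rewrite dotZl dotZr oe// !mulr0. Qed.

Lemma onb_rnorm i x : rnorm (dot x (e i) *: e i) = rnorm (dot x (e i)).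
Proof. by apply: onb_rnormZ => ->; rewrite dot0r. Qed.

Lemma onb_coef i x : dot (dot x (e i) *: e i) x = (rnorm (dot x (e i) *: e i) ^+ 2)%:C.
Proof.
by rewrite onb_rnorm dotZl [dot (e i) x]dotC -normCK rnormE rmorphXn.
Qed.

Lemma onb_dot_sum (a : I -> C) (F : {fset I}) i : i \in F -> (e i = 0 -> a i = 0) ->
  dot (\sum_(j <- F) a j *: e j) (e i) = a i.
Proof.
move=> iF ai; rewrite (big_fsetD1 i)//= dotDl dot_suml big_seq big1 => [|j].
  by rewrite addr0; case: (onb_norm i (a i)) => // h; rewrite h scaler0 dot0l ai.
by rewrite !inE => /andP[ji _]; rewrite dotZl oe// mulr0.
Qed.

(** The series converges by Bessel, and x minus its sum is orthogonal to every
    basis vector. *)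
Lemma onb_expansion x : partial_sum (fun i => dot x (e i) *: e i) F @[F --> totally] --> x.
Proof.
have ho := onb_orth (fun i => dot x (e i)).
have hb := bessel ho (fun i => onb_coef i x).
have [l hl] := orthogonal_series ho hb.
suff xl : x = l by rewrite [X in _ --> X]xl.
apply/eqP; rewrite -subr_eq0; apply/eqP; case: he => _ _; apply => i.
rewrite dotBl; apply/eqP; rewrite subr_eq0; apply/eqP.
have h1 := cvg_dotl (FF := totally_F _) (y := e i) hl.
have h2 : (fun F => dot (partial_sum (fun i => dot x (e i) *: e i) F) (e i) : C^o)
    @ totally --> (dot x (e i) : C^o).
  apply: cvg_near_cst; near=> F; rewrite partial_sumE onb_dot_sum//.
    by near: F; exact: near_totally_in.
  by move=> ->; rewrite dot0r.
exact: (cvg_unique _ h2 h1).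
Unshelve. all: by end_near. Qed.

Lemma onb_parseval x :
  \esum_(i in [set: I]) (rnorm (dot x (e i)) ^+ 2)%:E = (rnorm x ^+ 2)%:E.
Proof.
rewrite -(parseval_esum (onb_orth (fun i => dot x (e i))) (fun i => onb_coef i x) (onb_expansion (x := x))).
by apply: eq_esum => i _; rewrite onb_rnorm.
Qed.

(** The vector is the sum of conj(phi(e i)) e i: on a partial sum u, phi(u) = |u|^2,
    so |u| is bounded by the norm of phi and the series converges. *)
Lemma riesz_representation (phi : H -> C^o) (B : R) : linear phi -> opbound phi B ->
  exists v, forall x, phi x = dot x v.
Proof.
move=> lphi bphi.
pose a i := Num.conj (phi (e i)); pose u (F : {fset I}) := \sum_(i <- F) a i *: e i.
have a0 i : e i = 0 -> a i = 0 by rewrite /a => ->; rewrite (lin0 lphi) rmorph0.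
have ho := onb_orth a.
have nu F : phi (u F) = (rnorm (u F) ^+ 2)%:C.
  rewrite /u (pythagoras_fset ho) (linsum lphi) rmorph_sum; apply: eq_bigr => i _.
  rewrite (linZ lphi) onb_rnormZ; last exact: a0.
  by rewrite /a rnorm_conj [RHS]rmorphXn /= -rnormE normCK mulrC.
have bu F : rnorm (u F) ^+ 2 <= `|B| ^+ 2.
  rewrite ler_pXn2r ?nnegrE//.
  have := bphi (u F); rewrite nu rnormR ger0_norm ?sqr_ge0// expr2.
  have [->|S0] := eqVneq (u F) 0; first by rewrite rnorm0.
  rewrite ler_pM2r ?rnorm_gt0// => /le_trans; apply; exact: ler_norm.
have [|v hv] := @orthogonal_series _ _ ho (`|B| ^+ 2).
  by move=> F; rewrite -(pythagoras_fset ho); exact: bu.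
exists v => x.
have h1 := cvg_opbound (FF := totally_F _) lphi bphi (onb_expansion (x := x)).
have h2 := cvg_dotr (FF := totally_F _) (y := x) hv.
suff e12 : (phi \o (fun F => partial_sum (fun i => dot x (e i) *: e i) F)) =
   (fun F => dot x (partial_sum (fun i => a i *: e i) F)).
  by rewrite e12 in h1; exact: (cvg_unique _ h1 h2).
apply/funext => F; rewrite /= !partial_sumE (linsum lphi) dot_sumr; apply: eq_bigr => i _.
by rewrite (linZ lphi) dotZr /a conjCK mulrC.
Qed.

End OrthonormalBasis.

(** Both sides equal the sum of the squared norms of the vectors X^* (f j), by
    Parseval in [f], Tonelli and Parseval in the other basis. *)
Lemma basis_independent (I J : choiceType) (e : I -> H) (f : J -> H) (X : H -> H) :
  onb e -> onb f -> bounded_op X ->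
  \esum_(i in [set: I]) (rnorm (X (e i)) ^+ 2)%:E =
  \esum_(j in [set: J]) (rnorm (X (f j)) ^+ 2)%:E.
Proof.
move=> he hf /bounded_opP[lX [M _ bX]].
have ex j : exists v, forall x, dot (X x) (f j) = dot x v.
  apply: (riesz_representation he (B := rnorm (f j) * M)).
    by move=> a x y; rewrite lX dotDl dotZl.
  exact: (opbound_comp (rnorm_ge0 _) (opbound_dotl (f j)) bX).
have [Y hY] := choice ex.
have key (K : choiceType) (g : K -> H) : onb g ->
    \esum_(i in [set: K]) (rnorm (X (g i)) ^+ 2)%:E =
    \esum_(j in [set: J]) (rnorm (Y j) ^+ 2)%:E.
  move=> hg.
  under eq_esum => i _ do rewrite -(onb_parseval hf).
  rewrite esum_swap; last by move=> i j; rewrite lee_fin sqr_ge0.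
  apply: eq_esum => j _; rewrite -(onb_parseval hg); apply: eq_esum => i _.
  by rewrite hY dotC rnorm_conj.
by rewrite (key _ e he) (key _ f hf).
Qed.

End HilbertSums.

(** * Hilbert-Schmidt operators *)

Section HilbertSchmidt.
Variables (R : realType) (H : completeNormedModType R[i]).
Variable dot : {dot H for Num.conj}.
Local Notation C := R[i].
Hypothesis hd : hilbert_inner_product dot.
Variables (J : choiceType) (e : J -> H).
Hypothesis he : onb dot e.

(** The squared Hilbert-Schmidt norm computed in the basis [e]. *)
Definition hs2 (X : H -> H) : \bar R := \esum_(i in [set: J]) (rnorm (X (e i)) ^+ 2)%:E.

(** The existence of a padded basis guarantees that the chosen basis is one. *)
Lemma hs_basis_orthonormal : orthonormal_basis dot (hs_basis dot).
Proof.
apply: (xgetPex set0 (P := [set S | orthonormal_basis dot S])).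
case: he => h1 h2 h3; exists [set v | v != 0 /\ exists i, v = e i].
split=> [u v [n1 [i ui]] [n2 [j vj]]|x hx].
  rewrite ui vj in n1 n2 *.
  have [ij|ij] := eqVneq (e i) (e j).
    by rewrite ij; case: (h2 j) => // h; rewrite h eqxx in n2.
  by rewrite h1//; apply: contra ij => /eqP ->.
apply: h3 => i; have [->|ei] := eqVneq (e i) 0; first by rewrite dot0r.
by apply: hx; split=> //; exists i.
Qed.

(** The chosen basis, padded by zeros over the whole space, is compared with [e]. *)
Lemma hs_normE X : bounded_op X -> hs_norm dot X = sqrte (hs2 X).
Proof.
move=> bX; rewrite /hs_norm; congr sqrte.
have [hso hst] := hs_basis_orthonormal.
pose f (v : H) : H := if v \in hs_basis dot then v else 0.
have hf : onb dot f.
  split=> [u v uv|u|x hx].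
  - rewrite /f; case: ifPn => hu; last by rewrite dot0l.
    case: ifPn => hv; last by rewrite dot0r.
    by rewrite hso ?(negbTE uv)//; apply: set_mem.
  - rewrite /f; case: ifPn => hu; [right|by left].
    by rewrite hso ?eqxx//; apply: set_mem.
  apply: hst => v hv; have := hx v.
  by rewrite /f mem_set.
rewrite /hs2 (basis_independent hd he hf bX) esum_mkcond; apply: eq_esum => v _.
rewrite /f; case: ifPn => // _; case: bX => lX _.
by rewrite (lin0 lX) rnorm0 expr0n.
Qed.

(** Bounded operators of Hilbert-Schmidt norm at most [a]; with explicit bounds all
    estimates stay in the real numbers. *)
Definition hsle (X : H -> H) (a : R) :=
  [/\ bounded_op X, 0 <= a & (hs2 X <= (a ^+ 2)%:E)%E].

Lemma hsle_norm X a : hsle X a <-> [/\ bounded_op X, 0 <= a & (hs_norm dot X <= a%:E)%E].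
Proof.
have aux b : 0 <= b -> (sqrte (hs2 X) <= b%:E)%E = (hs2 X <= (b ^+ 2)%:E)%E.
  move=> b0; rewrite -[b%:E](_ : sqrte (b ^+ 2)%:E = _).
    by rewrite lee_sqrt// lee_fin sqr_ge0.
  by rewrite /= sqrtr_sqr ger0_norm.
by split=> -[bX a0 h]; split=> //; move: h; rewrite hs_normE// aux.
Qed.

Lemma hsle_hs X a : hsle X a -> hilbert_schmidt dot X.
Proof.
move=> /hsle_norm[bX a0 h]; split=> //; exact: le_lt_trans h (ltry _).
Qed.

Lemma hs_norm_lt_hsle X (c : \bar R) : bounded_op X -> (hs_norm dot X < c)%E ->
  exists2 a : R, hsle X a & (a%:E < c)%E.
Proof.
move=> bX; have := sqrte_ge0 (hs2 X); rewrite -hs_normE//.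
case E: (hs_norm dot X) => [a| |]// a0 ac; last by move: ac; rewrite ltNge leey.
by exists a => //; apply/hsle_norm; split=> //; rewrite ?E.
Qed.

Lemma hsle_ge0 X a : hsle X a -> 0 <= a. Proof. by case. Qed.
Lemma hsle_bop X a : hsle X a -> bounded_op X. Proof. by case. Qed.
Lemma hsle_lin X a : hsle X a -> linear X. Proof. by case=> -[]. Qed.

Lemma hsle_le X a b : a <= b -> hsle X a -> hsle X b.
Proof.
move=> ab [bX a0 h]; split=> //; first exact: le_trans ab.
by apply: le_trans h _; rewrite lee_fin ler_pXn2r ?nnegrE// (le_trans a0).
Qed.

Lemma hsle0 : hsle (fun=> 0) 0.
Proof.
split=> //; first exact: bounded_op0.
by rewrite /hs2 esum1// => i _; rewrite rnorm0 expr0n.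
Qed.

Lemma hsle_fsum X a : hsle X a -> forall F : {fset J}, \sum_(i <- F) rnorm (X (e i)) ^+ 2 <= a ^+ 2.
Proof.
move=> [_ _ h] F; rewrite -lee_fin; apply: le_trans h.
by apply: (esum_fset_le (a := fun i => rnorm (X (e i)) ^+ 2)) => i; exact: sqr_ge0.
Qed.

Lemma hsleI X a : bounded_op X -> 0 <= a ->
  (forall F : {fset J}, \sum_(i <- F) rnorm (X (e i)) ^+ 2 <= a ^+ 2) -> hsle X a.
Proof.
move=> bX a0 h; split=> //.
by apply: esum_le_fset => F; rewrite lee_fin.
Qed.

(** Expand [x] in the basis and use Cauchy-Schwarz in the form
    2 u v <= t u^2 + v^2 / t with t = a / |x|. *)
Lemma hsle_opbound X a : hsle X a -> opbound X a.
Proof.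
move=> hX x; have [[lX cX] a0 h2] := hX.
have [_ [M _ bX]] := (bounded_opP _).1 (hsle_bop hX).
have cE := cvg_opbound (FF := totally_F _) lX bX (onb_expansion hd he (x := x)).
apply: (rnorm_lim_le cE); near=> F; rewrite /= partial_sumE (linsum lX).
apply: le_trans (rnorm_sum _ _ _) _.
under eq_bigr do rewrite (linZ lX) rnormZ.
have sx : \sum_(i <- F) rnorm (dot x (e i)) ^+ 2 <= rnorm x ^+ 2.
  rewrite -lee_fin -(onb_parseval hd he).
  by apply: (esum_fset_le (a := fun i => rnorm (dot x (e i)) ^+ 2)) => i; exact: sqr_ge0.
have sX := hsle_fsum hX F.
have [x0|x0] := eqVneq x 0.
  by rewrite x0 rnorm0 mulr0 big1// => i _; rewrite dot0l rnorm0 mul0r.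
move: a0; rewrite le_eqVlt => /orP[/eqP a0|a0].
  rewrite -a0 mul0r big_seq big1// => i iF.
  have : rnorm (X (e i)) ^+ 2 <= 0.
    apply: le_trans (_ : _ <= \sum_(i <- F) rnorm (X (e i)) ^+ 2) _.
      by rewrite (big_fsetD1 i)//= lerDl sumr_ge0// => j _; exact: sqr_ge0.
    by apply: le_trans sX _; rewrite -a0 expr0n.
  rewrite le_eqVlt ltNge sqr_ge0 orbF sqrf_eq0 => /eqP ->.
  by rewrite mulr0.
have nx : 0 < rnorm x by rewrite rnorm_gt0.
pose t := a / rnorm x; have t0 : 0 < t by rewrite divr_gt0.
apply: (@le_trans _ _ (\sum_(i <- F) (t / 2 * rnorm (dot x (e i)) ^+ 2 + (2 * t)^-1 * rnorm (X (e i)) ^+ 2))).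
  apply: ler_sum => i _; set u := rnorm _; set v := rnorm _.
  have : 0 <= (2 * t)^-1 * (t * u - v) ^+ 2 by rewrite mulr_ge0 ?sqr_ge0// invr_ge0 mulr_ge0// ltW.
  suff -> : (2 * t)^-1 * (t * u - v) ^+ 2 = t / 2 * u ^+ 2 + (2 * t)^-1 * v ^+ 2 - u * v by rewrite subr_ge0.
  by field; rewrite gt_eqF.
rewrite big_split -!mulr_sumr /=.
apply: (@le_trans _ _ (t / 2 * rnorm x ^+ 2 + (2 * t)^-1 * a ^+ 2)).
  apply: lerD; apply: ler_wpM2l => //; first by rewrite divr_ge0// ltW.
  by rewrite invr_ge0 mulr_ge0// ltW.
rewrite le_eqVlt; apply/orP; left; apply/eqP; rewrite /t; field.
by rewrite !gt_eqF.
Unshelve. all: by end_near. Qed.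

Lemma hsle_compl M B X a : bounded_op B -> 0 <= M -> opbound B M -> hsle X a -> hsle (B \o X) (M * a).
Proof.
move=> bB M0 hB hX; apply: hsleI; first exact: bounded_op_comp (hsle_bop hX).
  by rewrite mulr_ge0// (hsle_ge0 hX).
move=> F; apply: (@le_trans _ _ (\sum_(i <- F) M ^+ 2 * rnorm (X (e i)) ^+ 2)).
  apply: ler_sum => i _; rewrite -exprMn ler_pXn2r ?nnegrE ?mulr_ge0//.
  exact: hB.
by rewrite -mulr_sumr exprMn ler_wpM2l ?sqr_ge0// hsle_fsum.
Qed.

Lemma hsle_comp B X b a : hsle B b -> hsle X a -> hsle (fun x => B (X x)) (b * a).
Proof.
move=> hB hX; apply: (hsle_compl (hsle_bop hB) (hsle_ge0 hB) (hsle_opbound hB) hX).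
Qed.

(** Minkowski, from |x + y|^2 <= (1 + t)|x|^2 + (1 + 1/t)|y|^2 with t = b / a. *)
Lemma hsleD X Y a b : hsle X a -> hsle Y b -> hsle (fun x => X x + Y x) (a + b).
Proof.
move=> hX hY; have a0 := hsle_ge0 hX; have b0 := hsle_ge0 hY.
have zero Z z x : hsle Z z -> z = 0 -> Z x = 0.
  by move=> hZ z0; apply: rnorm_eq0; apply/eqP; rewrite eq_le rnorm_ge0 andbT;
    have := hsle_opbound hZ x; rewrite z0 mul0r.
apply: hsleI; first by apply: bounded_opD; [case: hX|case: hY].
  exact: addr_ge0.
move=> F; have sX := hsle_fsum hX F; have sY := hsle_fsum hY F.
move: a0; rewrite le_eqVlt => /orP[/eqP a0|a0].
  rewrite -a0 add0r; under eq_bigr do rewrite (zero X a _ hX (esym a0)) add0r.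
  exact: sY.
move: b0; rewrite le_eqVlt => /orP[/eqP b0|b0].
  rewrite -b0 addr0; under eq_bigr do rewrite (zero Y b _ hY (esym b0)) addr0.
  exact: sX.
apply: (@le_trans _ _ (\sum_(i <- F) ((1 + b / a) * rnorm (X (e i)) ^+ 2 +
    (1 + a / b) * rnorm (Y (e i)) ^+ 2))).
  apply: ler_sum => i _.
  apply: (@le_trans _ _ ((rnorm (X (e i)) + rnorm (Y (e i))) ^+ 2)).
    by rewrite ler_pXn2r ?nnegrE ?addr_ge0// rnormD.
  set u := rnorm _; set v := rnorm _; rewrite -subr_ge0.
  have -> : (1 + b / a) * u ^+ 2 + (1 + a / b) * v ^+ 2 - (u + v) ^+ 2 = (b * u - a * v) ^+ 2 / (a * b).
    by field; rewrite !gt_eqF.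
  by rewrite divr_ge0 ?sqr_ge0// mulr_ge0// ltW.
rewrite big_split -!mulr_sumr /=.
apply: (@le_trans _ _ ((1 + b / a) * a ^+ 2 + (1 + a / b) * b ^+ 2)).
  by apply: lerD; rewrite ler_wpM2l// addr_ge0// divr_ge0// ltW.
rewrite le_eqVlt; apply/orP; left; apply/eqP; field.
by rewrite !gt_eqF.
Qed.

Lemma hsleN X a : hsle X a -> hsle (fun x => - X x) a.
Proof.
move=> hX; apply: hsleI.
- have := bounded_opZ (-1) (hsle_bop hX).
  by under eq_fun do rewrite scaleN1r.
- exact: hsle_ge0 hX.
by move=> F; under eq_bigr do rewrite rnormN; exact: hsle_fsum.
Qed.

Lemma hsleB X Y a b : hsle X a -> hsle Y b -> hsle (fun x => X x - Y x) (a + b).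
Proof. by move=> hX hY; apply: hsleD => //; exact: hsleN. Qed.

Lemma hsle_distC X Y a : hsle (fun x => X x - Y x) a -> hsle (fun x => Y x - X x) a.
Proof. by move=> /hsleN; under eq_fun do rewrite opprB. Qed.

Lemma hsle_dist_trans X Y Z a b :
  hsle (fun x => X x - Y x) a -> hsle (fun x => Y x - Z x) b -> hsle (fun x => X x - Z x) (a + b).
Proof. by move=> h1 h2; have := hsleD h1 h2; under eq_fun do rewrite addrA subrK. Qed.

(** Lower semicontinuity: a finite part of the sum defining the norm passes to the
    limit. *)
Lemma hsle_lim (T : Type) (F : set_system T) {FF : ProperFilter F} (u : T -> H -> H) (X : H -> H) a :
  (\forall t \near F, hsle (u t) a) -> (forall x, (fun t => u t x) @ F --> X x) -> hsle X a.
Proof.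
move=> hu cu.
have [t0 ht0] := filter_ex hu; have a0 := hsle_ge0 ht0.
have lX : linear X.
  move=> k x y.
  have h1 : (fun t => u t (k *: x + y)) @ F --> k *: X x + X y.
    have h2 : (fun t => k *: u t x + u t y) @ F --> k *: X x + X y.
      by apply: cvgD; [apply: cvgZr|].
    apply: cvg_trans h2; apply: near_eq_cvg; near=> t.
    have ht : hsle (u t) a by near: t.
    by rewrite (hsle_lin ht).
  exact: (cvg_unique _ (cu _) h1).
have bX : opbound X a.
  move=> x; apply: (rnorm_lim_le (cu x)); near=> t.
  by apply: hsle_opbound; near: t.
apply: hsleI => //; first exact: bounded_opI bX.
move=> G; apply/ler_addgt0Pl => eps eps0.
have cs : (fun t => \sum_(i <- G) rnorm (u t (e i)) ^+ 2) @ F --> \sum_(i <- G) rnorm (X (e i)) ^+ 2.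
  elim: (enum_fset G) => [|i r IH].
    by rewrite big_nil; under eq_fun do rewrite big_nil; exact: cvg_cst.
  rewrite big_cons; under eq_fun do rewrite big_cons.
  apply: cvgD => //.
  have cn : (fun t => rnorm (u t (e i))) @ F --> rnorm (X (e i)).
    apply/cvgrPdist_lt => d d0; near=> t.
    apply: (@le_lt_trans _ _ (rnorm (u t (e i) - X (e i)))); last first.
      by near: t; move: d d0; apply/cvg_rnormP; exact: cu.
    by rewrite rnorm_distC ler_norml rnorm_sub_ge andbT lerNl opprB rnorm_distC rnorm_sub_ge.
  by under eq_fun do rewrite expr2; rewrite expr2; apply: cvgM.
have /cvgrPdist_lt/(_ eps eps0) h := cs.
have [t [ht ht']] := filter_ex (filterI h hu).
have := hsle_fsum ht' G.
have := ltr_normlW ht.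
lra.
Unshelve. all: by end_near. Qed.

(** Pointwise limits exist because the Hilbert-Schmidt norm dominates the operator
    norm; lower semicontinuity controls the distance to the limit. Filters cover the
    sequence of iterates and the nets of finite partial sums. *)
Lemma hs_complete (T : Type) (F : set_system T) {FF : ProperFilter F} (u : T -> H -> H) :
  (forall eps : R, 0 < eps -> exists2 U, F U & forall s t, U s -> U t ->
     hsle (fun x => u s x - u t x) eps) ->
  exists X, (forall x, (fun t => u t x) @ F --> X x) /\
    forall eps : R, 0 < eps -> \forall t \near F, hsle (fun x => u t x - X x) eps.
Proof.
move=> hu.
have ex x : exists l : H, (fun t => u t x) @ F --> l.
  apply: cauchy_rnorm => d d0.
  have x1 : 0 < rnorm x + 1 by rewrite ltr_wpDl.
  have [|U FU hU] := hu (d / (rnorm x + 1)); first by rewrite divr_gt0.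
  exists U => // s t Us Ut; apply: le_lt_trans (hsle_opbound (hU s t Us Ut) x) _.
  by rewrite mulrAC ltr_pdivrMr// ltr_pM2l// ltrDl.
have [X hX] := choice ex; exists X; split=> // d d0.
have [U FU hU] := hu d d0.
apply: (filterS _ FU) => s Us.
apply: (hsle_lim (F := F) (u := fun t x => u s x - u t x)).
  by apply: filterS FU => t Ut; exact: hU.
by move=> x; apply: cvgB; [exact: cvg_cst|exact: hX].
Qed.

Lemma hs_cvgP (T : Type) (F : set_system T) {FF : Filter F} (D : T -> H -> H) :
  (forall t, bounded_op (D t)) ->
  (hs_norm dot (D t) @[t --> F] --> (0 : \bar R)%E) <->
  (forall eps : R, 0 < eps -> \forall t \near F, hsle (D t) eps).
Proof.
move=> bD; split=> [/fine_cvgP[h1 /cvgrPdist_lt h2] d d0|h].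
  near=> t; apply/hsle_norm; split=> //; first exact: ltW.
  have ft : hs_norm dot (D t) \is a fin_num by near: t.
  rewrite -(fineK ft) lee_fin.
  have : `|0 - fine (hs_norm dot (D t))| < d by near: t; exact: h2.
  by rewrite sub0r normrN => /ltW; apply: le_trans; exact: ler_norm.
have n0 t : (0 <= hs_norm dot (D t))%E by exact: sqrte_ge0.
apply/fine_cvgP; split.
  near=> t; have /hsle_norm[_ _ h1] : hsle (D t) 1 by near: t; exact: h.
  by rewrite ge0_fin_numE//; apply: le_lt_trans h1 (ltry _).
apply/cvgrPdist_le => d d0; near=> t.
have /hsle_norm[_ _ h1] : hsle (D t) d by near: t; exact: h.
rewrite sub0r normrN ger0_norm; last exact: fine_ge0.
rewrite -lee_fin fineK//.
by rewrite ge0_fin_numE//; apply: le_lt_trans h1 (ltry _).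
Unshelve. all: by end_near. Qed.

(** Limits for the Hilbert-Schmidt norm are unique, so the chosen sum is [S]. *)
Lemma hs_sumE (I : choiceType) (f : I -> H -> H) (S : H -> H) :
  (forall i, bounded_op (f i)) -> hilbert_schmidt dot S ->
  (forall eps : R, 0 < eps -> \forall F \near @totally I,
     hsle (fun x => \sum_(i <- (F : {fset I})) f i x - S x) eps) ->
  hs_sum dot f = S.
Proof.
move=> bf hS cS.
pose Q := [set S | hilbert_schmidt dot S /\
    (hs_norm dot ((fun x => partial_sum (f ^~ x) F) \- S) @[F --> @totally I] --> (0 : \bar R)%E)].
have bfS S' F : hilbert_schmidt dot S' -> bounded_op ((fun x => partial_sum (f ^~ x) F) \- S').
  move=> [bS' _]; apply: bounded_opB => //.
  by under eq_fun do rewrite partial_sumE; exact: bounded_op_sum.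
have Qe S' : Q S' -> forall eps : R, 0 < eps -> \forall F \near @totally I,
     hsle (fun x => \sum_(i <- (F : {fset I})) f i x - S' x) eps.
  move=> [hS' /(hs_cvgP (FF := totally_F I) (fun F => bfS S' F hS')) h] d d0.
  near=> F; have : hsle ((fun x => partial_sum (f ^~ x) F) \- S') d by near: F; exact: h.
  by under eq_fun do rewrite partial_sumE.
have QS : Q S.
  split=> //; apply/(hs_cvgP (FF := totally_F I) (fun F => bfS S F hS)) => d d0.
  near=> F; under eq_fun do rewrite partial_sumE.
  by near: F; exact: cS.
have QX : Q (hs_sum dot f) := xgetPex _ (ex_intro _ S QS).
apply/funext => x; apply/eqP; rewrite -subr_eq0; apply/eqP.
apply: (@rnorm_small_eq0 _ _ _ (2 * rnorm x)) => d d0.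
have [F [h1 h2]] := filter_ex (filterI (Qe _ QX d d0) (cS d d0)).
have := hsle_opbound (hsle_dist_trans (hsle_distC h1) h2) x.
move/le_trans; apply; rewrite le_eqVlt; apply/orP; left; apply/eqP; ring.
Unshelve. all: by end_near. Qed.

End HilbertSchmidt.

(** * Block matrices for a resolution of the identity *)

Section Resolution.
Variables (R : realType) (H : completeNormedModType R[i]).
Variable dot : {dot H for Num.conj}.
Local Notation C := R[i].
Hypothesis hd : hilbert_inner_product dot.
Variable P : int -> H -> H.
Hypothesis hP : resolution_of_identity dot P.

Lemma res_bounded n : bounded_op (P n). Proof. by case: hP => /(_ n)[]. Qed.
Lemma res_linear n : linear (P n). Proof. by case: (res_bounded n). Qed.
Lemma res_idem n x : P n (P n x) = P n x. Proof. by case: hP => /(_ n)[]. Qed.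
Lemma res_sym n x y : dot (P n x) y = dot x (P n y). Proof. by case: hP => /(_ n)[]. Qed.
Lemma res_orth m n x : m != n -> P m (P n x) = 0. Proof. by case: hP => _ h _ /h. Qed.
Lemma res_cvg x : partial_sum (fun n => P n x) F @[F --> @totally int] --> x.
Proof. by case: hP. Qed.

Lemma res_comp m n x : P m (P n x) = if m == n then P n x else 0.
Proof. by case: eqVneq => [->|/res_orth ->//]; rewrite res_idem. Qed.

Lemma res_dot_orth x m n : m != n -> dot (P m x) (P n x) = 0.
Proof. by move=> mn; rewrite res_sym res_orth// dot0r. Qed.

Lemma res_dot_norm n x : dot (P n x) x = (rnorm (P n x) ^+ 2)%:C.
Proof. by rewrite -res_idem res_sym (dot_self hd) res_idem. Qed.

Lemma res_opbound n : opbound (P n) 1.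
Proof.
move=> x; rewrite mul1r.
have := bessel hd (res_dot_orth x) (fun n => res_dot_norm n x) [fset n]%fset.
by rewrite big_seq_fset1 ler_pXn2r ?nnegrE.
Qed.

Lemma res_vec_ext x y : (forall n, P n x = P n y) -> x = y.
Proof.
move=> h; have := res_cvg (x := x); have := res_cvg (x := y).
rewrite (_ : partial_sum (P ^~ y) = partial_sum (P ^~ x)); last first.
  by congr partial_sum; apply/funext => n; rewrite h.
by move=> h1 h2; exact: (cvg_unique _ h2 h1).
Qed.

(** The ranges of the projections span a dense subspace. *)
Lemma res_op_ext (V : normedModType C) (X Y : H -> V) (M N : R) :
  linear X -> opbound X M -> linear Y -> opbound Y N ->
  (forall n x, X (P n x) = Y (P n x)) -> forall x, X x = Y x.
Proof.
move=> lX bX lY bY h x.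
have h1 := cvg_opbound (FF := totally_F _) lX bX (res_cvg (x := x)).
have h2 := cvg_opbound (FF := totally_F _) lY bY (res_cvg (x := x)).
have E : X \o partial_sum (P ^~ x) = Y \o partial_sum (P ^~ x).
  apply/funext => F; rewrite /= !partial_sumE (linsum lX) (linsum lY).
  by apply: eq_bigr.
by rewrite E in h1; exact: (cvg_unique (@norm_hausdorff _ V) h1 h2).
Qed.

Lemma res_block_ext (X Y : H -> H) : bounded_op X -> bounded_op Y ->
  (forall m n x, P m (X (P n x)) = P m (Y (P n x))) -> forall x, X x = Y x.
Proof.
move=> /bounded_opP[lX [M _ bX]] /bounded_opP[lY [N _ bY]] h.
by apply: (res_op_ext lX bX lY bY) => n x; apply: res_vec_ext => m.
Qed.

Lemma res_sum_diag (t : int -> C) (F : {fset int}) n x : n \in F ->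
  P n (\sum_(k <- F) t k *: P k x) = t n *: P n x.
Proof.
move=> nF; rewrite (linsum (res_linear n)) (big_fsetD1 n)//= big_seq big1 => [|k].
  by rewrite addr0 (linZ (res_linear n)) res_idem.
by rewrite !inE => /andP[kn _]; rewrite (linZ (res_linear n)) res_orth ?scaler0// eq_sym.
Qed.

(** The series of the t_n P_n x converges since its terms are orthogonal with squared
    norms summing to at most K^2 |x|^2. *)
Lemma diagonal_operator (t : int -> C) (K : R) : 0 <= K -> (forall n, rnorm (t n) <= K) ->
  exists D : H -> H, [/\ linear D, opbound D K & forall n x, P n (D x) = t n *: P n x].
Proof.
move=> K0 tK.
have orth x i j : i != j -> dot (t i *: P i x) (t j *: P j x) = 0.
  by move=> ij; rewrite dotZl dotZr res_dot_orth// !mulr0.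
have bnd x (F : {fset int}) : \sum_(i <- F) rnorm (t i *: P i x) ^+ 2 <= (K * rnorm x) ^+ 2.
  apply: (@le_trans _ _ (\sum_(i <- F) K ^+ 2 * rnorm (P i x) ^+ 2)).
    apply: ler_sum => i _; rewrite rnormZ -exprMn ler_pXn2r ?nnegrE ?mulr_ge0//.
    by rewrite ler_wpM2r.
  rewrite -mulr_sumr exprMn ler_wpM2l ?sqr_ge0//.
  exact: (bessel hd (res_dot_orth x) (fun n => res_dot_norm n x)).
have ex x : exists l : H, partial_sum (fun i => t i *: P i x) F @[F --> totally] --> l.
  exact: (orthogonal_series hd (orth x) (bnd x)).
have [D hD] := choice ex.
have PD n x : P n (D x) = t n *: P n x.
  have h1 := cvg_opbound (FF := totally_F _) (res_linear n) (@res_opbound n) (hD x).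
  have h2 : P n \o partial_sum (fun i => t i *: P i x) @ totally --> t n *: P n x.
    apply: cvg_near_cst; near=> F; rewrite /= partial_sumE res_sum_diag//.
    by near: F; exact: near_totally_in.
  exact: (cvg_unique _ h1 h2).
exists D; split=> //.
  move=> a x y; apply: res_vec_ext => n; rewrite (res_linear n) !PD (res_linear n).
  by rewrite scalerDr !scalerA mulrC.
move=> x; apply: (rnorm_lim_le (hD x)); near=> F.
rewrite -(@ler_pXn2r _ 2) ?nnegrE ?mulr_ge0//.
by rewrite partial_sumE (pythagoras_fset hd (orth x)).
Unshelve. all: by end_near. Qed.

(** [e (n, i)] for i < mult n is an orthonormal basis of the range of [P n]; the
    remaining entries are zero. In such a basis cutting out a block of an operator
    just keeps or kills its columns. *)
Definition adapted_basis (mult : int -> nat) (e : int * nat -> H) :=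
  [/\ onb dot e, forall n p, P n (e p) = if p.1 == n then e p else 0,
      forall p, dot (e p) (e p) = (p.2 < mult p.1)%N%:R &
      forall n x, P n x = \sum_(i < mult n) dot x (e (n, i : nat)) *: e (n, i : nat)].

Lemma adapted_basis_exists (mult : int -> nat) :
  (forall n, has_dimension dot (range (P n)) (mult n)) ->
  exists e, adapted_basis mult e.
Proof.
move=> hdim.
have ex n : exists f : 'I_(mult n) -> H,
    (forall i j, dot (f i) (f j) = (i == j)%:R) /\
    range (P n) = range (fun c : 'I_(mult n) -> C => \sum_i c i *: f i) := hdim n.
pose f n := sval (cid (ex n)).
have fo n i j : dot (f n i) (f n j) = (i == j)%:R by rewrite /f; case: cid => g /= [].
have fr n : range (P n) = range (fun c : 'I_(mult n) -> C => \sum_i c i *: f n i).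
  by rewrite /f; case: cid => g /= [].
have Pf n i : P n (f n i) = f n i.
  have : range (P n) (f n i).
    rewrite fr; exists (fun j => (j == i)%:R) => //.
    rewrite (bigD1 i)//= eqxx scale1r big1 ?addr0// => j /negbTE ->.
    by rewrite scale0r.
  by move=> [y _ <-]; rewrite res_idem.
have Pexp n x : P n x = \sum_i dot x (f n i) *: f n i.
  have : range (P n) (P n x) by exists x.
  rewrite fr => -[c _ E]; rewrite -E; apply: eq_bigr => i _; congr (_ *: _).
  rewrite -[f n i]Pf -res_sym -E dot_suml (bigD1 i)//= dotZl fo eqxx mulr1 big1 ?addr0// => j ji.
  by rewrite dotZl fo (negbTE ji) mulr0.
pose e (p : int * nat) := if insub p.2 is Some i then f p.1 i else 0.
have eE n (i : 'I_(mult n)) : e (n, i : nat) = f n i by rewrite /e /= valK.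
have Pe n p : P n (e p) = if p.1 == n then e p else 0.
  rewrite /e; case: insubP => [i _ _|_]; last by rewrite (lin0 (res_linear n)) if_same.
  by rewrite -{1}Pf res_comp eq_sym Pf.
have en p : dot (e p) (e p) = (p.2 < mult p.1)%N%:R.
  rewrite /e; case: insubP => [i -> _|/negbTE ->]; last by rewrite dot0l.
  by rewrite fo eqxx.
exists e; split=> //; last by move=> n x; rewrite Pexp; apply: eq_bigr => i _; rewrite eE.
split=> [p q pq|p|x hx].
- have [pq1|pq1] := eqVneq p.1 q.1; last first.
    have E1 : e p = P p.1 (e p) by rewrite Pe eqxx.
    by rewrite [X in dot X _]E1 res_sym Pe eq_sym (negbTE pq1) dot0r.
  move: p q pq pq1 => [p1 p2] [q1 q2] /= pq e1; subst q1.
  rewrite /e /=; case: insubP => [i _ ip|_]; last by rewrite dot0l.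
  case: insubP => [j _ jq|_]; last by rewrite dot0r.
  rewrite fo; case: eqVneq => // ij; case/eqP: pq.
  by rewrite -ip -jq ij.
- rewrite en; case: ltnP => h; first by right.
  by left; rewrite /e insubF// ltnNge h.
apply: res_vec_ext => n; rewrite (lin0 (res_linear n)) Pexp big1// => i _.
by rewrite -eE hx scale0r.
Qed.

Section BlockSum.
Variables (mult : int -> nat) (e : int * nat -> H).
Hypothesis he : adapted_basis mult e.
Variables (I : choiceType) (g : I -> int * int) (c : I -> C) (K : R).
Hypotheses (gi : injective g) (K0 : 0 <= K) (cK : forall i, rnorm (c i) <= K).
Variables (X : H -> H) (a : R).
Hypothesis hX : hsle e X a.

Let ho : onb dot e. Proof. by case: he. Qed.
Let Pe n p : P n (e p) = if p.1 == n then e p else 0. Proof. by case: he. Qed.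
Let lX : linear X := hsle_lin hX.
Let f i x := c i *: P (g i).1 (X (P (g i).2 x)).
Let w i p : R := if p.1 == (g i).2 then rnorm (P (g i).1 (X (e p))) ^+ 2 else 0.

Lemma block_bounded i : bounded_op (f i).
Proof.
apply: bounded_opZ; apply: bounded_op_comp; first exact: res_bounded.
by apply: bounded_op_comp; [exact: hsle_bop hX|exact: res_bounded].
Qed.

Let fe i p : f i (e p) = if p.1 == (g i).2 then c i *: P (g i).1 (X (e p)) else 0.
Proof.
rewrite /f Pe; case: ifP => // _.
by rewrite (lin0 lX) (lin0 (@res_linear _)) scaler0.
Qed.

Let w_ge0 i p : 0 <= w i p.
Proof. by rewrite /w; case: ifP => // _; rewrite sqr_ge0. Qed.

Let forth p i j : i != j -> dot (f i (e p)) (f j (e p)) = 0.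
Proof.
move=> ij; rewrite !fe; case: ifP => [/eqP h1|_]; last by rewrite dot0l.
case: ifP => [/eqP h2|_]; last by rewrite dot0r.
rewrite dotZl dotZr res_dot_orth ?mulr0//.
apply: contra ij => /eqP h3; apply/eqP/gi.
by rewrite [LHS]surjective_pairing [RHS]surjective_pairing h3 -h1 h2.
Qed.

Let fnorm p i : rnorm (f i (e p)) ^+ 2 <= K ^+ 2 * w i p.
Proof.
rewrite fe /w; case: ifP => _; last by rewrite rnorm0 expr0n mulr0.
by rewrite rnormZ -exprMn ler_pXn2r ?nnegrE ?mulr_ge0// ler_wpM2r.
Qed.

Let wsum_le p (F : {fset I}) : \sum_(i <- F) w i p <= rnorm (X (e p)) ^+ 2.
Proof.
pose v i := if p.1 == (g i).2 then P (g i).1 (X (e p)) else 0.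
have vo i j : i != j -> dot (v i) (v j) = 0.
  move=> ij; rewrite /v; case: ifP => [/eqP h1|_]; last by rewrite dot0l.
  case: ifP => [/eqP h2|_]; last by rewrite dot0r.
  rewrite res_dot_orth//; apply: contra ij => /eqP h3; apply/eqP/gi.
  by rewrite [LHS]surjective_pairing [RHS]surjective_pairing h3 -h1 h2.
have vn i : dot (v i) (X (e p)) = (rnorm (v i) ^+ 2)%:C.
  by rewrite /v; case: ifP => _; rewrite ?res_dot_norm// dot0l rnorm0 expr0n.
apply: le_trans (bessel hd vo vn F); apply: ler_sum => i _.
by rewrite /w /v; case: ifP => // _; rewrite rnorm0 expr0n.
Qed.

Let W i : \bar R := \esum_(p in [set: int * nat]) (w i p)%:E.

Let Wsum (F : {fset I}) : (\sum_(i <- F) W i <= (a ^+ 2)%:E)%E.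
Proof.
case: hX => _ _; apply: le_trans; rewrite /W -esum_sum; last first.
  by move=> i j _ _; rewrite lee_fin.
by apply: le_esum => p _; rewrite sumEFin lee_fin wsum_le.
Qed.

Let W_fin i : W i \is a fin_num.
Proof.
have W0 : (0 <= W i)%E by apply: esum_ge0 => p _; rewrite lee_fin.
rewrite ge0_fin_numE//; have := Wsum [fset i]%fset; rewrite big_seq_fset1 => h.
exact: le_lt_trans h (ltry _).
Qed.

Let fsum_hsle (F : {fset I}) (b : R) : 0 <= b ->
  K ^+ 2 * \sum_(i <- F) fine (W i) <= b ^+ 2 -> hsle e (fun x => \sum_(i <- F) f i x) b.
Proof.
move=> b0 hb; split=> //; first exact/bounded_op_sum/block_bounded.
apply: (@le_trans _ _ ((K ^+ 2 * \sum_(i <- F) fine (W i))%:E)); last by rewrite lee_fin.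
rewrite EFinM -sumEFin; under [in leRHS]eq_bigr do rewrite fineK//.
rewrite /W -esum_sum; last by move=> i j _ _; rewrite lee_fin.
apply: esum_le_fset => G.
apply: (@le_trans _ _ ((K ^+ 2 * \sum_(p <- G) \sum_(i <- F) w i p)%:E)).
  rewrite lee_fin mulr_sumr; apply: ler_sum => p _.
  rewrite (pythagoras_fset hd (forth p)) mulr_sumr; apply: ler_sum => i _.
  exact: fnorm.
rewrite EFinM lee_wpmul2l//; first by rewrite lee_fin sqr_ge0.
have := @esum_fset_le _ _ (fun p => \sum_(i <- F) w i p) G (fun p => sumr_ge0 _ (fun i _ => w_ge0 i p)).
by move/le_trans; apply; apply: le_esum => p _; rewrite sumEFin.
Qed.

Let Wfine (F : {fset I}) : \sum_(i <- F) fine (W i) <= a ^+ 2.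
Proof.
rewrite -lee_fin -sumEFin; under eq_bigr do rewrite fineK//.
exact: Wsum.
Qed.

(** The operators c_i P_m X P_n with (m, n) = g i are pairwise orthogonal for the
    Hilbert-Schmidt inner product, and their squared norms add up to at most
    K^2 |X|^2. Hence the unconditional sum exists; its blocks are found by taking
    limits. Both transforms J and Gamma are of this form. *)
Lemma block_sum : exists S : H -> H, [/\ hs_sum dot f = S, hsle e S (K * a),
  forall i x, P (g i).1 (S (P (g i).2 x)) = c i *: P (g i).1 (X (P (g i).2 x)) &
  forall m n, (forall i, g i != (m, n)) -> forall x, P m (S (P n x)) = 0].
Proof.
have a0 := hsle_ge0 hX.
have W0 i : 0 <= fine (W i) by apply: fine_ge0; apply: esum_ge0 => p _; rewrite lee_fin.
pose u (F : {fset I}) x := \sum_(i <- F) f i x.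
have uK F : hsle e (u F) (K * a).
  apply: fsum_hsle; first by rewrite mulr_ge0.
  by rewrite exprMn ler_wpM2l ?sqr_ge0// Wfine.
have [eps0 e0|S [cS hS]] := @hs_complete _ _ _ hd _ _ ho _ (@totally I) _ u.
  pose d := eps0 / 2 / (K + 1).
  have K1 : 0 < K + 1 by rewrite ltr_wpDl.
  have d0 : 0 < d by rewrite !divr_gt0.
  have [F0 hF0] := fsum_tail W0 Wfine (exprn_gt0 2 d0).
  (* dividing by K + 1 covers the case K = 0 *)
  have close F : (F0 `<=` F)%fset -> hsle e (fun x => u F x - u F0 x) (eps0 / 2).
    move=> F0F.
    rewrite (_ : (fun x => _) = fun x => \sum_(i <- (F `\` F0)%fset) f i x); last first.
      by apply/funext => x; rewrite /u (fsum_sub _ F0F) addrC addKr.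
    apply: fsum_hsle; first by rewrite divr_ge0// ltW.
    have hF := hF0 (F `\` F0)%fset.
    apply: (@le_trans _ _ (K ^+ 2 * d ^+ 2)).
      by rewrite ler_wpM2l ?sqr_ge0// ltW// hF// => i; rewrite !inE => /andP[].
    rewrite -exprMn ler_pXn2r// ?nnegrE; last 2 first.
    - by rewrite mulr_ge0// ltW.
    - by rewrite divr_ge0// ltW.
    rewrite /d mulrCA ger_pMr ?divr_gt0//.
    by rewrite ler_pdivrMr// mul1r lerDl.
  exists [set F | (F0 `<=` F)%fset]; first exact: near_totally.
  move=> F G /= hF hG; rewrite [eps0]splitr.
  exact: (hsle_dist_trans hd ho (close F hF) (hsle_distC (close G hG))).
have hSK : hsle e S (K * a).
  by apply: (hsle_lim hd ho _ cS); near=> F.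
have lS := hsle_lin hSK.
have PcS m n x : (fun F => P m (u F (P n x))) @ totally --> P m (S (P n x)).
  exact: (cvg_opbound (FF := totally_F _) (@res_linear m) (@res_opbound m) (cS _)).
have Pu m n F x : P m (u F (P n x)) = \sum_(i <- F | g i == (m, n)) f i x.
  rewrite /u (linsum (@res_linear m)) [RHS]big_mkcond; apply: eq_bigr => i _.
  have -> : (g i == (m, n)) = (m == (g i).1) && ((g i).2 == n).
    by case: (g i) => k l; rewrite xpair_eqE /= [m == _]eq_sym.
  rewrite /f (linZ (@res_linear m)) !res_comp.
  case: eqVneq => _; last by rewrite scaler0.
  by case: eqVneq => [->//|_]; rewrite (lin0 lX) (lin0 (@res_linear _)) scaler0.
exists S; split=> //.
- apply: (hs_sumE hd ho block_bounded); first exact: (hsle_hs hd ho hSK).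
  exact: hS.
- move=> i x.
  have h2 : (fun F => P (g i).1 (u F (P (g i).2 x))) @ totally --> f i x.
    apply: cvg_near_cst; near=> F; rewrite Pu.
    have iF : i \in F by near: F; exact: near_totally_in.
    rewrite big_mkcond (big_fsetD1 i)//= -surjective_pairing eqxx big_seq big1 ?addr0// => j.
    rewrite !inE => /andP[ji _]; case: eqP => // /gi ij.
    by rewrite ij eqxx in ji.
  exact: (cvg_unique _ (PcS _ _ _) h2).
move=> m n hmn x.
have h2 : (fun F => P m (u F (P n x))) @ totally --> (0 : H).
  apply: cvg_near_cst; near=> F; rewrite Pu big1// => i /eqP h.
  by have := hmn i; rewrite h eqxx.
exact: (cvg_unique _ (PcS _ _ _) h2).
Unshelve. all: by end_near. Qed.

End BlockSum.

End Resolution.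

(** * Bounded perturbations of a resolvent *)

Section Perturbation.
Variables (R : realType) (H : completeNormedModType R[i]).
Local Notation C := R[i].
Variable A : unbounded_op H.
Hypothesis lA : linear_op A.

(** The resolvent of A - V is T (1 - V T)^-1. *)
Lemma resolvent_perturb z T (V : H -> H) (t v : R) :
  is_resolvent A z T -> 0 <= t -> opbound T t -> linear V -> 0 <= v -> opbound V v ->
  v * t < 1 -> exists2 T', is_resolvent (sub_op A V) z T' & opbound T' (t * (1 - v * t)^-1).
Proof.
move=> [[lT cT] hT1 hT2] t0 bT lV v0 bV vt.
have lK : linear (V \o T) by exact: linear_comp.
have [N [lN bN N1 N2]] := neumann lK (introT andP (conj (mulr_ge0 v0 t0) vt)) (opbound_comp v0 bV bT).
have bTN := opbound_comp t0 bT bN.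
exists (T \o N) => //; split.
- exact: bounded_opI (linear_comp lT lN) bTN.
- move=> x /=; have [dx ex] := hT1 (N x); split=> //.
  by rewrite addrAC ex; exact: N1.
move=> x dx /=; have {}dx : dom A x := dx.
rewrite (_ : A x - V x - z *: x = (A x - z *: x) - (V \o T) (A x - z *: x)).
  by rewrite N2 hT2.
by rewrite /= hT2// addrAC.
Qed.

Lemma op_norm_opbound (X : H -> H) (b : R) : linear X -> (op_norm X < b%:E)%E -> opbound X b.
Proof.
move=> lX hX x; have [->|x0] := eqVneq x 0; first by rewrite (lin0 lX) !rnorm0 mulr0.
have nx : 0 < rnorm x by rewrite rnorm_gt0.
have : ((rnorm (X ((rnorm x)^-1%:C *: x)))%:E <= op_norm X)%E.
  apply: ereal_sup_ubound; exists ((rnorm x)^-1%:C *: x) => //=.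
  by rewrite rnormZ rnormR ger0_norm ?invr_ge0// mulVf// gt_eqF.
move=> /le_lt_trans/(_ hX); rewrite lte_fin (linZ lX) rnormZ rnormR ger0_norm ?invr_ge0//.
by rewrite ltr_pdivrMl// mulrC => /ltW.
Qed.

End Perturbation.

(** * The unperturbed operator is diagonal *)

Section NormalOperator.
Variables (R : realType) (H : completeNormedModType R[i]).
Local Notation C := R[i].
Variable dot : {dot H for Num.conj}.
Hypothesis hd : hilbert_inner_product dot.
Variables (A : unbounded_op H) (lam : int -> C) (mult : int -> nat) (P : int -> H -> H).
Hypothesis sa : standing_assumptions dot A lam mult P.

Let lA : linear_op A := A_linear sa.
Let hP : resolution_of_identity dot P := P_resolution sa.

(** All circles defining Riesz projections of the same point can be replaced by the
    same small circle. *)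
Lemma riesz_circle l Q : riesz_projection dot A [set l] Q -> exists2 rho : R, 0 < rho &
  forall r, 0 < r <= rho -> forall x y, dot (Q x) y =
    - (2 * pi%:C * 'i)^-1 * circle_integral (fun z => dot (resolvent A z x) y) l r.
Proof.
move=> [bQ [c [r [r0 hs hc hQ]]]]; exists (r - rnorm (l - c)).
  have : [set l] l by []; rewrite hs => -[_ /=].
  by rewrite subr_gt0.
move=> r' hr x y; rewrite hQ; congr (_ * _).
apply: (@circle_shrink _ _ _ l c r r' (fun u => dot u y) (rnorm y) x) => //.
- exact: linear_dotl.
- exact: opbound_dotl.
Qed.

Lemma dot_ext (u v : H) : (forall y, dot u y = dot v y) -> u = v.
Proof.
move=> h; apply/eqP; rewrite -subr_eq0; apply/eqP/(dot_self_eq0 hd).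
by rewrite dotBl h subrr.
Qed.

(** Compare both projections on one small circle. *)
Lemma riesz_unique l Q Q' : riesz_projection dot A [set l] Q ->
  riesz_projection dot A [set l] Q' -> Q = Q'.
Proof.
move=> /riesz_circle[r r0 h] /riesz_circle[r' r'0 h'].
apply/funext => x; apply: dot_ext => y.
rewrite (h (Num.min r r')) ?(h' (Num.min r r'))//.
  by rewrite lt_min r0 r'0 ge_min lexx orbT.
by rewrite lt_min r0 r'0 ge_min lexx.
Qed.

(** The projection that witnesses semisimplicity is [P n] itself, by uniqueness. *)
Lemma range_P n : range (P n) = Defs.eigenspace A (lam n) /\ has_dimension dot (range (P n)) (mult n).
Proof.
have [_ [Q [hQ rQ dQ]]] := A_semisimple sa n.
by rewrite (riesz_unique (P_riesz sa n) hQ).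
Qed.

Lemma P_eigen n x : dom A (P n x) /\ A (P n x) = lam n *: P n x.
Proof.
have : range (P n) (P n x) by exists x.
by rewrite (range_P n).1.
Qed.

(** If two eigenvalues with different indices were equal, their Riesz projections
    would coincide and, being orthogonal, vanish; but eigenvectors exist. *)
Lemma lam_inj m n : m != n -> lam m != lam n.
Proof.
move=> mn; apply/eqP => e.
have Pmn : P m = P n by apply: (riesz_unique (P_riesz sa m)); rewrite e; exact: P_riesz sa n.
have [[x hx x0] _] := A_semisimple sa n.
move: hx; rewrite -(range_P n).1 => -[y _ hy].
by have := res_orth hP y mn; rewrite Pmn (res_idem hP) hy => /eqP; rewrite (negbTE x0).
Qed.

Lemma resolvent_neq_lam z n : resolvent_set A z -> lam n - z != 0.
Proof.
move=> hz; rewrite subr_eq0; apply/eqP => e.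
have : spectrum A (lam n) by rewrite (A_spectrum sa); exists n.
by rewrite e.
Qed.

Lemma resolvent_P z T n x : is_resolvent A z T -> T (P n x) = (lam n - z)^-1 *: P n x.
Proof.
move=> hT; have zn := @resolvent_neq_lam z n (ex_intro _ T hT).
have [[lT _] _ h2] := hT; have [dP eP] := P_eigen n x.
have := h2 _ dP; rewrite eP -scalerBl (linZ lT) => e.
by rewrite -{2}e scalerA mulVf// scale1r.
Qed.

(** Both sides are bounded operators that agree on the ranges of the projections. *)
Lemma P_resolvent z T n x : is_resolvent A z T -> P n (T x) = (lam n - z)^-1 *: P n x.
Proof.
move=> hT; have [bT _ _] := hT; have [lT [t t0 ht]] := (bounded_opP _).1 bT.
have lP := res_linear hP n; have bP := res_opbound hd hP n.
have lZ : linear (fun y => (lam n - z)^-1 *: P n y).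
  by move=> a u v; rewrite lP scalerDr !scalerA mulrC.
have bZ : opbound (fun y => (lam n - z)^-1 *: P n y) (rnorm ((lam n - z)^-1) * 1).
  by move=> u; rewrite rnormZ -mulrA ler_wpM2l.
have lPT : linear (P n \o T) by exact: linear_comp.
have bPT := opbound_comp ler01 bP ht.
apply: (res_op_ext hP lPT bPT lZ bZ) => k y /=.
rewrite (resolvent_P _ _ hT) (linZ lP) (res_comp hP).
by case: eqVneq => [->//|_]; rewrite !scaler0.
Qed.

(** The domain of [A] is described by blocks: if the components of [w] are those of
    [A y], then [y] is the image of w - z y under the resolvent at [z]. *)
Lemma dom_criterion y w : (forall m, P m w = lam m *: P m y) -> dom A y /\ A y = w.
Proof.
move=> h; have [z hz _] := A_resolvent_small sa ltr01.
have hT := resolventP hz; set T := resolvent A z in hT.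
have [_ h1 _] := hT; have [dx ex] := h1 (w - z *: y).
have e : T (w - z *: y) = y.
  apply: (res_vec_ext hP) => n; rewrite (P_resolvent _ _ hT).
  rewrite (linB (res_linear hP n)) (linZ (res_linear hP n)) h -scalerBl scalerA.
  by rewrite mulVf ?scale1r// resolvent_neq_lam.
rewrite e in dx ex; split=> //.
by move/eqP: ex; rewrite subr_eq subrK => /eqP.
Qed.

Lemma P_act n x : dom A x -> P n (A x) = lam n *: P n x.
Proof.
move=> dx; have [z hz _] := A_resolvent_small sa ltr01.
have hT := resolventP hz; set T := resolvent A z in hT.
have [_ _ h2] := hT; have lP := res_linear hP n.
have := P_resolvent n (A x - z *: x) hT; rewrite h2// (linB lP) (linZ lP) => e.
have : (lam n - z) *: P n x = P n (A x) - z *: P n x.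
  by rewrite {1}e scalerA mulfV ?scale1r// resolvent_neq_lam.
by rewrite scalerBl => /addIr.
Qed.

(** The diagonal operator with entries (lam n - z)^-1. *)
Lemma diag_resolvent z (d : R) : 0 < d -> (forall n, d <= rnorm (lam n - z)) ->
  exists2 T, is_resolvent A z T & opbound T d^-1.
Proof.
move=> d0 hz.
have nz n : lam n - z != 0.
  by rewrite -rnorm_eq0E gt_eqF// (lt_le_trans d0).
have [|n|D [lD bD PD]] := @diagonal_operator _ _ _ hd _ hP (fun n => (lam n - z)^-1) d^-1.
- by rewrite invr_ge0 ltW.
- by rewrite rnormV lef_pV2 ?posrE ?(lt_le_trans d0).
exists D => //; split; first exact: bounded_opI lD bD.
- move=> x; have [dx ex] : dom A (D x) /\ A (D x) = x + z *: D x.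
    apply: dom_criterion => m; have lP := res_linear hP m.
    rewrite (linD lP) (linZ lP) PD !scalerA -[X in X + _]scale1r -scalerDl.
    congr (_ *: _); rewrite -{1}(mulfV (nz m)) -mulrDl subrK//.
  by split=> //; rewrite ex addrK.
move=> x dx; apply: (res_vec_ext hP) => m; have lP := res_linear hP m.
by rewrite PD (linB lP) (linZ lP) P_act// -scalerBl scalerA mulVf ?scale1r.
Qed.

Lemma small_resolvent (eps : R) : 0 < eps -> exists z T, is_resolvent A z T /\ opbound T eps.
Proof.
move=> e0; have [z hz hn] := A_resolvent_small sa e0.
exists z, (resolvent A z); split; first exact: resolventP.
by apply: op_norm_opbound hn; case: (resolventP hz) => -[].
Qed.

Lemma gap_le m n : m != n -> gap lam <= rnorm (lam m - lam n).
Proof.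
move=> mn; apply: inf_lbound; last by exists (m, n).
by exists 0 => _ [p _ <-].
Qed.

End NormalOperator.

Lemma telescope_sub (V : zmodType) (p q r t p' q' r' s : V) :
  (p - q - r + t) - (p' - q' - r' + t) = (p - p') - (q - q') - ((r - s) + (s - r')).
Proof.
have -> : r - s + (s - r') = r - r' by rewrite addrA subrK.
have -> : p - q - r + t - (p' - q' - r' + t) = (p - q - r) - (p' - q' - r').
  by rewrite [- (_ + t)]opprD addrACA subrr addr0.
by rewrite (subrACA (p - q)) (subrACA p).
Qed.

(** * The block transforms and the fixed point *)

Section Transformations.
Variables (R : realType) (H : completeNormedModType R[i]).
Local Notation C := R[i].
Variable dot : {dot H for Num.conj}.
Hypothesis hd : hilbert_inner_product dot.
Variables (lam : int -> C) (mult : int -> nat) (P : int -> H -> H).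
Hypothesis hP : resolution_of_identity dot P.
Variable e : int * nat -> H.
Hypothesis he : adapted_basis dot P mult e.
Variable delta : R.
Hypothesis delta0 : 0 < delta.
Hypothesis hgap : forall m n, m != n -> delta <= rnorm (lam m - lam n).

Local Notation J := (Jmap dot P).
Local Notation G := (Gmap dot lam P).
Local Notation hs := (hsle e).

Let ho : onb dot e. Proof. by case: he. Qed.

(** [J] keeps the diagonal blocks: multiplier 1 on the pairs (n, n). *)
Lemma Jmap_spec X a : hs X a -> hs (J X) a /\
  forall m n x, P m (J X (P n x)) = if m == n then P m (X (P n x)) else 0.
Proof.
move=> hX; pose g (n : int) := (n, n).
have gi : injective g by move=> m n [].
have [|S [E hS h1 h2]] := block_sum hd hP he gi ler01 (c := fun=> 1) _ hX.
  by move=> _; rewrite rnorm1.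
have {}E : J X = S.
  rewrite -E /Jmap; congr hs_sum; apply/funext => n; apply/funext => x.
  by rewrite scale1r.
rewrite E; rewrite mul1r in hS; split=> // m n x.
case: eqVneq => [->|mn]; first by have := h1 n x; rewrite scale1r.
apply: h2 => i; apply/eqP => -[im in_]; by rewrite -im -in_ eqxx in mn.
Qed.

(** [G] multiplies the off-diagonal blocks by numbers of modulus at most 1 / delta. *)
Lemma Gmap_spec X a : hs X a -> hs (G X) (delta^-1 * a) /\
  forall m n x, P m (G X (P n x)) =
    if m == n then 0 else (lam m - lam n)^-1 *: P m (X (P n x)).
Proof.
move=> hX; pose c (p : int * int) : C := if p.1 == p.2 then 0 else (lam p.1 - lam p.2)^-1.
have K0 : 0 <= delta^-1 by rewrite invr_ge0 ltW.
have cK p : rnorm (c p) <= delta^-1.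
  rewrite /c; case: eqVneq => [_|h]; first by rewrite rnorm0.
  by rewrite rnormV lef_pV2 ?posrE ?hgap// (lt_le_trans delta0)// hgap.
have [S [E hS h1 h2]] := block_sum hd hP he (g := id) (fun _ _ => id) K0 cK hX.
have {}E : G X = S.
  rewrite -E /Gmap; congr hs_sum; apply/funext => p; apply/funext => x.
  by rewrite /c; case: ifP => _; rewrite ?scale0r.
rewrite E; split=> // m n x; have := h1 (m, n) x; rewrite /c /= => ->.
by case: eqVneq => _; rewrite ?scale0r.
Qed.

(** No rearrangement of the defining sums is needed: the blocks of both sides agree. *)
Lemma JmapB X Y a b : hs X a -> hs Y b ->
  forall x, J (fun x => X x - Y x) x = J X x - J Y x.
Proof.
move=> hX hY.
have [h1 e1] := Jmap_spec (hsleB hd ho hX hY).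
have [h2 e2] := Jmap_spec hX; have [h3 e3] := Jmap_spec hY.
apply: (res_block_ext hP (hsle_bop h1)) => [|m n x].
  exact: bounded_opB (hsle_bop h2) (hsle_bop h3).
rewrite (linB (res_linear hP m)) e1 e2 e3; case: eqVneq => _; last by rewrite subrr.
by rewrite (linB (res_linear hP m)).
Qed.

Lemma GmapB X Y a b : hs X a -> hs Y b ->
  forall x, G (fun x => X x - Y x) x = G X x - G Y x.
Proof.
move=> hX hY.
have [h1 e1] := Gmap_spec (hsleB hd ho hX hY).
have [h2 e2] := Gmap_spec hX; have [h3 e3] := Gmap_spec hY.
apply: (res_block_ext hP (hsle_bop h1)) => [|m n x].
  exact: bounded_opB (hsle_bop h2) (hsle_bop h3).
rewrite (linB (res_linear hP m)) e1 e2 e3; case: eqVneq => _; first by rewrite subrr.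
by rewrite (linB (res_linear hP m)) scalerBr.
Qed.

Section FixedPoint.
Variables (B : H -> H) (b : R).
Hypotheses (hB : hs B b) (bdelta : b < delta / 4).
Local Notation F := (Phi dot lam P B).

Let b0 : 0 <= b := hsle_ge0 hB.
Let dn0 : delta != 0. Proof. by rewrite gt_eqF. Qed.

Let b4 : 4 * b < delta. Proof. by move: bdelta; rewrite ltr_pdivlMr// mulrC. Qed.

Lemma hs_BG X a : hs X a -> hs (B \o G X) (b * (delta^-1 * a)).
Proof.
by move=> hX; apply: (hsle_compl (hsle_bop hB) b0 (hsle_opbound hd ho hB)); exact: (Gmap_spec hX).1.
Qed.

Lemma hs_JBG X a : hs X a -> hs (J (B \o G X)) (b * (delta^-1 * a)).
Proof. by move=> /hs_BG/Jmap_spec[]. Qed.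

(** On the ball of radius delta each of the four terms of Phi has norm at most b. *)
Lemma hs_Phi X : hs X delta -> hs (F X) (4 * b).
Proof.
move=> hX; have [hG _] := Gmap_spec hX; have [hJ _] := Jmap_spec hB.
rewrite (_ : 4 * b = b * (delta^-1 * delta) + delta^-1 * delta * b
   + delta^-1 * delta * (b * (delta^-1 * delta)) + b); last by field.
apply: (hsleD hd ho) => //; apply: (hsleB hd ho); first apply: (hsleB hd ho).
- exact: hs_BG.
- exact: (hsle_comp hd ho hG hJ).
- exact: (hsle_comp hd ho hG (hs_JBG hX)).
Qed.

Lemma hs_Phi_delta X : hs X delta -> hs (F X) delta.
Proof. by move=> /hs_Phi; apply: hsle_le; exact: ltW. Qed.

Definition contraction_ratio : R := 4 * b / delta.

Lemma contraction_ratio_ge0 : 0 <= contraction_ratio.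
Proof. by rewrite divr_ge0 ?mulr_ge0// ltW. Qed.

Lemma contraction_ratio_lt1 : contraction_ratio < 1.
Proof. by rewrite ltr_pdivrMr// mul1r. Qed.

(** The difference of the values of Phi is the sum of four terms, each of norm at
    most b d / delta. *)
Lemma Phi_contraction X Y d : hs X delta -> hs Y delta -> hs (fun x => X x - Y x) d ->
  hs (fun x => F X x - F Y x) (contraction_ratio * d).
Proof.
move=> hX hY hD; set D := fun x => X x - Y x.
have [hGD _] := Gmap_spec hD; have [hJ _] := Jmap_spec hB; have [hGY _] := Gmap_spec hY.
have lB := hsle_lin hB.
have lGX := hsle_lin (Gmap_spec hX).1; have lGY := hsle_lin (Gmap_spec hY).1.
have GD x : G D x = G X x - G Y x := GmapB hX hY x.
have BGD x : (B \o G D) x = (B \o G X) x - (B \o G Y) x by rewrite /= GD (linB lB).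
have JD x : J (B \o G D) x = J (B \o G X) x - J (B \o G Y) x.
  by rewrite -(JmapB (hs_BG hX) (hs_BG hY)); congr (J _ x); apply/funext.
have -> : (fun x => F X x - F Y x) = fun x =>
    B (G D x) - G D (J B x) - (G D (J (B \o G X) x) + G Y (J (B \o G D) x)).
  apply/funext => x; rewrite /Phi !GD JD (linB lB) (linB lGY).
  exact: telescope_sub.
rewrite (_ : contraction_ratio * d = b * (delta^-1 * d) + delta^-1 * d * b
   + (delta^-1 * d * (b * (delta^-1 * delta)) + delta^-1 * delta * (b * (delta^-1 * d))));
  last by rewrite /contraction_ratio; field.
apply: (hsleB hd ho); first apply: (hsleB hd ho).
- exact: hs_BG.
- exact: (hsle_comp hd ho hGD hJ).
apply: (hsleD hd ho).
- exact: (hsle_comp hd ho hGD (hs_JBG hX)).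
- exact: (hsle_comp hd ho hGY (hs_JBG hD)).
Qed.

Lemma hs_delta0 : hs (fun=> 0) delta.
Proof. exact: (hsle_le (ltW delta0) (hsle0 e)). Qed.

(** Banach's fixed point argument in the ball of radius delta. *)
Lemma Phi_fixed_point : exists Xs : H -> H,
  [/\ hs_limit dot (fun k => iter k F (fun=> 0)) Xs, hs Xs (4 * b) & F Xs = Xs].
Proof.
pose u k := iter k F (fun=> 0 : H).
have hu k : hs (u k) delta.
  by elim: k => [|k IH]; [exact: hs_delta0|exact: hs_Phi_delta].
have step k : hs (fun x => u k x - u k.+1 x) (delta * contraction_ratio ^+ k).
  elim: k => [|k IH].
    rewrite expr0 mulr1 -[X in hs _ X]add0r; apply: (hsleB hd ho) (hu 1%N).
    exact: hsle0.
  by rewrite exprS mulrCA; exact: (Phi_contraction (hu k) (hu k.+1) IH).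
pose D i j a := hs (fun x => u i x - u j x) a.
have chain k l : (k <= l)%N -> D k l (delta * contraction_ratio ^+ k / (1 - contraction_ratio)).
  move=> kl; apply: (@geometric_chain R D _ _ _ _ _ _ _ _ _ _ _ kl); rewrite /D.
  - exact: ltW.
  - exact: contraction_ratio_ge0.
  - exact: contraction_ratio_lt1.
  - exact: step.
  - by move=> i; under eq_fun do rewrite subrr; exact: hsle0.
  - by move=> i j n a a'; exact: (hsle_dist_trans hd ho).
  - by move=> i j a a'; exact: hsle_le.
have cauchy (eps : R) : 0 < eps -> exists2 U, (\oo : set_system nat) U &
    forall s t, U s -> U t -> hs (fun x => u s x - u t x) eps.
  move=> e0; have [N hN] := @geometric_small R delta contraction_ratio contraction_ratio_ge0
    contraction_ratio_lt1 eps e0.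
  exists [set k | (N <= k)%N]; first by exists N.
  move=> s t /= Ns Nt; case: (leqP s t) => [st|/ltnW ts].
    exact: (hsle_le (ltW (hN _ Ns)) (chain _ _ st)).
  exact: (hsle_distC (hsle_le (ltW (hN _ Nt)) (chain _ _ ts))).
have [X [cX hX]] := hs_complete hd ho cauchy.
have hXd : hs X delta by apply: (hsle_lim hd ho _ cX); near=> k; exact: hu.
have fX : F X = X.
  apply/funext => x; apply/eqP; rewrite -subr_eq0; apply/eqP.
  apply: (@rnorm_small_eq0 _ _ _ (2 * rnorm x)) => d d0.
  have [N _ hN] := hX d d0.
  have h1 : hs (fun x => u N x - X x) d by apply: hN => /=.
  have h2 : hs (fun x => u N.+1 x - X x) d by apply: hN => /=.
  have h3 := Phi_contraction hXd (hu N) (hsle_distC h1).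
  have := hsle_opbound hd ho (hsle_dist_trans hd ho h3 h2) x.
  move/le_trans; apply; rewrite [leRHS]mulrAC ler_wpM2r// mulr_natl mulr2n lerD2r.
  by rewrite ler_piMl ?ltW// contraction_ratio_lt1.
exists X; split=> //; last by rewrite -fX; exact: hs_Phi.
split; first exact: (hsle_hs hd ho hXd).
apply/(hs_cvgP hd ho) => [k|]; last exact: hX.
exact: bounded_opB (hsle_bop (hu k)) (hsle_bop hXd).
Unshelve. all: by end_near. Qed.

Section Solution.
Variable X : H -> H.
Hypotheses (hX : hs X (4 * b)) (fX : F X = X).
Local Notation U := (G X).
Local Notation V := (J X).

Lemma hs_U : hs U contraction_ratio.
Proof. by have := (Gmap_spec hX).1; rewrite mulrC. Qed.

(** Apply J to the equation X = Phi X: the operators G X (J B) and G X (J (B (G X)))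
    have zero diagonal blocks, being products of a block-off-diagonal and a
    block-diagonal operator. *)
Lemma Jmap_solution : V = fun x => J B x + J (B \o U) x.
Proof.
have hXd : hs X delta by apply: hsle_le hX; exact: ltW.
have [hV eV] := Jmap_spec hX; have [hJ eJ] := Jmap_spec hB.
have hJB := hs_JBG hXd; have [_ eJB] := Jmap_spec (hs_BG hXd).
have [hG eG] := Gmap_spec hX.
apply/funext; apply: (res_block_ext hP (hsle_bop hV)) => [|m n x].
  exact: bounded_opD (hsle_bop hJ) (hsle_bop hJB).
have lP := res_linear hP.
have GJ Y a : hs Y a -> (forall m n x, P m (Y (P n x)) = if m == n then P m (Y (P n x)) else 0) ->
    P n (U (Y (P n x))) = 0.
  move=> hY eY; rewrite (_ : Y (P n x) = P n (Y (P n x))); first by rewrite eG eqxx.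
  apply: (res_vec_ext hP) => k; rewrite (res_comp hP) eY.
  by case: eqVneq => // ->.
rewrite (linD (lP m)) eV eJ eJB; case: eqVneq => [->|_]; last by rewrite addr0.
rewrite -{1}fX /Phi (linD (lP n)) !(linB (lP n)).
rewrite (GJ _ _ hJ); last by move=> m' n' y; rewrite eJ; case: ifP.
rewrite (GJ _ _ hJB); last by move=> m' n' y; rewrite eJB; case: ifP.
by rewrite !subr0 addrC.
Qed.

Lemma hs_V : hs V (2 * b).
Proof.
rewrite Jmap_solution (_ : 2 * b = b + b); last by rewrite mulr_natl mulr2n.
apply: (hsleD hd ho); first by have := (Jmap_spec hB).1.
have hXd : hs X delta by apply: hsle_le hX; exact: ltW.
by have := hs_JBG hXd; rewrite mulVf// mulr1.
Qed.

(** With V = J B + J (B U) the fixed point equation takes this closed form. *)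
Lemma solution_equation x : X x = B x + B (U x) - U (V x).
Proof.
rewrite Jmap_solution -{1}fX /Phi (linD (hsle_lin hs_U)).
by rewrite opprD -addrA -addrA [RHS]addrC addrC -!addrA; do ?congr (_ + _); rewrite addrC.
Qed.

Lemma V_block m n x : m != n -> P m (V (P n x)) = 0.
Proof. by move=> mn; rewrite (Jmap_spec hX).2 (negbTE mn). Qed.

Lemma V_comm n x : P n (V x) = V (P n x).
Proof.
have [hV eV] := Jmap_spec hX.
move: x; apply: (res_block_ext hP) => [||m k x].
- exact: bounded_op_comp (res_bounded hP n) (hsle_bop hV).
- exact: bounded_op_comp (hsle_bop hV) (res_bounded hP n).
rewrite !(res_comp hP); case: eqVneq => [->|mn].
  rewrite eV; case: eqVneq => [->|_]; first by rewrite eV eqxx.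
  by rewrite (lin0 (hsle_lin hV)) (lin0 (res_linear hP _)).
case: eqVneq => [kn|_]; last by rewrite (lin0 (hsle_lin hV)) (lin0 (res_linear hP _)).
by rewrite eV -kn (negbTE mn).
Qed.

End Solution.

End FixedPoint.

End Transformations.

(** * Consequences of similarity *)

Section Similarity.
Variables (R : realType) (H : completeNormedModType R[i]).
Local Notation C := R[i].

Lemma similar_resolvent (A1 A2 : unbounded_op H) (W W' : H -> H) z T :
  similarity_transform A1 A2 W -> inverse_op W W' -> is_resolvent A2 z T ->
  is_resolvent A1 z (W \o T \o W').
Proof.
move=> [bW _ dW sW] [bW' K1 K2] [bT h1 h2]; have [lW _] := bW; have [lW' _] := bW'.
split; first by apply: bounded_op_comp bW'; exact: bounded_op_comp.
  move=> x /=; have [dx ex] := h1 (W' x).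
  split; first by rewrite -dW; exists (T (W' x)).
  by rewrite sW// -(linZ lW) -(linB lW) ex K2.
move=> x; rewrite -dW => -[y dy <-] /=.
by rewrite sW// -(linZ lW) -(linB lW) K1 h2.
Qed.

Lemma similarity_sym (A1 A2 : unbounded_op H) (W W' : H -> H) :
  similarity_transform A1 A2 W -> inverse_op W W' -> similarity_transform A2 A1 W'.
Proof.
move=> [bW _ dW sW] [bW' K1 K2]; split=> //.
- by exists W; split.
- apply/seteqP; split=> [_ [x + <-]|x dx].
    by rewrite -dW => -[y dy <-]; rewrite K1.
  by exists (W x); rewrite ?K1// -dW; exists x.
by move=> x; rewrite -dW => -[y dy <-]; rewrite K1 sW// K1.
Qed.

Lemma similar_spectrum (A1 A2 : unbounded_op H) (W : H -> H) :
  similarity_transform A1 A2 W -> spectrum A1 = spectrum A2.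
Proof.
move=> sW; have [_ [W' iW] _ _] := sW.
have iW' : inverse_op W' W by case: iW sW => b k1 k2 [bW _ _ _]; split.
congr (~` _); apply/seteqP; split=> z [T hT].
  exists (W' \o T \o W); exact: similar_resolvent (similarity_sym sW iW) iW' hT.
exists (W \o T \o W'); exact: similar_resolvent sW iW hT.
Qed.

Lemma resolvent_similarity (A1 A2 : unbounded_op H) (W W' : H -> H) z :
  similarity_transform A1 A2 W -> inverse_op W W' -> resolvent_set A2 z ->
  resolvent A1 z = W \o resolvent A2 z \o W'.
Proof.
move=> sW iW hz; apply: resolventE.
exact: similar_resolvent sW iW (resolventP hz).
Qed.

Variable dot : {dot H for Num.conj}.
Hypothesis hd : hilbert_inner_product dot.

(** The inner product for which W', hence W, becomes unitary. *)
Lemma pullback_dot (W' : H -> H) : linear W' -> injective W' ->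
  exists d : {dot H for Num.conj}, forall x y, d x y = dot (W' x) (W' y).
Proof.
move=> lW iW.
pose f (x y : H) : C := dot (W' x) (W' y).
have al u' : zmod_morphism (f ^~ u') by move=> x y; rewrite /f (linB lW) dotBl.
have ar u : zmod_morphism (f u) by move=> x y; rewrite /f (linB lW) dotBr.
have sl u' : scalable_for *%R (f ^~ u') by move=> a x; rewrite /f (linZ lW) dotZl.
have sr u : scalable_for (Num.conj \; *%R) (f u) by move=> a x; rewrite /f (linZ lW) dotZr.
have he x y : f x y = (-1) ^+ false * Num.conj (f y x).
  by rewrite expr0 mul1r /f dotC.
have pos u : u != 0 -> 0 < f u u.
  move=> u0; apply: neq0_dnorm_gt0; apply: contra u0 => /eqP e.
  by apply/eqP/iW; rewrite e (lin0 lW).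
pose b := isBilinear.Build C H H C *%R (Num.conj \; *%R) f al ar sl sr.
pose h := isHermitianSesquilinear.Build C H false Num.conj f he.
pose p := isDotProduct.Build C H f pos.
by exists (HB.pack_for {dot H for Num.conj} f b h p).
Qed.

Lemma pullback_equivalent (W W' : H -> H) (d : {dot H for Num.conj}) :
  (forall x y, d x y = dot (W' x) (W' y)) -> bounded_op W -> inverse_op W W' ->
  equivalent_inner_product d.
Proof.
move=> dE /bounded_opP[_ [M M0 bM]] [/bounded_opP[_ [N N0 bN]] _ K2].
exists ((M ^- 2)%:C), ((N ^+ 2)%:C); split.
- by rewrite ltcR invr_gt0 exprn_gt0.
- by rewrite ltcR exprn_gt0.
move=> x; rewrite dE (dot_self hd) rnormE -rmorphXn -!rmorphM !lecR.
apply/andP; split.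
  rewrite ler_pdivrMl ?exprn_gt0// -exprMn ler_pXn2r ?nnegrE ?mulr_ge0// ?(ltW M0)//.
  by rewrite -{1}(K2 x).
by rewrite -exprMn ler_pXn2r ?nnegrE ?mulr_ge0// ltW.
Qed.

Lemma pullback_resolution (P : int -> H -> H) (W W' : H -> H) (d : {dot H for Num.conj}) :
  (forall x y, d x y = dot (W' x) (W' y)) -> bounded_op W -> inverse_op W W' ->
  resolution_of_identity dot P ->
  resolution_of_identity d (fun n : int => W \o P n \o W').
Proof.
move=> dE bW [bW' K1 K2] hP; have [lW [M M0 hM]] := (bounded_opP _).1 bW.
split.
- move=> n; split.
  + apply: bounded_op_comp bW'; apply: bounded_op_comp => //; exact: res_bounded hP n.
  + by move=> x /=; rewrite K1 (res_idem hP).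
  + by move=> x y /=; rewrite !dE /= !K1 (res_sym hP).
- by move=> m n mn x /=; rewrite K1 (res_orth hP _ mn) (lin0 lW).
move=> x; have := cvg_opbound (FF := totally_F _) lW hM (res_cvg hP (x := W' x)).
rewrite K2 (_ : W \o _ = partial_sum (fun n => (W \o P n \o W') x))//.
by apply/funext => F; rewrite /= !partial_sumE (linsum lW).
Qed.

End Similarity.

(** * Algebra of circle integrals *)

Section CircleIntegralAlgebra.
Variable R : realType.
Local Notation C := R[i].
Variables (c : C) (r : R).

Definition circle_loclip (f : C -> C) := loclip (fun t => f (c + r%:C * cis t)).

Let circle_loclipM f : circle_loclip f ->
  loclip (fun t => f (c + r%:C * cis t) * ('i * r%:C * cis t)).
Proof.
move=> hf; apply: loclipM => //.
by apply: loclipM; [exact: loclip_cst|exact: loclip_cis].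
Qed.

Lemma circle_integral_ext (f g : C -> C) :
  (forall t, f (c + r%:C * cis t) = g (c + r%:C * cis t)) ->
  circle_integral f c r = circle_integral g c r.
Proof. by move=> h; congr complex_integral; apply/funext => t; rewrite h. Qed.

Lemma circle_integralD f g : circle_loclip f -> circle_loclip g ->
  circle_integral (fun z => f z + g z) c r = circle_integral f c r + circle_integral g c r.
Proof.
move=> hf hg; rewrite /circle_integral -complex_integralD; try exact: circle_loclipM.
by congr complex_integral; apply/funext => t; rewrite mulrDl.
Qed.

Lemma circle_integralZ a f : circle_loclip f ->
  circle_integral (fun z => a * f z) c r = a * circle_integral f c r.
Proof.
move=> hf; rewrite /circle_integral -complex_integralZ; last exact: circle_loclipM.
by congr complex_integral; apply/funext => t; rewrite mulrA.
Qed.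

Lemma circle_loclipZ a f : circle_loclip f -> circle_loclip (fun z => a * f z).
Proof. by move=> hf; apply: loclipM hf; exact: loclip_cst. Qed.

Lemma circle_integral_bound f (M : R) : circle_loclip f ->
  (forall t, rnorm (f (c + r%:C * cis t)) <= M) ->
  rnorm (circle_integral f c r) <= 4 * pi * (M * `|r|).
Proof.
move=> hf fM; apply: complex_integral_bound; first exact: circle_loclipM.
by move=> t; rewrite !rnormM rnorm_i rnormR rnorm_cis mul1r mulr1 ler_wpM2r.
Qed.

End CircleIntegralAlgebra.

Lemma shift_sub (V : zmodType) (a p p' q : V) : a - p - q = (a - p' - q) + (p' - p).
Proof. by rewrite [a - p' - q]addrAC -[RHS]addrA addKr addrAC. Qed.

Lemma half_gap (R : realFieldType) (d p q : R) : d <= p -> p <= q + d / 2 -> d / 2 <= q.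
Proof. lra. Qed.

(** * Riesz projections of a block-diagonal perturbation *)

Section BlockPerturbation.
Variables (R : realType) (H : completeNormedModType R[i]).
Local Notation C := R[i].
Variable dot : {dot H for Num.conj}.
Hypothesis hd : hilbert_inner_product dot.
Variables (A : unbounded_op H) (lam : int -> C) (mult : int -> nat) (P : int -> H -> H).
Hypothesis sa : standing_assumptions dot A lam mult P.
Local Notation delta := (gap lam).
Hypothesis delta0 : 0 < delta.
Variables (V : H -> H) (v : R).
Hypotheses (lV : linear V) (v0 : 0 <= v) (bV : opbound V v) (vd : v < delta / 2).
Hypothesis VP : forall n x, P n (V x) = V (P n x).

Let lA : linear_op A := A_linear sa.
Let hP : resolution_of_identity dot P := P_resolution sa.
Let d20 : 0 < delta / 2. Proof. by rewrite divr_gt0. Qed.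

(** [V] commutes with [A] because it commutes with every [P n]. *)
Lemma V_dom y : dom A y -> dom A (V y) /\ A (V y) = V (A y).
Proof.
by move=> dy; apply: (dom_criterion hd sa) => m; rewrite !VP (P_act hd sa _ dy) (linZ lV).
Qed.

Lemma far_from_spectrum n z : rnorm (z - lam n) = delta / 2 ->
  forall m, delta / 2 <= rnorm (lam m - z).
Proof.
move=> hz m; have [->|mn] := eqVneq m n; first by rewrite rnorm_distC hz.
have h1 := gap_le lam mn; have h2 := rnorm_distD z (lam m) (lam n).
by rewrite hz in h2; exact: half_gap h1 h2.
Qed.

Lemma spectrum_disc n : [set lam n] = spectrum A `&` [set z | rnorm (z - lam n) < delta / 2].
Proof.
rewrite (A_spectrum sa); apply/seteqP; split=> [z /= ->|z [[m _ <-] /=]].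
  by split; [exists n|rewrite /= subrr rnorm0].
have [->//|mn] := eqVneq m n; move/ltW => h; have := le_trans (gap_le lam mn) h.
by rewrite ler_pdivlMr// ger_pMr// leNgt ltr1n.
Qed.

Lemma circle_resolvent n :
  [set z | rnorm (z - lam n) = delta / 2] `<=` resolvent_set A.
Proof.
by move=> z /= /far_from_spectrum hz; have [T hT _] := diag_resolvent hd sa d20 hz; exists T.
Qed.

Lemma rnorm_circle n (t : R) :
  rnorm (lam n + (delta / 2)%:C * cis t - lam n) = delta / 2.
Proof. by rewrite addrC addKr rnormM rnorm_cis mulr1 rnormR ger0_norm// ltW. Qed.

Lemma riesz_A n x y : dot (P n x) y =
  - (2 * pi%:C * 'i)^-1 * circle_integral (fun z => dot (resolvent A z x) y) (lam n) (delta / 2).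
Proof.
have [rho rho0 h] := riesz_circle hd (P_riesz sa n).
have m0 : 0 < Num.min rho (delta / 2) by rewrite lt_min rho0.
rewrite (h (Num.min rho (delta / 2))); last by rewrite m0 ge_min lexx.
congr (_ * _); symmetry.
apply: (@circle_shrink _ _ _ (lam n) (lam n) (delta / 2) _ (fun u => dot u y) (rnorm y) x) => //.
- exact: linear_dotl.
- exact: opbound_dotl.
- exact: spectrum_disc.
- exact: circle_resolvent.
by rewrite m0 subrr rnorm0 subr0 ge_min lexx orbT.
Qed.

Let sV (s : R) x := s%:C *: V x.
Let vd1 : v * (delta / 2)^-1 < 1. Proof. by rewrite ltr_pdivrMr// mul1r. Qed.
Let M := (delta / 2)^-1 * (1 - v * (delta / 2)^-1)^-1.
Let M0 : 0 <= M. Proof. by apply: mulr_ge0; rewrite invr_ge0 ?subr_ge0; apply: ltW. Qed.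

Let lsV s : linear (sV s).
Proof. by move=> a x y; rewrite /sV lV scalerDr !scalerA mulrC. Qed.

Lemma segment_resolvent s z : 0 <= s <= 1 -> (forall m, delta / 2 <= rnorm (lam m - z)) ->
  exists2 T, is_resolvent (sub_op A (sV s)) z T & opbound T M.
Proof.
move=> /andP[s0 s1] hz; have [T hT bT] := diag_resolvent hd sa d20 hz.
apply: (resolvent_perturb hT _ bT (lsV s) v0 _ vd1).
  by rewrite invr_ge0 ltW.
move=> x; rewrite /sV rnormZ rnormR ger0_norm//.
by apply: le_trans (bV x); rewrite ler_piMl.
Qed.

(** [V] commutes with [A], hence with A - sV, on the domain of [A]. *)
Lemma segment_comm s z T u : is_resolvent (sub_op A (sV s)) z T -> T (V u) = V (T u).
Proof.
move=> [_ h1 h2]; have [/= dy ey] := h1 u.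
have [dV eV] := V_dom dy.
rewrite -[RHS](h2 _ dV) /= eV -{1}ey /sV.
by rewrite !(linB lV) !(linZ lV).
Qed.

(** The second resolvent identity. *)
Lemma segment_diff s s' z T T' x : is_resolvent (sub_op A (sV s)) z T ->
  is_resolvent (sub_op A (sV s')) z T' -> T' x = T x + (s' - s)%:C *: T' (V (T x)).
Proof.
move=> [_ h1 _] [[lT' _] _ h2]; have [/= dy ey] := h1 x.
have := h2 _ dy; rewrite /= => e2.
have e3 : x = (A (T x) - sV s' (T x) - z *: T x) + (s' - s)%:C *: V (T x).
  by rewrite -{1}ey rmorphB scalerBl; exact: shift_sub.
by rewrite {1}e3 (linD lT') e2 (linZ lT').
Qed.

Let sub_op0 : sub_op A (sV 0) = A.
Proof.
rewrite /sub_op; case: A => D a /=; congr UnboundedOp; apply/funext => x.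
by rewrite /sV scale0r subr0.
Qed.

Let sub_op1 : sub_op A (sV 1) = sub_op A V.
Proof.
by rewrite /sub_op; congr UnboundedOp; apply/funext => x; rewrite /sV scale1r.
Qed.

(** Deform [A] into A - V along A - sV. As [V] commutes with the resolvent T_s of
    A - sV, the derivative of T_s x in s is T_s T_s V x, which is also the derivative
    of T_s V x in z; so the contour integral is constant in s. *)
Lemma riesz_V n x y : dot (P n x) y = - (2 * pi%:C * 'i)^-1 *
  circle_integral (fun z => dot (resolvent (sub_op A V) z x) y) (lam n) (delta / 2).
Proof.
rewrite riesz_A -{1}sub_op0 -sub_op1; congr (_ * _).
pose phi u : C := dot u y.
have lphi : linear phi := linear_dotl dot y.
have bphi : opbound phi (rnorm y) := opbound_dotl hd y.
pose cir t := lam n + (delta / 2)%:C * cis t.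
pose S := [set z | exists t, z = cir t].
pose T s z := resolvent (sub_op A (sV s)) z.
have far z : S z -> forall m, delta / 2 <= rnorm (lam m - z).
  by move=> [t ->]; apply: far_from_spectrum; exact: rnorm_circle.
have TR s z : 0 <= s <= 1 -> S z -> is_resolvent (sub_op A (sV s)) z (T s z) /\ opbound (T s z) M.
  move=> hs /far hz; have [T0 hT0 bT0] := segment_resolvent hs hz.
  by rewrite /T (resolventE hT0).
have bT s (hs : 0 <= s <= 1) z : S z -> opbound (T s z) M by move=> Sz; have [_ bTz] := TR s z hs Sz.
have eT s (hs : 0 <= s <= 1) w z u : S w -> S z ->
    T s w u = T s z u + (w - z) *: T s w (T s z u).
  by move=> Sw Sz; have [h1 _] := TR s w hs Sw; have [h2 _] := TR s z hs Sz; exact: (resolvent_eq u h1 h2).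
have holo s (hs : 0 <= s <= 1) u := resolvent_holo M0 (bT s hs) (eT s hs) (rnorm_ge0 y) lphi bphi u.
have holo' s (hs : 0 <= s <= 1) u z (Sz : S z) := resolvent_deriv_bound M0 (bT s hs) (rnorm_ge0 y) bphi u Sz.
have Sc t : S (cir t) by exists t.
have cl s (hs : 0 <= s <= 1) u : circle_loclip (lam n) (delta / 2) (fun z => phi (T s z u)).
  exact: (holo_loclip (holo s hs u) (holo' s hs u) Sc (circle_cderiv (lam n) (delta / 2))).
have cl' s (hs : 0 <= s <= 1) u : circle_loclip (lam n) (delta / 2) (fun z => phi (T s z (T s z u))).
  exact: (holo_deriv_loclip (holo s hs u) Sc (circle_cderiv (lam n) (delta / 2))).
pose F s := circle_integral (fun z => phi (T s z x)) (lam n) (delta / 2).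
symmetry; pose K := rnorm y * (M * (v * (M * (v * (M * rnorm x))))).
apply: (@quadratic_increment_constant R F (4 * pi * (K * `|delta / 2|))) => s s' hs hs'.
pose h := s' - s.
(* the last term integrates to 0, and [D] is quadratic in [h] *)
pose D z := (phi (T s' z x) + -1 * phi (T s z x)) + (- h%:C) * phi (T s z (T s z (V x))).
have c1 : circle_loclip (lam n) (delta / 2) (fun z => -1 * phi (T s z x)).
  by apply: circle_loclipZ; exact: cl.
have c2 : circle_loclip (lam n) (delta / 2) (fun z => (- h%:C) * phi (T s z (T s z (V x)))).
  by apply: circle_loclipZ; exact: cl'.
have c3 : circle_loclip (lam n) (delta / 2) (fun z => phi (T s' z x) + -1 * phi (T s z x)).
  by apply: loclipD => //; exact: cl.
have cD : circle_loclip (lam n) (delta / 2) D by exact: loclipD.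
have -> : F s' - F s = circle_integral D (lam n) (delta / 2).
  rewrite (circle_integralD c3 c2) (circle_integralD (cl s' hs' x) c1).
  rewrite (circle_integralZ _ (cl s hs x)) (circle_integralZ _ (cl' s hs (V x))).
  rewrite (circle_integral_primitive (holo s hs (V x)) (holo' s hs (V x)) Sc).
  by rewrite mulr0 addr0 mulN1r.
rewrite (_ : 4 * pi * _ * _ = 4 * pi * (K * h ^+ 2 * `|delta / 2|)); last by rewrite /h; ring.
apply: circle_integral_bound => // t.
have [hR bR] := TR s _ hs (Sc t); have [hR' bR'] := TR s' _ hs' (Sc t).
set Q := T s (cir t) in hR bR; set Q' := T s' (cir t) in hR' bR'.
have -> : D (cir t) = h%:C ^+ 2 * phi (Q' (V (Q (V (Q x))))).
  rewrite /D -/Q -/Q' (segment_diff x hR hR') (segment_diff (V (Q x)) hR hR').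
  rewrite (segment_comm x hR).
  rewrite !(linD lphi) !(linZ lphi) !(linD lphi) !(linZ lphi) -/h /GRing.scale /=; ring.
rewrite rnormM rnormX rnormR real_normK ?num_real// mulrC ler_wpM2r ?sqr_ge0//.
apply: le_trans (bphi _) _; rewrite ler_wpM2l//.
apply: le_trans (bR' _) _; rewrite ler_wpM2l//.
apply: le_trans (bV _) _; rewrite ler_wpM2l//.
apply: le_trans (bR _) _; rewrite ler_wpM2l//.
by apply: le_trans (bV _) _; rewrite ler_wpM2l.
Qed.

Lemma circle_resolvent_V n z : rnorm (z - lam n) = delta / 2 -> resolvent_set (sub_op A V) z.
Proof.
move=> /far_from_spectrum hz; rewrite -sub_op1.
have [|T hT _] := @segment_resolvent 1 z _ hz; first by rewrite ler01 lexx.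
by exists T.
Qed.

End BlockPerturbation.

(** * Schur's inequality for eigenvalues *)

Section SchurInequality.
Variable R : realType.
Local Notation C := R[i].
Local Open Scope sesquilinear_scope.

Lemma frobenius_trace n (M : 'M[C]_n) :
  \sum_i \sum_j (rnorm (M i j) ^+ 2)%:C = \tr (M *m M ^t Num.conj).
Proof.
rewrite /mxtrace; apply: eq_bigr => i _; rewrite mxE; apply: eq_bigr => j _.
by rewrite !mxE -normCK rnormE rmorphXn.
Qed.

(** Schur triangularization by a unitary matrix preserves the sum of the squared
    moduli of the entries, and the diagonal entries are part of them. *)
Lemma schur_eigenvalues n (M : 'M[C]_n) : exists d : 'I_n -> C,
  (forall a, eigenvalue M a = [exists i, a == d i]) /\
  \sum_i rnorm (d i) ^+ 2 <= \sum_i \sum_j rnorm (M i j) ^+ 2.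
Proof.
case: n => [|n] in M *.
  exists (fun=> 0); split=> [a|]; last by rewrite !big_ord0.
  apply/idP/idP => [/eigenvalueP[v _]|/existsP[[]//]].
  by rewrite [v]thinmx0 eqxx.
have [Q uQ] := Schur M (ltn0Sn n).
rewrite /similar_to (conjymx M uQ) => tN.
set N := Q *m M *m _ in tN.
have QQ : Q *m Q ^t Num.conj = 1%:M by apply/unitarymxP.
have QQ' : Q ^t Num.conj *m Q = 1%:M by exact: mulmx1C.
exists (fun i => N i i); split=> [a|].
  transitivity (eigenvalue N a).
    apply/eigenvalueP/eigenvalueP => -[v va v0].
      exists (v *m Q ^t Num.conj).
        by rewrite /N !mulmxA -(mulmxA v) QQ' mulmx1 va scalemxAl.
      apply: contra v0 => /eqP h.
      by rewrite -[v]mulmx1 -QQ' mulmxA h mul0mx.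
    exists (v *m Q).
      by rewrite -[_ *m M]mulmx1 -QQ' mulmxA -(mulmxA v) -(mulmxA v) va scalemxAl.
    apply: contra v0 => /eqP h.
    by rewrite -[v]mulmx1 -QQ mulmxA h mul0mx.
  rewrite eigenvalue_root_char char_poly_trig//.
  rewrite -(big_map (fun i => N i i) predT (fun x => 'X - x%:P)) root_prod_XsubC.
  apply/mapP/existsP => [[i _ ->]|[i /eqP ->]]; exists i => //.
  by rewrite mem_index_enum.
have -> : \sum_i \sum_j rnorm (M i j) ^+ 2 = \sum_i \sum_j rnorm (N i j) ^+ 2.
  apply: complexI; rewrite !rmorph_sum.
  under eq_bigr do rewrite rmorph_sum; under [RHS]eq_bigr do rewrite rmorph_sum.
  rewrite !frobenius_trace /N !trmx_mul !map_mxM trmxCK.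
  rewrite [in RHS]mxtrace_mulC -!mulmxA [in RHS](mulmxA _ Q) QQ' mul1mx.
  by rewrite [in RHS]mxtrace_mulC -!mulmxA QQ' mulmx1 mxtrace_mulC.
apply: ler_sum => i _; rewrite (bigD1 i)//= lerDl sumr_ge0// => j _.
exact: sqr_ge0.
Qed.

End SchurInequality.

Lemma sub3D (V : zmodType) (a b c d e f : V) :
  (a + b) - (c + d) - (e + f) = (a - c - e) + (b - d - f).
Proof. by rewrite [- (c + d)]opprD [- (e + f)]opprD [X in X + _ = _]addrACA [LHS]addrACA. Qed.

(** * Spectrum of a block-diagonal perturbation *)

Section BlockSpectrum.
Variables (R : realType) (H : completeNormedModType R[i]).
Local Notation C := R[i].
Variable dot : {dot H for Num.conj}.
Hypothesis hd : hilbert_inner_product dot.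
Variables (A : unbounded_op H) (lam : int -> C) (mult : int -> nat) (P : int -> H -> H).
Hypothesis sa : standing_assumptions dot A lam mult P.
Local Notation delta := (gap lam).
Hypothesis delta0 : 0 < delta.
Variable e : int * nat -> H.
Hypothesis he : adapted_basis dot P mult e.
Variables (V : H -> H) (v : R).
Hypotheses (lV : linear V) (v0 : 0 <= v) (bV : opbound V v) (vd : v < delta / 2).
Hypothesis VP : forall n x, P n (V x) = V (P n x).

Let lA : linear_op A := A_linear sa.
Let hP : resolution_of_identity dot P := P_resolution sa.
Let lP n : linear (P n) := res_linear hP n.
Let d20 : 0 < delta / 2. Proof. by rewrite divr_gt0. Qed.

Let b n (i : 'I_(mult n)) := e (n, i : nat).
Definition vec n (c : 'rV[C]_(mult n)) : H := \sum_i c 0 i *: b i.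
Definition coords n (x : H) : 'rV[C]_(mult n) := \row_i dot x (b i).
Definition block n : 'M[C]_(mult n) := \matrix_(i, j) dot (V (b i)) (b j).

Lemma basis_dot n (i j : 'I_(mult n)) : dot (b i) (b j) = (i == j)%:R.
Proof.
case: he => -[h1 _ _] _ h2 _; case: eqVneq => [->|ij].
  by rewrite h2 ltn_ord.
by rewrite h1//; apply: contra ij => /eqP[/val_inj ->].
Qed.

Lemma P_basis n (i : 'I_(mult n)) : P n (b i) = b i.
Proof. by case: he => _ h _ _; rewrite h eqxx. Qed.

Lemma P_vec n (c : 'rV[C]_(mult n)) : P n (vec c) = vec c.
Proof.
rewrite /vec (linsum (lP n)); apply: eq_bigr => i _.
by rewrite (linZ (lP n)) P_basis.
Qed.

Lemma vec_coords n x : vec (coords n x) = P n x.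
Proof. by case: he => _ _ _ ->; apply: eq_bigr => i _; rewrite mxE. Qed.

Lemma coords_vec n (c : 'rV[C]_(mult n)) : coords n (vec c) = c.
Proof.
apply/rowP => i; rewrite mxE /vec dot_suml (bigD1 i)//= dotZl basis_dot eqxx mulr1.
by rewrite big1 ?addr0// => j ji; rewrite dotZl basis_dot (negbTE ji) mulr0.
Qed.

Lemma linear_vec n : linear (@vec n).
Proof.
move=> a c d; rewrite /vec scaler_sumr -big_split; apply: eq_bigr => i _.
by rewrite !mxE scalerDl scalerA.
Qed.

Lemma V_vec n (c : 'rV[C]_(mult n)) : V (vec c) = vec (c *m block n).
Proof.
rewrite -[vec c]P_vec -VP -vec_coords; congr vec.
apply/rowP => j; rewrite !mxE /vec (linsum lV) dot_suml; apply: eq_bigr => i _.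
by rewrite (linZ lV) dotZl mxE.
Qed.

(** On the range of [P n] the operator A - V - z is a matrix in the adapted basis. *)
Lemma AV_vec n (c : 'rV[C]_(mult n)) z : dom A (vec c) /\
  A (vec c) - V (vec c) - z *: vec c = vec (c *m ((lam n - z)%:M - block n)).
Proof.
have [dx ex] := P_eigen hd sa n (vec c); rewrite P_vec in dx ex.
split=> //; rewrite ex V_vec mulmxBr (linB (@linear_vec n)) mul_mx_scalar (linZ (@linear_vec n)).
by rewrite scalerBl addrAC.
Qed.

Lemma eigen_in_spectrum n a : eigenvalue (block n) a -> spectrum (sub_op A V) (lam n - a).
Proof.
move=> /eigenvalueP[c ca c0] [T [bT _ h2]].
have [dx ex] := AV_vec c (lam n - a).
have := h2 _ dx; rewrite /= ex mulmxBr mul_mx_scalar subKr ca subrr.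
rewrite (lin0 (@linear_vec n)) (lin0 (bT.1)) => h.
by move/eqP: c0; apply; rewrite -[c]coords_vec -h; apply/rowP => i; rewrite !mxE dot0l.
Qed.

(** Two eigenvalues within half the gap from [z] would be closer than the gap. *)
Lemma exceptional_block z : exists n0, forall n, n != n0 -> delta / 2 <= rnorm (lam n - z).
Proof.
have [[n0 h]|h] := pselect (exists n, rnorm (lam n - z) < delta / 2).
  exists n0 => n nn; have h1 := gap_le lam nn; have h2 := rnorm_distD z (lam n) (lam n0).
  apply: half_gap h1 (le_trans h2 _).
  by rewrite lerD2l rnorm_distC ltW.
by exists 0 => n _; rewrite leNgt; apply/negP => hn; apply: h; exists n.
Qed.

Lemma bounded_op_rank1 (u w : H) : bounded_op (fun x => dot x u *: w).
Proof.
apply: (@bounded_opI _ _ _ (rnorm u * rnorm w)).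
  by move=> a x y; rewrite dotDl dotZl scalerDl scalerA.
by move=> x; rewrite rnormZ mulrAC ler_wpM2r// mulrC cauchy_schwarz.
Qed.

Lemma bounded_block_map n (K : 'M[C]_(mult n)) : bounded_op (fun x => vec (coords n x *m K)).
Proof.
have -> : (fun x => vec (coords n x *m K)) =
    fun x => \sum_i \sum_j K j i *: (dot x (b j) *: b i).
  apply/funext => x; rewrite /vec; apply: eq_bigr => i _; rewrite mxE scaler_suml.
  by apply: eq_bigr => j _; rewrite mxE scalerA mulrC.
apply: bounded_op_sum => i; apply: bounded_op_sum => j.
by apply: bounded_opZ; exact: bounded_op_rank1.
Qed.

(** On the complement of the exceptional block the diagonal part dominates [V], so a
    Neumann series inverts A - V - z there; on the block itself it is a matrix
    without zero eigenvalue. The two inverses add up because [V] respects the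
    decomposition. *)
Lemma block_resolvent n0 z :
  (forall n, n != n0 -> delta / 2 <= rnorm (lam n - z)) ->
  ~~ eigenvalue (block n0) (lam n0 - z) -> resolvent_set (sub_op A V) z.
Proof.
move=> hz hn0.
set K := (lam n0 - z)%:M - block n0.
have uK : K \in unitmx.
  rewrite unitmxE unitfE; apply: contra hn0 => /det0P[c c0 cK].
  apply/eigenvalueP; exists c => //; apply/eqP; rewrite -subr_eq0 -opprB oppr_eq0.
  by rewrite -mul_mx_scalar -mulmxBr cK.
(* reduced resolvent of A: the exceptional block is left out *)
pose t n := if n == n0 then 0 else (lam n - z)^-1.
have nz n : n != n0 -> lam n - z != 0.
  by move=> nn; rewrite -rnorm_eq0E gt_eqF// (lt_le_trans d20)// hz.
have [||D [lD bD PD]] := @diagonal_operator _ _ _ hd _ hP t (delta / 2)^-1.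
- by rewrite invr_ge0 ltW.
- move=> n; rewrite /t; case: eqVneq => [_|nn]; first by rewrite rnorm0 invr_ge0 ltW.
  by rewrite rnormV lef_pV2 ?posrE ?hz// (lt_le_trans d20)// hz.
have D0 : 0 <= (delta / 2)^-1 by rewrite invr_ge0 ltW.
have vd1 : v * (delta / 2)^-1 < 1 by rewrite ltr_pdivrMr// mul1r.
have lVD : linear (V \o D) by exact: linear_comp.
have [N [lN bN N1 N2]] := neumann lVD (introT andP (conj (mulr_ge0 v0 D0) vd1)) (opbound_comp v0 bV bD).
have AD y : P n0 y = 0 -> dom A (D y) /\ A (D y) = y + z *: D y.
  move=> y0; apply: (dom_criterion hd sa) => m.
  rewrite (linD (@lP m)) (linZ (@lP m)) PD /t; case: eqVneq => [->|mn].
    by rewrite y0 scale0r !scaler0 addr0.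
  rewrite !scalerA -[X in X + _]scale1r -scalerDl; congr (_ *: _).
  by rewrite -{1}(mulfV (nz m mn)) -mulrDl subrK.
have PN x : P n0 x = 0 -> P n0 (N x) = 0.
  move=> x0; have := N1 x => /= /eqP; rewrite subr_eq => /eqP ->.
  by rewrite (linD (@lP n0)) x0 VP PD /t eqxx scale0r (lin0 lV) addr0.
pose T x := D (N (x - P n0 x)) + vec (coords n0 x *m invmx K).
have bT : bounded_op T.
  apply: bounded_opD; last exact: bounded_block_map.
  apply: (@bounded_op_comp _ _ D (fun x => N (x - P n0 x))).
    exact: bounded_opI lD bD.
  apply: (@bounded_op_comp _ _ N (fun x => x - P n0 x)).
    exact: bounded_opI lN bN.
  by apply: bounded_opB; [exact: bounded_op_id|exact: res_bounded hP n0].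
have inj x : dom A x -> A x - V x - z *: x = 0 -> x = 0.
  move=> dx hx; apply: (res_vec_ext hP) => n; rewrite (lin0 (@lP n)).
  have hn : (lam n - z) *: P n x = V (P n x).
    have : P n (A x - V x - z *: x) = 0 by rewrite hx (lin0 (@lP n)).
    rewrite !(linB (@lP n)) (linZ (@lP n)) (P_act hd sa _ dx) VP addrAC -scalerBl.
    by move/eqP; rewrite subr_eq0 => /eqP.
  have [nn|nn] := eqVneq n n0; last first.
    apply: rnorm_eq0; apply/eqP; rewrite eq_le rnorm_ge0 andbT.
    have h1 := bV (P n x); rewrite -hn rnormZ in h1.
    have h2 := ler_wpM2r (rnorm_ge0 (P n x)) (hz n nn).
    rewrite leNgt; apply/negP => p0.
    have := le_trans h2 h1; rewrite ler_pM2r// => h3.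
    by have := le_lt_trans h3 vd; rewrite ltxx.
  rewrite nn in hn *; rewrite -vec_coords in hn *.
  have : vec (coords n0 x *m K) = 0.
    rewrite /K mulmxBr (linB (@linear_vec n0)) mul_mx_scalar (linZ (@linear_vec n0)).
    by rewrite -V_vec hn subrr.
  move/(congr1 (@coords n0)); rewrite coords_vec => h.
  have -> : coords n0 x = 0.
    rewrite -[coords n0 x](mulmxK uK) h (_ : coords n0 0 = 0) ?mul0mx//.
    by apply/rowP => i; rewrite !mxE dot0l.
  exact: lin0 (@linear_vec n0).
have right x : dom A (T x) /\ A (T x) - V (T x) - z *: T x = x.
  have x0 : P n0 (x - P n0 x) = 0 by rewrite (linB (@lP n0)) (res_idem hP) subrr.
  have [d1 e1] := AD _ (PN _ x0).
  have [d2 e2] := AV_vec (coords n0 x *m invmx K) z.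
  rewrite -/K mulmxKV// vec_coords in e2.
  split; first exact: domD.
  rewrite /T (actD lA d1 d2) (linD lV) scalerDr sub3D e2 e1.
  rewrite [_ - z *: _]addrAC addrK.
  by have := N1 (x - P n0 x); rewrite /= => ->; rewrite subrK.
exists T; split=> // x dx; apply/eqP; rewrite -subr_eq0; apply/eqP.
have [d1 e1] := right (A x - V x - z *: x).
apply: inj; first exact: domB.
rewrite (actB lA d1 dx) (linB lV) scalerBr [X in X - _ = _]subrACA [LHS]subrACA e1.
by rewrite subrr.
Qed.

Lemma spectrum_block : spectrum (sub_op A V) =
  [set z | exists n, eigenvalue (block n) (lam n - z)].
Proof.
apply/seteqP; split=> [z hz|z [n hn]]; last first.
  by have := eigen_in_spectrum hn; rewrite subKr.
have [n0 hn0] := exceptional_block z; exists n0.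
by apply: contrapT => /negP h; apply: hz; exact: (block_resolvent hn0 h).
Qed.

Lemma block_norm n : \sum_i \sum_j rnorm (block n i j) ^+ 2 =
  \sum_(i < mult n) rnorm (V (e (n, i : nat))) ^+ 2.
Proof.
apply: eq_bigr => i _.
have E : V (b i) = \sum_j block n i j *: b j.
  by rewrite -[b i]P_basis -VP -vec_coords; apply: eq_bigr => j _; rewrite !mxE.
rewrite -/(b i) E (pythagoras_sum hd (index_enum_uniq _)).
  apply: eq_bigr => j _; rewrite rnormZ.
  have : rnorm (b j) ^+ 2 = 1 by rewrite (rnorm_sq_dot hd) basis_dot eqxx.
  by move/eqP; rewrite sqrp_eq1// => /eqP ->; rewrite mulr1.
move=> j k jk; rewrite dotZl dotZr basis_dot (negbTE jk) !mulr0//.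
Qed.

Hypothesis hsV : hsle e V v.

(** In each block the list of eigenvalues comes from Schur's inequality, and the
    right-hand sides add up to the squared Hilbert-Schmidt norm of [V]. *)
Lemma block_eigenvalues : exists beta : int -> nat -> C,
  (\esum_(p in [set p : int * nat | (p.2 < mult p.1)%N])
     ((rnorm (beta p.1 p.2)) ^+ 2)%:E < +oo)%E /\
  spectrum (sub_op A V) = [set z | exists n i, (i < mult n)%N /\ z = lam n - beta n i].
Proof.
pose d n := sval (cid (schur_eigenvalues (block n))).
have d1 n a : eigenvalue (block n) a = [exists i, a == d n i].
  by rewrite /d; case: cid => x /= [].
have d2 n : \sum_i rnorm (d n i) ^+ 2 <= \sum_(i < mult n) rnorm (V (e (n, i : nat))) ^+ 2.
  by rewrite -block_norm /d; case: cid => x /= [].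
pose beta n (i : nat) : C := if insub i is Some j then d n j else 0.
have betaE n (i : 'I_(mult n)) : beta n i = d n i by rewrite /beta valK.
exists beta; split; last first.
  rewrite spectrum_block; apply/seteqP; split=> [z [n]|z [n [i [im ->]]]].
    rewrite d1 => /existsP[i /eqP h]; exists n, i; split=> //.
    by rewrite betaE -h subKr.
  exists n; rewrite subKr d1; apply/existsP; exists (Ordinal im).
  by rewrite -(betaE n (Ordinal im)) eqxx.
have setE : [set p : int * nat | (p.2 < mult p.1)%N] = [set: int] `*`` (fun n => `I_(mult n)).
  by apply/seteqP; split=> [[n i]|[n i] []].
have sumE (h : int * nat -> R) : (forall p, 0 <= h p) ->
    \esum_(p in [set p : int * nat | (p.2 < mult p.1)%N]) (h p)%:E =
    \esum_(n in [set: int]) (\sum_(i < mult n) h (n, i : nat))%:E.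
  move=> h0; rewrite setE.
  transitivity (\esum_(p in [set: int] `*`` (fun n => `I_(mult n))) (h (p.1, p.2))%:E).
    by apply: eq_esum => -[].
  rewrite -(@esum_esum _ _ _ [set: int] (fun n => `I_(mult n)) (fun n i => (h (n, i))%:E)); last first.
    by move=> n i _ _; rewrite lee_fin.
  apply: eq_esum => n _; rewrite esum_fset//; last by move=> i _; rewrite lee_fin.
  by rewrite -fsbig_ord sumEFin.
rewrite (sumE (fun p => rnorm (beta p.1 p.2) ^+ 2)); last by move=> p; exact: sqr_ge0.
case: hsV => _ _ h; apply: le_lt_trans (ltry (v ^+ 2)); apply: le_trans h.
apply: (@le_trans _ _ (\esum_(p in [set p : int * nat | (p.2 < mult p.1)%N]) (rnorm (V (e p)) ^+ 2)%:E)).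
  rewrite sumE; last by move=> p; exact: sqr_ge0.
  apply: le_esum => n _; rewrite lee_fin; under eq_bigr do rewrite betaE.
  exact: d2.
rewrite esum_mkcond; apply: le_esum => p _; case: ifP => // _.
by rewrite lee_fin sqr_ge0.
Qed.

End BlockSpectrum.

Lemma cancel_perturbation (V : zmodType) (a u s t v : V) :
  a + (u + (s - t - v)) - s = a - v + (u - t).
Proof.
have -> : u + (s - t - v) = s + (u - t - v) by rewrite !addrA [u + s]addrC.
by rewrite addrCA [LHS]addrC addKr [u - t - v]addrC addrA.
Qed.

(** * The similarity of A - B and A - V *)

Section Intertwining.
Variables (R : realType) (H : completeNormedModType R[i]).
Local Notation C := R[i].
Variable dot : {dot H for Num.conj}.
Hypothesis hd : hilbert_inner_product dot.
Variables (A : unbounded_op H) (lam : int -> C) (mult : int -> nat) (P : int -> H -> H).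
Hypothesis sa : standing_assumptions dot A lam mult P.
Hypothesis delta0 : 0 < gap lam.
Variable e : int * nat -> H.
Hypothesis he : adapted_basis dot P mult e.
Variables (B : H -> H) (b : R).
Hypotheses (hB : hsle e B b) (bdelta : b < gap lam / 4).
Variable X : H -> H.
Hypotheses (hX : hsle e X (4 * b)) (fX : Phi dot lam P B X = X).
Local Notation U := (Gmap dot lam P X).
Local Notation V := (Jmap dot P X).

Let lA : linear_op A := A_linear sa.
Let hP : resolution_of_identity dot P := P_resolution sa.
Let lP n : linear (P n) := res_linear hP n.
Let ho : onb dot e. Proof. by case: he. Qed.
Let hgap : forall m n, m != n -> gap lam <= rnorm (lam m - lam n) := @gap_le _ lam.
Let hU : hsle e U (contraction_ratio (gap lam) b) := hs_U hd hP he delta0 hgap hX.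
Let hV : hsle e V (2 * b) := hs_V hd hP he delta0 hgap hB bdelta hX fX.
Let q0 := contraction_ratio_ge0 delta0 hB.
Let q1 := contraction_ratio_lt1 delta0 bdelta.

(** The relation A U - U A = X - V, block by block: (lam m - lam n) times the block
    of [U] is the off-diagonal block of [X]. Writing x = T w with a resolvent T of
    [A] reduces it to an identity between bounded operators. *)
Lemma U_commutator x : dom A x -> dom A (U x) /\ A (U x) = U (A x) + (X x - V x).
Proof.
move=> dx; have [z hz _] := A_resolvent_small sa ltr01.
have hT := resolventP hz; set T := resolvent A z in hT.
have [bT _ h2] := hT; have [lT _] := bT.
have [lU bU] := (hsle_bop hU); have bU' := hsle_bop hU; have bV' := hsle_bop hV.
have bX' := hsle_bop hX; have lV := hsle_lin hV; have lX := hsle_lin hX.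
pose w := A x - z *: x; have xw : x = T w by rewrite h2.
have Aw : A x = w + z *: T w by rewrite -xw /w subrK.
apply: (dom_criterion hd sa) => m.
(* both sides of the block equation, as bounded operators in w *)
pose Z1 y := P m (U (y + z *: T y) + (X (T y) - V (T y))).
pose Z2 y := lam m *: P m (U (T y)).
have bPm := res_bounded hP m.
have bUT : bounded_op (fun y => U (T y)) by exact: bounded_op_comp.
have b1 : bounded_op Z1.
  apply: (@bounded_op_comp _ _ (P m) (fun y => U (y + z *: T y) + (X (T y) - V (T y)))) => //.
  apply: bounded_opD; last by apply: bounded_opB; exact: bounded_op_comp.
  apply: (@bounded_op_comp _ _ U (fun y => y + z *: T y)) => //.
  by apply: bounded_opD; [exact: bounded_op_id|exact: bounded_opZ].
have b2 : bounded_op Z2.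
  by apply: bounded_opZ; apply: (@bounded_op_comp _ _ (P m) (fun y => U (T y))).
suff E : Z1 w = Z2 w by move: E; rewrite /Z1 /Z2 -Aw -xw.
have /bounded_opP[l1 [M1 _ o1]] := b1; have /bounded_opP[l2 [M2 _ o2]] := b2.
apply: (res_op_ext hP l1 o1 l2 o2) => n y.
rewrite /Z1 /Z2 (resolvent_P hd sa _ _ hT).
have nz := resolvent_neq_lam sa n hz.
rewrite scalerA -[X in U (X + _)]scale1r -scalerDl.
have -> : 1 + z * (lam n - z)^-1 = lam n * (lam n - z)^-1.
  by rewrite -{1}(mulfV nz) -mulrDl subrK.
rewrite !(linZ lU) !(linZ lX) !(linZ lV) -scalerBr (linD (@lP m)) !(linZ (@lP m)) (linB (@lP m)).
have [_ eG] := Gmap_spec hd hP he delta0 hgap hX; have [_ eJ] := Jmap_spec hd hP he hX.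
rewrite eG eJ; case: eqVneq => [->|mn]; first by rewrite !scaler0 subrr scaler0 addr0.
have ml : lam m - lam n != 0 by rewrite subr_eq0 (lam_inj hd sa).
rewrite subr0 !scalerA -scalerDl; congr (_ *: _); field.
by rewrite nz ml.
Qed.

Let W x := x + U x.

Lemma W_bounded : bounded_op W.
Proof. by apply: bounded_opD; [exact: bounded_op_id|exact: hsle_bop hU]. Qed.

Lemma W_intertwines x : dom A x ->
  dom A (W x) /\ A (W x) - B (W x) = W (A x - V x).
Proof.
move=> dx; have [dU eU] := U_commutator dx.
split; first exact: domD.
rewrite /W (actD lA dx dU) eU (linD (hsle_lin hB)) (linB (hsle_lin hU)).
rewrite (solution_equation hd hP he delta0 hgap hB bdelta hX fX x).
exact: cancel_perturbation.
Qed.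

(** A Neumann series, since the norm of [U] is less than 1. *)
Lemma W_invertible : exists W', inverse_op W W'.
Proof.
have lN : linear (fun x => - U x).
  by move=> k x y; rewrite (hsle_lin hU) opprD scalerN.
have bN : opbound (fun x => - U x) (contraction_ratio (gap lam) b).
  by move=> x; rewrite rnormN; exact: (hsle_opbound hd ho hU).
have [T [lT bT T1 T2]] := neumann lN (introT andP (conj q0 q1)) bN.
exists T; split; first exact: bounded_opI lT bT.
  by move=> x; have := T2 x; rewrite opprK.
by move=> x; have := T1 x; rewrite opprK.
Qed.

(** It remains to see that [W] maps the domain onto itself. At a point z where the
    resolvent of [A] is small enough both A - B and A - V have resolvents, and these
    are intertwined by [W]; so W^-1 maps the range of one resolvent into the range of
    the other, and both ranges are the domain of [A]. *)
Lemma W_similarity : similarity_transform (sub_op A B) (sub_op A V) W.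
Proof.
have b0 := hsle_ge0 hB.
have lB := hsle_lin hB; have bB := hsle_opbound hd ho hB.
have lV := hsle_lin hV; have bV := hsle_opbound hd ho hV.
(* a resolvent of A of norm 1 / (2 b + 1) beats both B and V *)
have c0 : 0 < 2 * b + 1 by rewrite ltr_wpDl// mulr_ge0.
have eps0 : 0 < (2 * b + 1)^-1 by rewrite invr_gt0.
have [z [T [hT bT]]] := small_resolvent sa eps0.
have [|TB hTB _] := resolvent_perturb hT (ltW eps0) bT lB b0 bB.
  by rewrite ltr_pdivrMr// mul1r; lra.
have [||TV hTV _] := resolvent_perturb hT (ltW eps0) bT lV _ bV.
- by rewrite mulr_ge0.
- by rewrite ltr_pdivrMr// mul1r ltrDl.
have lW : linear W by case: W_bounded.
split; [exact: W_bounded|exact: W_invertible| |by move=> x dx; exact: (W_intertwines dx).2].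
apply/seteqP; split=> [_ [x dx <-]|y dy]; first by have [] := W_intertwines dx.
have [W' [_ K1 K2]] := W_invertible.
have [_ hV1 _] := hTV; have [_ hB1 hB2] := hTB.
have WT w : W (TV w) = TB (W w).
  have [/= dv ev] := hV1 w; have [dw ew] := W_intertwines dv.
  by rewrite -(hB2 _ dw) /= ew -(linZ lW) -(linB lW) ev.
have dy' : dom A y := dy.
exists (TV (W' (A y - B y - z *: y))).
  by have [] := hV1 (W' (A y - B y - z *: y)).
by rewrite WT K2; apply: (hB2 _ dy).
Qed.

End Intertwining.

(** * Conclusion *)

Section RieszSimilar.
Variables (R : realType) (H : completeNormedModType R[i]).
Local Notation C := R[i].
Variable dot : {dot H for Num.conj}.
Hypothesis hd : hilbert_inner_product dot.
Variables (A : unbounded_op H) (lam : int -> C) (mult : int -> nat) (P : int -> H -> H).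
Hypothesis sa : standing_assumptions dot A lam mult P.
Hypothesis delta0 : 0 < gap lam.
Variable e : int * nat -> H.
Hypothesis he : adapted_basis dot P mult e.
Variables (V : H -> H) (v : R).
Hypotheses (lV : linear V) (v0 : 0 <= v) (bV : opbound V v) (vd : v < gap lam / 2).
Hypothesis VP : forall n x, P n (V x) = V (P n x).

(** Conjugating by [W] carries the resolvent of A - V to that of A1, and the
    contour integral formula with it; the functional u -> <W u, y> is represented by
    a vector. *)
Lemma riesz_similar (A1 : unbounded_op H) (W W' : H -> H) n :
  similarity_transform A1 (sub_op A V) W -> inverse_op W W' ->
  exists s, riesz_projection dot A1 s (W \o P n \o W').
Proof.
move=> sW iW; have [bW' _ _] := iW; have [bW _ _ _] := sW.
have hP := P_resolution sa.
have d20 : 0 < gap lam / 2 by rewrite divr_gt0.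
have crV := circle_resolvent_V hd sa delta0 lV v0 bV vd.
exists (spectrum A1 `&` [set z | rnorm (z - lam n) < gap lam / 2]); split.
  by apply: bounded_op_comp bW'; apply: bounded_op_comp => //; exact: res_bounded hP n.
exists (lam n), (gap lam / 2); split=> //.
  move=> z /crV[T hT]; exists (W \o T \o W'); exact: similar_resolvent sW iW hT.
move=> x y; have [ho _ _ _] := he.
have [lW [M M0 bM]] := (bounded_opP _).1 bW.
have [w hw] : exists w, forall u, dot (W u) y = dot u w.
  apply: (riesz_representation hd ho (B := rnorm y * M)).
    by move=> k u u'; rewrite lW dotDl dotZl.
  exact: (opbound_comp (rnorm_ge0 y) (opbound_dotl hd y) bM).
rewrite /= hw (riesz_V hd sa delta0 lV v0 bV vd VP); congr (_ * _).
apply: circle_integral_ext => t.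
have hz := crV n _ (rnorm_circle delta0 n t).
by rewrite (resolvent_similarity sW iW hz) /= hw.
Qed.

End RieszSimilar.

Theorem theorem4p1 (R : realType) (H : completeNormedModType R[i])
    (dot : {dot H for Num.conj}) (A : unbounded_op H) (lam : int -> R[i])
    (mult : int -> nat) (P : int -> H -> H) (B : H -> H) :
  hilbert_inner_product dot ->
  separable_space H ->
  standing_assumptions dot A lam mult P ->
  hilbert_schmidt dot B ->
  (hs_norm dot B < (gap lam / 4)%:E)%E ->
  exists Xs : H -> H,
    hs_limit dot (fun k => iter k (Phi dot lam P B) (fun=> 0)) Xs /\
    let U := Gmap dot lam P Xs in
    let V := Jmap dot P Xs in
    let W := fun x => x + U x in
    [/\ (* (1) *)
        [/\ hilbert_schmidt dot U, hilbert_schmidt dot V &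
            similarity_transform (sub_op A B) (sub_op A V) W],
        (* (2) *)
        (forall m n, m != n -> forall x, P m (V (P n x)) = 0) /\
        (forall W', inverse_op W W' ->
          let P' := fun n : int => W \o P n \o W' in
          (forall n, exists s, riesz_projection dot (sub_op A B) s (P' n)) /\
          exists2 dot' : {dot H for Num.conj},
            equivalent_inner_product dot' & resolution_of_identity dot' P') &
        (* (3) *)
        exists b : int -> nat -> R[i],
          (\esum_(p in [set p : int * nat | (p.2 < mult p.1)%N])
             ((rnorm (b p.1 p.2)) ^+ 2)%:E < +oo)%E /\
          spectrum (sub_op A B) =
            [set z | exists n i, (i < mult n)%N /\ z = lam n - b n i]].
Proof.
move=> hd _ sa [bB _] nB.
have delta4 : 0 < gap lam / 4 by rewrite -lte_fin; apply: le_lt_trans nB; exact: sqrte_ge0.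
have delta0 : 0 < gap lam by rewrite pmulr_lgt0 ?invr_gt0 in delta4.
have hP := P_resolution sa.
have [e he] := adapted_basis_exists hP (fun n => (range_P hd sa n).2).
have [ho _ _ _] := he.
have [b hB] := hs_norm_lt_hsle hd ho bB nB; rewrite lte_fin => bdelta.
have hgap := @gap_le _ lam.
have [X [limX hX fX]] := Phi_fixed_point hd hP he delta0 hgap hB bdelta.
exists X; split=> // U V W.
have hU : hsle e U _ := hs_U hd hP he delta0 hgap hX.
have hV : hsle e V (2 * b) := hs_V hd hP he delta0 hgap hB bdelta hX fX.
have simW : similarity_transform (sub_op A B) (sub_op A V) W :=
  W_similarity hd sa delta0 he hB bdelta hX fX.
have lV := hsle_lin hV; have bV := hsle_opbound hd ho hV; have v0 := hsle_ge0 hV.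
have vd : 2 * b < gap lam / 2 by lra.
have VP n x : P n (V x) = V (P n x) by exact: (V_comm hd hP he hX).
split.
- by split=> //; [exact: (hsle_hs hd ho hU)|exact: (hsle_hs hd ho hV)].
- split; first by move=> m n mn x; exact: (V_block hd hP he hX).
  move=> W' iW P'; split.
    by move=> n; exact: (riesz_similar hd sa delta0 he lV v0 bV vd VP n simW iW).
  have [bW _ _ _] := simW; have [bW' K1 K2] := iW.
  have [d dE] := pullback_dot dot bW'.1 (can_inj K2).
  exists d; first exact: (pullback_equivalent hd dE bW iW).
  exact: (pullback_resolution dE bW iW hP).
rewrite (similar_spectrum simW).
exact: (block_eigenvalues hd sa delta0 he lV v0 bV vd VP hV).
Qed.
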